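(* Let $\mathcal A$ be a $C^*$-algebra, $\mathcal H_0$ a Hilbert $\mathcal A$-module, and $P:\mathcal H_0\to\mathcal H_0$ an admissible orthogonal projection. Let $$0\to\operatorname{Ran}(P)\to\mathcal H_0\xrightarrow{A_0}\mathcal H_1\xrightarrow{A_1}\cdots\xrightarrow{A_{n-1}}\mathcal H_n$$ be an admissible resolution of length $n$ of $P$. Let $\widetilde P$ be the orthogonal projection in $\mathcal H_n$ onto $\operatorname{Coker}A_{n-1}=(\operatorname{Ran}A_{n-1})^\perp$, let $\mathcal H=\bigoplus_{k=0}^n\mathcal H_k$, let $A$ be the operator of degree $+1$ in $\mathcal H$ that is the direct sum of all $A_j$, and set $$D=A+A^*+P+(-1)^{n+1}\widetilde P:\mathcal H\to\mathcal H,$$ where $P$ and $\widetilde P$ act in the components $\mathcal H_0$ and $\mathcal H_n$, respectively. Then the positive spectral projection $P_+(D)$ of the self-adjoint operator $D$ is admissible, and the Toeplitz quantization corresponding to $P_+(D)$ is equivalent to the Toeplitz quantization defined by $P$: $$[P]=[P_+(D)]\in K^1(\mathcal A).$$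
   Context: A Hilbert $\mathcal A$-module here means a Hilbert space equipped with a $*$-representation of $\mathcal A$ by bounded operators; the action of $a\in\mathcal A$ is denoted by $a$. A bounded linear operator $D:\mathcal H_1\to\mathcal H_2$ between Hilbert $\mathcal A$-modules is admissible if (1) its range is closed and (2) $Da-aD$ is a compact operator from $\mathcal H_1$ to $\mathcal H_2$ for every $a\in\mathcal A$. In particular, an orthogonal projection is admissible iff it commutes with the action of $\mathcal A$ modulo compact operators. An admissible resolution of length $n$ of an admissible projection $P$ in $\mathcal H_0$ is an exact sequence of Hilbert spaces $0\to\operatorname{Ran}(P)\to\mathcal H_0\xrightarrow{A_0}\mathcal H_1\to\cdots\xrightarrow{A_{n-1}}\mathcal H_n$ (exact at $\operatorname{Ran}(P),\mathcal H_0,\dots,\mathcal H_{n-1}$; the map $\operatorname{Ran}(P)\to\mathcal H_0$ is the inclusion), where all $\mathcal H_j$ are Hilbert $\mathcal A$-modules and all $A_j$ are admissible operators. For $n=0$ the resolution is $0\to\operatorname{Ran}(P)\to\mathcal H_0$ and $\widetilde P=1-P$. The positive spectral projection $P_+(T)$ of a self-adjoint operator $T$ is the spectral projection of $T$ corresponding to $(0,\infty)$. An admissible orthogonal projection $P$ in a Hilbert $\mathcal A$-module $\mathcal E$ defines the Toeplitz quantization $a\mapsto Pa:\operatorname{Ran}P\to\operatorname{Ran}P$, a homomorphism modulo compact operators. Its class in the odd $K$-homology group $K^1(\mathcal A)$, denoted $[P]$, is the class of the odd Fredholm module $(\mathcal E,2P-1)$. Two quantizations are equivalent if their classes in $K^1(\mathcal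 A)$ coincide. *)

(* Defs.v *)
From Stdlib Require Import Relation_Operators.
From HB Require Import structures.
From mathcomp Require Import all_boot all_order all_algebra.
From mathcomp Require Import complex.
From mathcomp Require Import all_classical all_reals all_analysis.

Set Implicit Arguments.
Unset Strict Implicit.
Unset Printing Implicit Defensive.

Import Order.TTheory GRing.Theory Num.Theory.
Import numFieldNormedType.Exports.

Local Open Scope classical_set_scope.
Local Open Scope ring_scope.

(* The product is part of the mixin because MathComp rings are unital, whereas
   a C*-algebra need not have a unit. *)
HB.mixin Record isCStarAlgebra (R : realType) A
    of CompleteNormedModule R[i] A := {
  amul : A -> A -> A ;
  astar : A -> A ;
  amulA : associative amul ;
  amul_linearl : forall b : A, linear (amul ^~ b) ;
  amul_linearr : forall a : A, linear (amul a) ;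
  astarK : involutive astar ;
  astar_semilinear : forall (c : R[i]) (a b : A),
    astar (c *: a + b) = c^* *: astar a + astar b ;
  astarM : forall a b : A, astar (amul a b) = amul (astar b) (astar a) ;
  normr_amul : forall a b : A, `|amul a b| <= `|a| * `|b| ;
  cstar_identity : forall a : A, `|amul (astar a) a| = `|a| ^+ 2
}.

#[short(type="cstarAlgType")]
HB.structure Definition CStarAlgebra (R : realType) :=
  {A of isCStarAlgebra R A & CompleteNormedModule R[i] A}.

(* The inner product is linear in its first argument. *)
HB.mixin Record isHilbert (R : realType) H of CompleteNormedModule R[i] H := {
  inner : {dot H for (@Num.conj R[i])} ;
  inner_norm : forall x : H, inner x x = `|x| ^+ 2
}.

#[short(type="hilbertType")]
HB.structure Definition Hilbert (R : realType) :=
  {H of isHilbert R H & CompleteNormedModule R[i] H}.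

Section DotNorm.
Variables (C : numClosedFieldType) (U : lmodType C).
Variable form : {dot U for (@Num.conj C)}.

Lemma dot_cauchy_schwarz (u v : U) :
  `|form u v| ^+ 2 <= form u u * form v v.
Proof.
have [->|v0] := eqVneq v 0; first by rewrite !linear0r normr0 expr0n.
have b0 : 0 < form v v by rewrite dnorm_gt0.
have bC : (form v v)^* = form v v by rewrite geC0_conj// ltW.
have := dnorm_ge0 form (form v v *: u - form u v *: v).
have -> : form (form v v *: u - form u v *: v) (form v v *: u - form u v *: v)
    = `|form v v| ^+ 2 * form u u + `|form u v| ^+ 2 * form v v
      - (form v v * ((form u v)^* * form u v)
         + (form v v * ((form u v)^* * form u v))^*).
  by rewrite (dnormB form) !dnormZ (linearZl_LR form) (linearZr_LR form).
rewrite [(form u v)^* * form u v]mulrC -normCK (ger0_norm (ltW b0)).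
rewrite rmorphM/= bC (@geC0_conj _ (`|_| ^+ 2)) ?exprn_ge0//.
rewrite [`|_| ^+ 2 * _]mulrC opprD addrA addrK expr2 -mulrA -mulrBr.
by rewrite pmulr_rge0// subr_ge0 [form v v * _]mulrC.
Qed.

Lemma dot_triangle (u v : U) :
  sqrtC (form (u + v) (u + v)) <= sqrtC (form u u) + sqrtC (form v v).
Proof.
have a0 := dnorm_ge0 form u; have b0 := dnorm_ge0 form v.
have s0 : 0 <= sqrtC (form u u) + sqrtC (form v v).
  by rewrite addr_ge0 ?sqrtC_ge0.
rewrite -(@ler_pXn2r _ 2)// ?nnegrE ?sqrtC_ge0 ?dnorm_ge0// sqrtCK.
rewrite (dnormD form) sqrrD !sqrtCK -addrA [leRHS]addrAC -addrA lerD2l.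
rewrite lerD2l.
have -> : form u v + (form u v)^* = 2%:R * 'Re (form u v).
  by rewrite ReE mulrC divfK ?pnatr_eq0.
rewrite -[leRHS]mulr_natl ler_pM2l ?ltr0n//.
rewrite (le_trans (leif_Re_Creal (form u v)))//.
rewrite -(@ler_pXn2r _ 2)// ?nnegrE ?mulr_ge0 ?sqrtC_ge0//.
by rewrite exprMn !sqrtCK dot_cauchy_schwarz.
Qed.

End DotNorm.

Definition hsum (R : realType) (I : finType) (H : I -> hilbertType R) : Type :=
  forall i, H i.

Section HilbertSum.
Variables (R : realType) (I : finType) (H : I -> hilbertType R).
Local Notation C := R[i].
Local Notation V := (hsum H).

HB.instance Definition _ := gen_eqMixin V.
HB.instance Definition _ := gen_choiceMixin V.

Let add (x y : V) : V := fun i => x i + y i.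
Let opp (x : V) : V := fun i => - x i.
Let scale (c : C) (x : V) : V := fun i => c *: x i.

Let addA : associative add.
Proof. by move=> x y z; apply: functional_extensionality_dep => i; rewrite /add addrA. Qed.
Let addC : commutative add.
Proof. by move=> x y; apply: functional_extensionality_dep => i; rewrite /add addrC. Qed.
Let add0 : left_id (fun=> 0) add.
Proof. by move=> x; apply: functional_extensionality_dep => i; rewrite /add add0r. Qed.
Let addN : left_inverse (fun=> 0) opp add.
Proof. by move=> x; apply: functional_extensionality_dep => i; rewrite /add addNr. Qed.

HB.instance Definition _ := GRing.isZmodule.Build V addA addC add0 addN.

Let scaleA (a b : C) (x : V) : scale a (scale b x) = scale (a * b) x.
Proof. by apply: functional_extensionality_dep => i; rewrite /scale scalerA. Qed.
Let scale1 : left_id 1 scale.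
Proof. by move=> x; apply: functional_extensionality_dep => i; rewrite /scale scale1r. Qed.
Let scaleDr : right_distributive scale +%R.
Proof. by move=> a x y; apply: functional_extensionality_dep => i; rewrite /scale scalerDr. Qed.
Let scaleDl (x : V) : {morph scale^~ x : a b / a + b}.
Proof. by move=> a b; apply: functional_extensionality_dep => i; rewrite /scale scalerDl. Qed.

HB.instance Definition _ :=
  GRing.Zmodule_isLmodule.Build C V scaleA scale1 scaleDr scaleDl.

Definition hsum_inner (x y : V) : C := \sum_i inner (x i) (y i).

Let hsum_bilinear : bilinear_for *%R (@Num.conj C \; *%R) hsum_inner.
Proof.
split=> [y c x1 x2|x c y1 y2] /=; rewrite /hsum_inner mulr_sumr -big_split/=;
  by apply: eq_bigr => i _; rewrite ?linearPl ?linearPr.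
Qed.

HB.instance Definition _ := bilinear_isBilinear.Build C V V C
  *%R (@Num.conj C \; *%R) hsum_inner hsum_bilinear.

Let hsum_herm (x y : V) :
  hsum_inner x y = (-1) ^+ false * Num.conj (hsum_inner y x).
Proof.
rewrite expr0 mul1r /hsum_inner rmorph_sum; apply: eq_bigr => i _.
by rewrite hermC expr0 mul1r.
Qed.

HB.instance Definition _ := @isHermitianSesquilinear.Build C V false
  (@Num.conj C) hsum_inner hsum_herm.

Lemma hsum_innerE (x : V) : hsum_inner x x = \sum_i `|x i| ^+ 2.
Proof. by apply: eq_bigr => i _; rewrite inner_norm. Qed.

Let hsum_pos (x : V) : x != 0 -> 0 < hsum_inner x x.
Proof.
move=> x0; rewrite lt_def hsum_innerE sumr_ge0 ?andbT; last first.
  by move=> i _; rewrite exprn_ge0.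
apply: contra x0 => /eqP s0; apply/eqP/functional_extensionality_dep => i.
have := psumr_eq0P (fun i _ => exprn_ge0 2 (normr_ge0 (x i))) s0.
by move=> /(_ i isT)/eqP; rewrite sqrf_eq0 normr_eq0 => /eqP.
Qed.

HB.instance Definition _ := isDotProduct.Build C V hsum_inner hsum_pos.

Definition hsum_norm (x : V) : C := sqrtC (hsum_inner x x).

Let hsum_normD (x y : V) : hsum_norm (x + y) <= hsum_norm x + hsum_norm y.
Proof. exact: dot_triangle. Qed.

Let hsum_normZ (c : C) (x : V) : hsum_norm (c *: x) = `|c| * hsum_norm x.
Proof.
rewrite /hsum_norm dnormZ rootCMl ?exprn_ge0//.
by rewrite sqrCK.
Qed.

Let hsum_norm0 (x : V) : hsum_norm x = 0 -> x = 0.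
Proof. by move/eqP; rewrite sqrt_dnorm_eq0 => /eqP. Qed.

HB.instance Definition _ :=
  Lmodule_isNormed.Build C V hsum_normD hsum_normZ hsum_norm0.

Lemma hsum_normE (x : V) : `|x| = sqrtC (\sum_i `|x i| ^+ 2).
Proof. by rewrite -hsum_innerE. Qed.

Lemma hsum_norm_ge (x : V) i : `|x i| <= `|x|.
Proof.
rewrite -(@ler_pXn2r _ 2)// ?nnegrE// hsum_normE sqrtCK (bigD1 i)//=.
by rewrite lerDl sumr_ge0// => j _; rewrite exprn_ge0.
Qed.

Lemma hsum_norm_le (x : V) : `|x| <= \sum_i `|x i|.
Proof.
rewrite -(@ler_pXn2r _ 2)// ?nnegrE ?sumr_ge0// hsum_normE sqrtCK.
rewrite expr2 mulr_suml ler_sum// => i _; rewrite expr2 ler_wpM2l//.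
by rewrite (bigD1 i)//= lerDl sumr_ge0.
Qed.

Let hsum_complete (F : set_system V) : ProperFilter F -> cauchy F -> cvg F.
Proof.
move=> FF /cauchyP Fc.
have cv i : cvg ((fun x : V => x i) @ F).
  apply: cauchy_cvg; apply/cauchyP => e e0.
  have [x Fx] := Fc e e0; exists (x i).
  have : F [set y : V | ball (x i) e (y i)]; last by [].
  apply: filterS Fx => y /=.
  rewrite -!ball_normE/=; apply: le_lt_trans.
  exact: (hsum_norm_ge (x - y) i).
apply/cvg_ex; exists (fun i => lim ((fun x : V => x i) @ F)).
set l := (X in _ --> X).
apply/cvgrPdist_lt => e e0.
have d0 : 0 < e / #|I|.+1%:R by rewrite divr_gt0.
have : \forall x \near F, forall i, `|l i - x i| < e / #|I|.+1%:R.
  apply: filter_forall => i.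
  by have /cvgrPdist_lt/(_ _ d0) := cv i.
apply: filterS => x lx; rewrite (le_lt_trans (hsum_norm_le _))//.
rewrite (@le_lt_trans _ _ (\sum_(i : I) (e / #|I|.+1%:R)))//.
  by apply: ler_sum => i _; exact: ltW (lx i).
rewrite sumr_const -[ltLHS]mulr_natr mulrAC ltr_pdivrMr// ltr_pM2l//.
by rewrite ltr_nat.
Qed.

HB.instance Definition _ := Uniform_isComplete.Build V hsum_complete.

Let hsum_inner_norm (x : V) : hsum_inner x x = `|x| ^+ 2.
Proof. by rewrite hsum_normE sqrtCK hsum_innerE. Qed.

HB.instance Definition _ := @isHilbert.Build R V hsum_inner hsum_inner_norm.

End HilbertSum.

Section Operators.
Variable R : realType.
Implicit Types H G : hilbertType R.

Definition bounded_op H G (T : H -> G) : Prop :=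
  linear T /\ exists M : R[i], forall x, `|T x| <= M * `|x|.

Definition compact_op H G (T : H -> G) : Prop :=
  bounded_op T /\ precompact (T @` [set x | `|x| <= 1]).

Definition is_adjoint H G (T : H -> G) (S : G -> H) : Prop :=
  bounded_op S /\ forall x y, inner (T x) y = inner x (S y).

(* The default value is never taken when [T] is bounded. *)
Definition adjoint H G (T : H -> G) : G -> H :=
  xget (fun=> 0) [set S | is_adjoint T S].

Definition orthogonal_projection H (P : H -> H) : Prop :=
  [/\ bounded_op P, forall x, P (P x) = P x &
      forall x y, inner (P x) y = inner x (P y)].

Definition orthocomplement H (S : set H) : set H :=
  [set x | forall y, S y -> inner x y = 0].

(* The default value is never taken when [S] is a closed subspace. *)
Definition projection_onto H (S : set H) : H -> H :=
  xget (fun=> 0) [set Q | orthogonal_projection Q /\ range Q = S].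

(* The resolution of the identity [E] of [T], that is [E l] is the spectral
   projection of [T] corresponding to (-oo, l].  The last clause says that the
   Riemann-Stieltjes sums of [l dE(l)] converge to [T] in operator norm. *)
Definition is_spectral_family H (T : H -> H) (E : R -> H -> H) : Prop :=
  [/\ forall l, orthogonal_projection (E l),
      forall l m x, l <= m -> E l (E m x) = E l x,
      forall l x, E m x @[m --> l^'+] --> E l x &
      exists a b : R,
      [/\ forall l x, l <= a -> E l x = 0,
          forall l x, b <= l -> E l x = x &
          forall e : R, 0 < e -> exists2 d : R, 0 < d &
            forall (N : nat) (s xi : nat -> R),
              s 0%N <= a -> b <= s N ->
              (forall i, (i < N)%N ->
                 [/\ s i <= xi i, xi i <= s i.+1 & s i.+1 - s i < d]) ->
              forall x, `|T x - \sum_(i < N)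
                            (xi i)%:C%C *: (E (s i.+1) x - E (s i) x)|
                        <= e%:C%C * `|x|]].

Definition spectral_family H (T : H -> H) : R -> H -> H :=
  xget (fun _ _ => 0) [set E | is_spectral_family T E].

(* The spectral projection corresponding to (0, +oo) is the strong limit of
   [E l - E 0] as [l] tends to [+oo]. *)
Definition positive_spectral_projection H (T : H -> H) : H -> H :=
  fun x => x - spectral_family T 0 x.

Lemma eq_bounded_op H G (T S : H -> G) :
  T =1 S -> bounded_op T -> bounded_op S.
Proof. by move=> /funext ->. Qed.

Lemma eq_compact_op H G (T S : H -> G) :
  T =1 S -> compact_op T -> compact_op S.
Proof. by move=> /funext ->. Qed.

Lemma bounded_op_ge0 H G (T : H -> G) : bounded_op T ->
  exists2 M : R[i], 0 <= M & forall x, `|T x| <= M * `|x|.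
Proof.
move=> [_ [M TM]]; exists `|M| => // x; have := TM x.
rewrite -[X in _ -> _ <= _ * X]normr_id -normrM => h.
by rewrite ger0_norm// (le_trans _ h).
Qed.

Lemma bounded_op_comb H G (T S : H -> G) (c : R[i]) :
  bounded_op T -> bounded_op S -> bounded_op (fun x => c *: T x + S x).
Proof.
move=> [Tl [M TM]] [Sl [N SN]]; split.
  move=> k x y; rewrite Tl Sl !scalerDr !scalerA [c * k]mulrC -!addrA.
  by congr (_ + _); rewrite addrCA.
exists (`|c| * M + N) => x; rewrite (le_trans (ler_normD _ _))// normrZ mulrDl.
by rewrite lerD// -mulrA ler_wpM2l.
Qed.

Lemma bounded_op_id H : bounded_op (fun x : H => x).
Proof. by split=> //; exists 1 => x; rewrite mul1r. Qed.

Lemma compact_op0 H G : compact_op (fun _ : H => 0 : G).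
Proof.
split.
  by split=> [k x y|]; [rewrite scaler0 addr0|exists 0 => x; rewrite normr0 mul0r].
exists [set 0]; first by move=> _ [x _ <-].
split; first exact: compact_set1.
by apply: compact_closed; [exact: norm_hausdorff|exact: compact_set1].
Qed.

Lemma compact_opZ H G (T : H -> G) (c : R[i]) :
  compact_op T -> compact_op (fun x => c *: T x).
Proof.
move=> [Tb [U TU [Uc _]]]; split.
  apply: eq_bounded_op (bounded_op_comb c Tb (compact_op0 H G).1) => x.
  by rewrite addr0.
have cU : compact ((fun y : G => c *: y) @` U).
  apply: continuous_compact => //; apply: continuous_subspaceT.
  exact: scaler_continuous.
exists ((fun y : G => c *: y) @` U).
  by move=> _ [x x1 <-]; exists (T x) => //; apply: TU; exists x.
by split=> //; apply: compact_closed => //; exact: norm_hausdorff.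
Qed.

Lemma adjoint_sym H (T : H -> H) :
  bounded_op T -> (forall x y, inner (T x) y = inner x (T y)) -> adjoint T = T.
Proof.
move=> Tb Ts; rewrite /adjoint; case: xgetP => [S _ [_ TS]|/(_ T)]; last first.
  by case.
apply/funext => y; apply/eqP; rewrite -subr_eq0 -(dnorm_eq0 inner).
by rewrite linearBr/= -TS Ts subrr.
Qed.

End Operators.

Section SumOperators.
Variables (R : realType) (I : finType) (H G : I -> hilbertType R).

Definition hsum_map (T : forall i, H i -> G i) (x : hsum H) : hsum G :=
  fun i => T i (x i).

Definition on_component (i : I) (T : H i -> H i) (x : hsum H) : hsum H :=
  @dfwith I H (fun k => 0) i (T (x i)).

Lemma bounded_hsum_map (T : forall i, H i -> G i) :
  (forall i, bounded_op (T i)) -> bounded_op (hsum_map T).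
Proof.
move=> Tb; split.
  move=> c x y; apply: functional_extensionality_dep => i.
  exact: (Tb i).1.
have [M M0 TM] : exists2 M : I -> R[i], forall i, 0 <= M i &
    forall i x, `|T i x| <= M i * `|x|.
  have /choice[M MP] : forall i, exists M : R[i],
      0 <= M /\ forall x, `|T i x| <= M * `|x|.
    by move=> i; have [M] := bounded_op_ge0 (Tb i); exists M.
  by exists M => i; case: (MP i).
exists (\sum_i M i) => x; rewrite (le_trans (hsum_norm_le _))// mulr_suml.
apply: ler_sum => i _; rewrite (le_trans (TM i _))// ler_wpM2l//.
exact: hsum_norm_ge.
Qed.

End SumOperators.

(* Representations are not required to be nondegenerate. *)
Record hilbertModule (R : realType) (A : cstarAlgType R) := HilbertModule {
  hmod_space :> hilbertType R ;
  act : A -> hmod_space -> hmod_space ;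
  act_bounded : forall a, bounded_op (act a) ;
  act_linear : forall (c : R[i]) (a b : A) x,
    act (c *: a + b) x = c *: act a x + act b x ;
  actM : forall (a b : A) x, act (amul a b) x = act a (act b x) ;
  act_star : forall (a : A) x y, inner (act a x) y = inner x (act (astar a) y)
}.

Section HilbertModuleSum.
Variables (R : realType) (A : cstarAlgType R).
Variables (I : finType) (M : I -> hilbertModule A).

Let sum_act (a : A) : hsum M -> hsum M := hsum_map (fun i => @act R A (M i) a).

Let sum_act_bounded a : bounded_op (sum_act a).
Proof. by apply: bounded_hsum_map => i; exact: act_bounded. Qed.

Let sum_act_linear (c : R[i]) (a b : A) (x : hsum M) :
  sum_act (c *: a + b) x = c *: sum_act a x + sum_act b x.
Proof. by apply: functional_extensionality_dep => i; exact: act_linear. Qed.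

Let sum_actM (a b : A) (x : hsum M) :
  sum_act (amul a b) x = sum_act a (sum_act b x).
Proof. by apply: functional_extensionality_dep => i; exact: actM. Qed.

Let sum_act_star (a : A) (x y : hsum M) :
  inner (sum_act a x) y = inner x (sum_act (astar a) y).
Proof. by apply: eq_bigr => i _; exact: act_star. Qed.

Definition hsum_module : hilbertModule A :=
  HilbertModule sum_act_bounded sum_act_linear sum_actM sum_act_star.

End HilbertModuleSum.

Section Admissible.
Variables (R : realType) (A : cstarAlgType R).

Definition admissible (M N : hilbertModule A) (T : M -> N) : Prop :=
  [/\ bounded_op T, closed (range T) &
      forall a : A, compact_op (fun x => T (act a x) - act a (T x))].

Definition admissible_projection (M : hilbertModule A) (P : M -> M) : Prop :=
  orthogonal_projection P /\ admissible P.

End Admissible.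

Section KHomology.
Variables (R : realType) (A : cstarAlgType R).

(* A module with an operator that is not required to be Fredholm, so that direct
   sums can be formed without proof obligations; [K1] only has classes of
   Fredholm modules. *)
Record kcycle := KCycle {
  kc_module :> hilbertModule A ;
  kc_op : kc_module -> kc_module
}.

Definition is_fredholm (x : kcycle) : Prop :=
  let F := @kc_op x in
  bounded_op F /\ forall a : A,
    [/\ compact_op (fun v => F (F (act a v)) - act a v),
        compact_op (fun v => F (act a v) - adjoint F (act a v)) &
        compact_op (fun v => F (act a v) - act a (F v))].

Definition is_degenerate (x : kcycle) : Prop :=
  let F := @kc_op x in
  bounded_op F /\ forall (a : A) v,
    [/\ F (F (act a v)) = act a v,
        F (act a v) = adjoint F (act a v) &
        F (act a v) = act a (F v)].

Definition unitarily_equivalent (x y : kcycle) : Prop :=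
  exists U : x -> y,
    [/\ linear U, bijective U, forall u v, inner (U u) (U v) = inner u v,
        forall (a : A) v, U (act a v) = act a (U v) &
        forall v, U (kc_op v) = kc_op (U v)].

(* The second clause is continuity on [0, 1] for the operator norm. *)
Definition operator_homotopy (M : hilbertModule A) (F : R -> M -> M) : Prop :=
  (forall t, 0 <= t <= 1 -> is_fredholm (KCycle (F t))) /\
  forall t, 0 <= t <= 1 -> forall e : R, 0 < e -> exists2 d : R, 0 < d &
    forall s, 0 <= s <= 1 -> `|s - t| < d ->
      forall v, `|F s v - F t v| <= e%:C%C * `|v|.

Definition kc_sum (x y : kcycle) : kcycle :=
  @KCycle (hsum_module (fun b : bool => if b then x else y : kcycle))
    (hsum_map (fun b => @kc_op (if b then x else y))).

Inductive K1_step : kcycle -> kcycle -> Prop :=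
| K1_unitary x y : is_fredholm x -> is_fredholm y ->
    unitarily_equivalent x y -> K1_step x y
| K1_homotopy (M : hilbertModule A) (F : R -> M -> M) :
    operator_homotopy F -> K1_step (KCycle (F 0)) (KCycle (F 1))
| K1_degenerate x z : is_fredholm x -> is_degenerate z ->
    K1_step x (kc_sum x z).

(* The equivalence relation generated by unitary equivalence, operator homotopy
   and addition of degenerate modules (Kasparov).  There is no separability
   restriction on the underlying Hilbert spaces. *)
Definition K1_equiv : kcycle -> kcycle -> Prop := clos_refl_sym_trans _ K1_step.

(* The underlying set of the odd K-homology group K^1(A), whose addition is
   induced by [kc_sum]. *)
Definition K1 : Type :=
  {c : kcycle -> Prop | exists2 x, is_fredholm x & c = K1_equiv x}.

Definition K1_class (x : kcycle) (hx : is_fredholm x) : K1 :=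
  exist _ (K1_equiv x) (ex_intro2 _ _ x hx erefl).

Definition toeplitz_cycle (M : hilbertModule A) (P : M -> M) : kcycle :=
  @KCycle M (fun x => 2%:R *: P x - x).

Lemma toeplitz_fredholm (M : hilbertModule A) (P : M -> M) :
  admissible_projection P -> is_fredholm (toeplitz_cycle P).
Proof.
move=> [[Pb PP Ps] [_ _ Pc]].
have Nb : bounded_op (fun x : M => - x).
  apply: eq_bounded_op
    (bounded_op_comb (-1) (bounded_op_id M) (compact_op0 M M).1) => x.
  by rewrite scaleN1r addr0.
have Fb : bounded_op (fun x : M => 2%:R *: P x - x) by exact: bounded_op_comb.
rewrite /is_fredholm /=; split=> // a.
have PB x y : P (x - y) = P x - P y.
  by have := Pb.1 (-1) y x; rewrite !scaleN1r ![- _ + _]addrC.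
have PZ (c : R[i]) x : P (c *: x) = c *: P x.
  have P0 : P 0 = 0 by have := PB 0 0; rewrite !subrr.
  by have := Pb.1 c x 0; rewrite P0 !addr0.
have actB x y : act a (x - y) = act a x - act a y :> M.
  by have := (act_bounded M a).1 (-1) y x; rewrite !scaleN1r ![- _ + _]addrC.
have actZ (c : R[i]) x : act a (c *: x) = c *: act a x :> M.
  have a0 : act a 0 = 0 :> M by have := actB 0 0; rewrite !subrr.
  by have := (act_bounded M a).1 c x 0; rewrite a0 !addr0.
split.
- apply: eq_compact_op (compact_op0 M M) => v.
  set w := act a v; have -> : P (2%:R *: P w - w) = P w.
    by rewrite PB PZ PP scaler_nat mulr2n addrK.
  by rewrite subKr subrr.
- apply: eq_compact_op (compact_op0 M M) => v.
  rewrite adjoint_sym ?subrr// => x y.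
  rewrite linearBl linearBr /= (linearZl_LR inner) (linearZr_LR inner) /=.
  by rewrite Ps conjC_nat.
- apply: eq_compact_op (compact_opZ 2%:R (Pc a)) => v.
  by rewrite actB actZ scalerBr opprB addrA subrK.
Qed.

Definition toeplitz_class (M : hilbertModule A) (P : M -> M)
    (hP : admissible_projection P) : K1 :=
  K1_class (toeplitz_fredholm hP).

End KHomology.

Section Resolution.
Variables (R : realType) (A : cstarAlgType R).
(* A resolution of length [n] only uses [H 0 .. H n] and [d 0 .. d n.-1]. *)
Variables (H : nat -> hilbertModule A) (P : H 0%N -> H 0%N).
Variable d : forall j, H j -> H j.+1.

Definition incoming_range (k : nat) : set (H k) :=
  match k with
  | 0 => range P
  | j.+1 => range (@d j)
  end.

Definition admissible_resolution (n : nat) : Prop :=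
  (forall j, (j < n)%N -> admissible (@d j)) /\
  (forall k, (k < n)%N -> [set x | @d k x = 0] = @incoming_range k).

Definition total_module (n : nat) : hilbertModule A :=
  hsum_module (fun k : 'I_n.+1 => H k).

Definition total_differential (n : nat) (x : total_module n) : total_module n :=
  fun k : 'I_n.+1 =>
    let: Ordinal m ltm := k return H k in
    match m return (m < n.+1)%N -> H m with
    | 0 => fun=> 0
    | j.+1 => fun ltj => d (x (Ordinal (ltnW ltj)))
    end ltm.

Definition cokernel_projection (n : nat) : H n -> H n :=
  projection_onto (orthocomplement (@incoming_range n)).

Definition resolution_operator (n : nat) (x : total_module n) :
    total_module n :=
  total_differential x + adjoint (@total_differential n) x
  + on_component (H := fun k : 'I_n.+1 => H k) (i := ord0) P x
  + (-1) ^+ n.+1 *: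
    on_component (H := fun k : 'I_n.+1 => H k) (i := ord_max)
      (@cokernel_projection n) x.

End Resolution.

(* Main.v *)
(* Write Pi for the sum of the projections P and ~P and gamma for the grading by
   -(-1)^k. By exactness ker A is the orthogonal sum of ran A and ran Pi, so D is
   bounded below by the closed range theorem. Let F = 2 P_+(D) - 1 be its sign and
   S = F D = |D|. For an operator a, the difference Y = a - F a F satisfies
   S Y + Y S = F [D, a] - [D, a] F, and as S is bounded below this equation
   determines Y and puts it in every closed ideal containing its right-hand side.
   Hence F commutes with the action modulo compact operators; it also commutes
   with Pi, agrees with P + (-1)^(n+1) ~P on ran Pi, and anticommutes with
   gamma (1 - Pi). Therefore
     c F (1 - Pi) + s gamma (1 - Pi) + P + (-1)^(n+1) ~P,  c^2 + s^2 = 1,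
   are self-adjoint involutions joining F to gamma + 2 P, which is the sum of
   2 P - 1 on H_0 and of the degenerate operators -(-1)^k on H_k for k > 0. *)

From Stdlib Require Import Relation_Operators.
From HB Require Import structures.
Require Import Defs.
From mathcomp Require Import all_boot all_order all_algebra.
From mathcomp Require Import complex.
From mathcomp Require Import all_classical all_reals all_analysis.
From mathcomp Require Import ring lra.

Set Implicit Arguments.
Unset Strict Implicit.
Unset Printing Implicit Defensive.

Import Order.TTheory GRing.Theory Num.Theory.
Import numFieldNormedType.Exports.

Local Open Scope classical_set_scope.
Local Open Scope ring_scope.

(** * Real inner product and bounded operators *)

(** The sign (-1)^(n+1) makes the end of the homotopy elementary. The grading is -1 on H_0 and
    (-1)^(n+1) on H_n, so [sig], the part of D on ran Pi, is opposite to the grading on ran P and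
    equal to it on ran ~P; putting [sig] in place of the grading on ran Pi therefore adds only 2 P.
    The space ran Pi has to stay fixed during the rotation because the grading anticommutes with A +
    A^* but commutes with [sig]. Closed ranges enter twice: they give the gap of D at 0 on which the
    Sylvester argument rests, and they give preimages of controlled norm, through which the
    projections onto the ranges, hence ~P, commute with the action modulo compact operators.
    [sign_commutator] allows any closed ideal and a sign [eps]. The compact operators with eps = 1
    give admissibility; the zero ideal gives the exact relations of F, with Pi for eps = 1 and with
    gamma (1 - Pi) for eps = -1. [positive_spectral_projection] uses a chosen spectral family, so
    the properties of F are derived from the defining clauses of an arbitrary one. *)

Section RealInnerProduct.
Variables (R : realType) (H : hilbertType R).
Implicit Types (x y z : H) (c : R).

(* All estimates use the real inner product: it determines the complex one, and
   complex subspaces have the same orthogonal complement for both. *)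
Definition ip x y : R := complex.Re (inner x y).
Definition nm x : R := Num.sqrt (ip x x).

Lemma ipC x y : ip x y = ip y x.
Proof.
rewrite /ip [inner y x]hermC expr0 mul1r /=; by case: (inner x y).
Qed.

Lemma ipDl x y z : ip (x + y) z = ip x z + ip y z.
Proof. by rewrite /ip linearDl /= raddfD. Qed.

Lemma ipNl x y : ip (- x) y = - ip x y.
Proof. by rewrite /ip linearNl /= raddfN. Qed.

Lemma ipZl c x y : ip (c%:C%C *: x) y = c * ip x y.
Proof.
by rewrite /ip (linearZl_LR inner) /=; case: (inner x y) => a b /=; rewrite mul0r subr0.
Qed.

Lemma ipDr x y z : ip x (y + z) = ip x y + ip x z.
Proof. by rewrite ipC ipDl !(ipC x). Qed.
Lemma ipNr x y : ip x (- y) = - ip x y.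
Proof. by rewrite ipC ipNl ipC. Qed.
Lemma ipZr c x y : ip x (c%:C%C *: y) = c * ip x y.
Proof. by rewrite ipC ipZl ipC. Qed.
Lemma ipBl x y z : ip (x - y) z = ip x z - ip y z.
Proof. by rewrite ipDl ipNl. Qed.
Lemma ipBr x y z : ip x (y - z) = ip x y - ip x z.
Proof. by rewrite ipDr ipNr. Qed.
Lemma ip0l x : ip 0 x = 0.
Proof. by rewrite /ip linear0l. Qed.
Lemma ip0r x : ip x 0 = 0.
Proof. by rewrite ipC ip0l. Qed.

Lemma ip_suml (I : Type) (r : seq I) (Q : pred I) (F : I -> H) y :
  ip (\sum_(i <- r | Q i) F i) y = \sum_(i <- r | Q i) ip (F i) y.
Proof.
elim/big_rec2: _ => [|i a b _ <-]; first by rewrite ip0l.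
by rewrite ipDl.
Qed.

Lemma innerxxE x : inner x x = (ip x x)%:C%C.
Proof.
rewrite /ip; have := dnorm_ge0 inner x.
by case: (inner x x) => a b; rewrite lecE /= => /andP[/eqP -> _].
Qed.

Lemma ip_ge0 x : 0 <= ip x x.
Proof. by have := dnorm_ge0 inner x; rewrite innerxxE ler0c. Qed.

Lemma nmE x : `|x| = (nm x)%:C%C.
Proof.
have h : 0 <= (nm x)%:C%C by rewrite ler0c sqrtr_ge0.
apply: (@pexpIrn _ 2) => //; rewrite ?nnegrE//.
by rewrite -inner_norm innerxxE -rmorphXn /= sqr_sqrtr// ip_ge0.
Qed.

Lemma nm_ge0 x : 0 <= nm x. Proof. exact: sqrtr_ge0. Qed.
Hint Resolve nm_ge0 : core.

Lemma nm2 x : nm x ^+ 2 = ip x x. Proof. by rewrite sqr_sqrtr ?ip_ge0. Qed.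

Lemma nm0 : nm 0 = 0. Proof. by rewrite /nm ip0l sqrtr0. Qed.

Lemma nm0_eq0 x : nm x = 0 -> x = 0.
Proof. by move=> h; apply/eqP; rewrite -normr_eq0 nmE h. Qed.

Lemma ipxx_eq0 x : ip x x = 0 -> x = 0.
Proof. by move=> h; apply: nm0_eq0; rewrite /nm h sqrtr0. Qed.

Lemma nm_gt0 x : x != 0 -> 0 < nm x.
Proof. by move=> x0; rewrite lt_def nm_ge0 andbT; apply: contra x0 => /eqP/nm0_eq0/eqP.
  Qed.

Lemma nmN x : nm (- x) = nm x.
Proof. by rewrite /nm ipNl ipNr opprK. Qed.

Lemma nm_distC x y : nm (x - y) = nm (y - x).
Proof. by rewrite -nmN opprB. Qed.

Lemma nmD x y : nm (x + y) <= nm x + nm y.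
Proof. by rewrite -lecR rmorphD /= -!nmE ler_normD. Qed.

Lemma nmB x y : nm (x - y) <= nm x + nm y.
Proof. by rewrite -(nmN y) nmD. Qed.

Lemma nmB_trans y x z : nm (x - z) <= nm (x - y) + nm (y - z).
Proof. by rewrite (le_trans _ (nmD _ _))// addrA subrK. Qed.

Lemma nmZ c x : nm (c%:C%C *: x) = `|c| * nm x.
Proof. by rewrite /nm ipZl ipZr mulrA -expr2 sqrtrM ?sqr_ge0// sqrtr_sqr. Qed.

Lemma nmZC (k : R[i]) x : nm (k *: x) = complex.Re `|k| * nm x.
Proof. apply: complexI; rewrite (rmorphM (real_complex R)) -!nmE normrZ; congr (_ * _).
exact: nmE. Qed.

Lemma parallelogram x y :
  ip (x + y) (x + y) + ip (x - y) (x - y) = 2 * ip x x + 2 * ip y y.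
Proof. by rewrite !(ipDl, ipDr, ipNl, ipNr) (ipC y x); ring. Qed.

Lemma ip_CS x y : ip x y <= nm x * nm y.
Proof.
have [->|x0] := eqVneq x 0; first by rewrite ip0l nm0 mul0r.
have [->|y0] := eqVneq y 0; first by rewrite ip0r nm0 mulr0.
have hx := nm_gt0 x0; have hy := nm_gt0 y0.
(* This square expands to 2 |x| |y| (|x| |y| - <x, y>). *)
have := ip_ge0 ((nm y)%:C%C *: x - (nm x)%:C%C *: y).
rewrite !(ipBl, ipBr, ipZl, ipZr) (ipC y x) -!nm2.
set a := nm x in hx *; set b := nm y in hy *; move=> h.
have : 0 <= (2 * (a * b)) * (a * b - ip x y) by move: h; lra.
by rewrite pmulr_rge0 ?subr_ge0// !mulr_gt0.
Qed.

Lemma ip_CSn x y : `|ip x y| <= nm x * nm y.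
Proof. by rewrite ler_norml ip_CS andbT lerNl -ipNl (le_trans (ip_CS _ _))// nmN. Qed.

Lemma inner_eq0_ip x y : inner x y = 0 -> ip x y = 0.
Proof. by rewrite /ip => ->. Qed.

Lemma ip_i x y : ip x ('i%C *: y) = complex.Im (inner x y).
Proof.
rewrite /ip (linearZr_LR inner) /=; case: (inner x y) => a b /=; by rewrite !mul0r
  mulN1r sub0r opprK.
Qed.

(** Pairing with the multiple of [y] by i recovers the imaginary part, so identities for [ip]
    against all vectors pass to [inner]. *)
Lemma innerE x y : inner x y = (ip x y +i* ip x ('i *: y))%C.
Proof. by rewrite ip_i /ip; case: (inner x y). Qed.

Lemma ip_inj x y : (forall z, ip z x = ip z y) -> x = y.
Proof.
move=> h; apply/eqP; rewrite -subr_eq0; apply/eqP/ipxx_eq0.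
by rewrite ipBr h subrr.
Qed.

Lemma pythagoras x y : ip x y = 0 -> nm (x + y) ^+ 2 = nm x ^+ 2 + nm y ^+ 2.
Proof. by move=> h; rewrite !nm2 !(ipDl, ipDr) (ipC y x) h; ring. Qed.

End RealInnerProduct.
#[global] Hint Extern 0 (is_true (0 <= nm _)) => exact: nm_ge0 : core.

Lemma small_inv (R : realType) (e : R) : 0 < e -> exists n : nat, n.+1%:R^-1 < e.
Proof.
move=> e0; exists (Num.truncn e^-1); rewrite -[ltRHS]invrK ltf_pV2 ?posrE ?invr_gt0//.
exact: truncnS_gt.
Qed.

(** * Sequential convergence and completeness with real radii *)

Section Sequences.
Variables (R : realType) (H : hilbertType R).
Implicit Types (u : nat -> H) (l x : H).

Definition tends u l := forall e : R, 0 < e ->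
  exists N, forall n, (N <= n)%N -> nm (u n - l) < e.

Definition nm_cauchy u := forall e : R, 0 < e ->
  exists N, forall m n, (N <= m)%N -> (m <= n)%N -> nm (u n - u m) < e.

Lemma nm_complete u : nm_cauchy u -> exists l, tends u l.
Proof.
move=> cu.
have : cvg (u @ \oo).
  apply: cauchy_cvg; apply/cauchyP => e; rewrite ltcE /= => /andP[/eqP e2 e0].
  have [N uN] := cu _ e0; exists (u N); exists N => // n /= Nn.
  rewrite -ball_normE /ball_ /= nmE nm_distC ltcE /= -e2 eqxx /=.
  exact: uN.
move=> /cvg_ex[l ul]; exists l => e e0.
have e0C : 0 < e%:C%C by rewrite ltcR.
have /cvgrPdist_lt/(_ _ e0C)[N _ uN] := ul.
by exists N => n /uN /=; rewrite nmE ltcR nm_distC.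
Qed.

Lemma tends_unique u l l' : tends u l -> tends u l' -> l = l'.
Proof.
move=> ul ul'; apply/eqP; rewrite -subr_eq0; apply: contraT => /nm_gt0 h.
have h2 : 0 < nm (l - l') / 2 by rewrite divr_gt0.
have [N uN] := ul _ h2; have [N' uN'] := ul' _ h2.
have := uN (maxn N N') (leq_maxl _ _); have := uN' (maxn N N') (leq_maxr _ _).
have := nmB_trans (u (maxn N N')) l l'; rewrite (nm_distC l (u _)); lra.
Qed.

Lemma closed_tends (S : set H) u l :
  closed S -> (forall n, S (u n)) -> tends u l -> S l.
Proof.
move=> cS Su ul; apply: cS => B /nbhs_ballP[e]; rewrite /= ltcE => /andP[/= /eqP e2 e0]
  eB.
have [N uN] := ul _ e0; exists (u N); split; first exact: Su.
apply: eB; rewrite -ball_normE /ball_ /= nmE nm_distC ltcE /= -e2 eqxx /=.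
exact: uN.
Qed.

Lemma tends_closed (S : set H) :
  (forall u l, (forall n, S (u n)) -> tends u l -> S l) -> closed S.
Proof.
move=> cS l cl.
have /choice[u uP] : forall n : nat, exists y, S y /\ nm (y - l) < n.+1%:R^-1.
  move=> n; have [|y [Sy yl]] := cl (ball l (n.+1%:R^-1)%:C%C).
    by apply: nbhsx_ballx; rewrite ltcR invr_gt0.
  by exists y; split => //; move: yl; rewrite -ball_normE /ball_ /= nmE nm_distC ltcR.
apply: (cS u) => [n|e e0]; first by case: (uP n).
have [N hN] := small_inv e0; exists N => n Nn.
apply: lt_trans hN; apply: lt_le_trans (uP n).2 _.
by rewrite lef_pV2 ?posrE// ler_nat.
Qed.

End Sequences.

(** * The module and the ring of bounded operators *)

Section BoundedOperators.
Variable R : realType.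
Implicit Types H G K : hilbertType R.

(** Bundling makes operators elements of a module, and of a ring when [H = G], so that operator
    identities become ring computations. Proof irrelevance makes equality pointwise, see [bopP]. *)
Record bop H G := Bop {
  bfun :> H -> G ;
  bop_linear : linear bfun ;
  bop_bounded : exists M : R, forall x, nm (bfun x) <= M * nm x }.

Lemma bopP H G (T S : bop H G) : T =1 S -> T = S.
Proof.
case: T S => [f fl fb] [g gl gb] /= /funext fg; rewrite -{}fg in gl gb *.
by congr Bop; exact: Prop_irrelevance.
Qed.

HB.instance Definition _ H G := gen_eqMixin (bop H G).
HB.instance Definition _ H G := gen_choiceMixin (bop H G).
HB.instance Definition _ H G (T : bop H G) :=
  GRing.isLinear.Build R[i] H G _ T (bop_linear T).

Lemma bop_bound H G (T : bop H G) :
  exists2 M : R, 0 < M & forall x, nm (T x) <= M * nm x.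
Proof.
have [M TM] := bop_bounded T; exists (`|M| + 1); first by rewrite ltr_pwDr.
move=> x; rewrite (le_trans (TM x))// ler_wpM2r//.
by rewrite (le_trans (ler_norm _))// lerDl.
Qed.

Section Zmodule.
Variables H G : hilbertType R.

Lemma zero_bop_bounded : exists M : R, forall x : H, nm (0 : G) <= M * nm x.
Proof. by exists 0 => x; rewrite nm0 mul0r. Qed.
Lemma zero_bop_linear : linear (fun _ : H => 0 : G).
Proof. by move=> k x y; rewrite scaler0 addr0. Qed.
Definition zero_bop := Bop zero_bop_linear zero_bop_bounded.

Lemma add_bop_linear (T S : bop H G) : linear (fun x => T x + S x).
Proof. by move=> k x y; rewrite !linearP scalerDr addrACA. Qed.
Lemma add_bop_bounded (T S : bop H G) :
  exists M : R, forall x, nm (T x + S x) <= M * nm x.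
Proof.
have [M _ TM] := bop_bound T; have [N _ SN] := bop_bound S.
by exists (M + N) => x; rewrite (le_trans (nmD _ _))// mulrDl lerD.
Qed.
Definition add_bop T S := Bop (add_bop_linear T S) (add_bop_bounded T S).

Lemma opp_bop_linear (T : bop H G) : linear (fun x => - T x).
Proof. by move=> k x y; rewrite linearP opprD scalerN. Qed.
Lemma opp_bop_bounded (T : bop H G) : exists M : R, forall x, nm (- T x) <= M * nm x.
Proof. by have [M _ TM] := bop_bound T; exists M => x; rewrite nmN. Qed.
Definition opp_bop T := Bop (opp_bop_linear T) (opp_bop_bounded T).

Lemma scale_bop_linear (k : R[i]) (T : bop H G) : linear (fun x => k *: T x).
Proof. by move=> c x y; rewrite linearP scalerDr !scalerA [k * c]mulrC. Qed.
Lemma scale_bop_bounded (k : R[i]) (T : bop H G) :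
  exists M : R, forall x, nm (k *: T x) <= M * nm x.
Proof.
have [M _ TM] := bop_bound T; exists (complex.Re `|k| * M) => x.
by rewrite nmZC -mulrA ler_wpM2l// -ler0c RRe_real ?normr_real.
Qed.
Definition scale_bop k T := Bop (scale_bop_linear k T) (scale_bop_bounded k T).

Local Notation zero := zero_bop.
Local Notation add := add_bop.
Local Notation opp := opp_bop.
Local Notation scale := scale_bop.

Let addA : associative add.
Proof. by move=> x y z; apply: bopP => i /=; rewrite addrA. Qed.
Let addC : commutative add.
Proof. by move=> x y; apply: bopP => i /=; rewrite addrC. Qed.
Let add0 : left_id zero add.
Proof. by move=> x; apply: bopP => i /=; rewrite add0r. Qed.
Let addN : left_inverse zero opp add.
Proof. by move=> x; apply: bopP => i /=; rewrite addNr. Qed.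

HB.instance Definition _ := GRing.isZmodule.Build (bop H G) addA addC add0 addN.

Let scaleA (a b : R[i]) (x : bop H G) : scale a (scale b x) = scale (a * b) x.
Proof. by apply: bopP => i; exact: scalerA. Qed.
Let scale1 : left_id 1 scale.
Proof. by move=> x; apply: bopP => i; exact: scale1r. Qed.
Let scaleDr : right_distributive scale +%R.
Proof. by move=> a x y; apply: bopP => i; exact: scalerDr. Qed.
Let scaleDl (x : bop H G) : {morph scale^~ x : a b / a + b}.
Proof. by move=> a b; apply: bopP => i; exact: scalerDl. Qed.

HB.instance Definition _ :=
  GRing.Zmodule_isLmodule.Build R[i] (bop H G) scaleA scale1 scaleDr scaleDl.

Lemma bop0E x : (0 : bop H G) x = 0. Proof. by []. Qed.
Lemma bopDE (T S : bop H G) x : (T + S) x = T x + S x. Proof. by []. Qed.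
Lemma bopNE (T : bop H G) x : (- T) x = - T x. Proof. by []. Qed.
Lemma bopBE (T S : bop H G) x : (T - S) x = T x - S x. Proof. by []. Qed.
Lemma bopZE k (T : bop H G) x : (k *: T) x = k *: T x. Proof. by []. Qed.

Lemma bop_sumE (I : Type) (r : seq I) (Q : pred I) (F : I -> bop H G) x :
  (\sum_(i <- r | Q i) F i) x = \sum_(i <- r | Q i) F i x.
Proof. by elim/big_rec2: _ => // i a b _ <-. Qed.

End Zmodule.

Lemma id_bop_linear H : linear (fun x : H => x).
Proof. by []. Qed.
Lemma id_bop_bounded H : exists M : R, forall x : H, nm x <= M * nm x.
Proof. by exists 1 => x; rewrite mul1r. Qed.
Definition bid H := Bop (@id_bop_linear H) (@id_bop_bounded H).

Lemma comp_bop_linear H G K (T : bop G K) (S : bop H G) : linear (fun x => T (S x)).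
Proof. by move=> k x y; rewrite !linearP. Qed.
Lemma comp_bop_bounded H G K (T : bop G K) (S : bop H G) :
  exists M : R, forall x, nm (T (S x)) <= M * nm x.
Proof.
have [M M0 TM] := bop_bound T; have [N _ SN] := bop_bound S.
by exists (M * N) => x; rewrite (le_trans (TM _))// -mulrA ler_wpM2l// ltW.
Qed.
Definition bcomp H G K (T : bop G K) (S : bop H G) :=
  Bop (comp_bop_linear T S) (comp_bop_bounded T S).

Section Ring.
Variable H : hilbertType R.

Let mulA : associative (@bcomp H H H).
Proof. by move=> x y z; apply: bopP. Qed.
Let mul1l : left_id (bid H) (@bcomp H H H).
Proof. by move=> x; apply: bopP. Qed.
Let mul1r_ : right_id (bid H) (@bcomp H H H).
Proof. by move=> x; apply: bopP. Qed.
Let mulDl : left_distributive (@bcomp H H H) +%R.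
Proof. by move=> x y z; apply: bopP. Qed.
Let mulDr : right_distributive (@bcomp H H H) +%R.
Proof. by move=> x y z; apply: bopP => v /=; rewrite linearD. Qed.

(** A ring structure that permits 1 = 0, since [H] may be the zero space. *)
HB.instance Definition _ :=
  GRing.Zmodule_isPzRing.Build (bop H H) mulA mul1l mul1r_ mulDl mulDr.

Implicit Types T S : bop H H.
Lemma bop1E x : (1 : bop H H) x = x. Proof. by []. Qed.
Lemma bopME T S x : (T * S) x = T (S x). Proof. by []. Qed.
Lemma scalebAl k T S : k *: (T * S) = (k *: T) * S.
Proof. by apply: bopP. Qed.
Lemma scalebAr k T S : k *: (T * S) = T * (k *: S).
Proof. by apply: bopP => x; rewrite bopZE !bopME bopZE linearZ. Qed.

End Ring.

Definition bounded_by H G (T : bop H G) (M : R) := forall x, nm (T x) <= M * nm x.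

Lemma bounded_by0 H G (T : bop H G) : (forall e, 0 < e -> bounded_by T e) -> T = 0.
Proof.
move=> h; apply: bopP => x; apply: nm0_eq0; apply/eqP; rewrite eq_le nm_ge0 andbT.
rewrite leNgt; apply/negP => p.
have p2 : 0 < nm (T x) / (2 * (nm x + 1)) by rewrite divr_gt0// mulr_gt0// ltr_wpDl.
have := h _ p2 x; rewrite mulrAC ler_pdivlMr ?mulr_gt0 ?ltr_wpDl//.
rewrite ler_pM2l//; have := nm_ge0 x; lra.
Qed.

Lemma bounded_byD H G (T S : bop H G) M N :
  bounded_by T M -> bounded_by S N -> bounded_by (T + S) (M + N).
Proof. by move=> TM SN x; rewrite (le_trans (nmD _ _))// mulrDl lerD. Qed.

Lemma bounded_byN H G (T : bop H G) M : bounded_by T M -> bounded_by (- T) M.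
Proof. by move=> TM x; rewrite bopNE nmN. Qed.

Lemma bounded_byZ H G (T : bop H G) M (c : R) :
  bounded_by T M -> bounded_by (c%:C%C *: T) (`|c| * M).
Proof. by move=> TM x; rewrite bopZE nmZ -mulrA ler_wpM2l. Qed.

Lemma bounded_by_comp H G K (T : bop G K) (S : bop H G) M N : 0 <= M ->
  bounded_by T M -> bounded_by S N -> bounded_by (bcomp T S) (M * N).
Proof. by move=> M0 TM SN x; rewrite (le_trans (TM _))// -mulrA ler_wpM2l. Qed.

Lemma bounded_byM H (T S : bop H H) M N : 0 <= M ->
  bounded_by T M -> bounded_by S N -> bounded_by (T * S) (M * N).
Proof. exact: bounded_by_comp. Qed.

Lemma bounded_byW H G (T : bop H G) M N : M <= N -> bounded_by T M -> bounded_by T N.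
Proof. by move=> MN TM x; rewrite (le_trans (TM x))// ler_wpM2r. Qed.

Lemma bop_tends H G (T : bop H G) u l : tends u l -> tends (T \o u) (T l).
Proof.
move=> ul e e0; have [M M0 TM] := bop_bound T.
have [|N uN] := ul (e / M); first by rewrite divr_gt0.
exists N => n /uN h /=; rewrite -linearB (le_lt_trans (TM _))//.
by rewrite mulrC -ltr_pdivlMr.
Qed.

Lemma bounded_op_bop H G (f : H -> G) : bounded_op f -> exists T : bop H G, f = T.
Proof.
move=> fb; have [M M0 fM] := bounded_op_ge0 fb; case: fb => fl _.
suff fb' : exists M : R, forall x, nm (f x) <= M * nm x by exists (Bop fl fb').
exists (complex.Re M) => x; have := fM x; rewrite !nmE.
by rewrite -{1}[M]RRe_real ?ger0_real// -rmorphM lecR.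
Qed.

Lemma bop_bounded_op H G (T : bop H G) : bounded_op T.
Proof.
split; first exact: bop_linear.
have [M _ TM] := bop_bound T; exists M%:C%C => x.
by rewrite !nmE -rmorphM lecR.
Qed.

Lemma ipZC H (k : R[i]) (x y : H) : ip (k *: x) y = ip x (k^* *: y).
Proof.
by rewrite /ip (linearZl_LR inner) (linearZr_LR inner) /= conjCK.
Qed.

Lemma ipZCr H (k : R[i]) (x y : H) : ip x (k *: y) = ip (k^* *: x) y.
Proof. by rewrite ipZC conjCK. Qed.

Lemma inner_CS H (x y : H) : complex.Re `|inner x y| <= nm x * nm y.
Proof.
rewrite -lecR RRe_real ?normr_real// -(@ler_pXn2r _ 2)// ?nnegrE ?normr_ge0//; last first.
  by rewrite ler0c mulr_ge0.
rewrite (le_trans (dot_cauchy_schwarz inner x y))//.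
by rewrite !innerxxE -!nm2 -rmorphM -rmorphXn /= exprMn.
Qed.

End BoundedOperators.

(** * Orthogonal projections onto closed subspaces *)

Section Projections.
Variables (R : realType) (H : hilbertType R).

Definition closed_subspace (S : set H) :=
  [/\ S 0, forall (k : R[i]) x y, S x -> S y -> S (k *: x + y) & closed S].

(** By the parallelogram law a minimising sequence for the distance from [x] is Cauchy. Moving its
    limit along [z] inside [S] cannot decrease the distance, which forces orthogonality. *)
Lemma projection_theorem (S : set H) x : closed_subspace S ->
  exists y, S y /\ forall z, S z -> ip (x - y) z = 0.
Proof.
move=> [S0 SL cS].
have SD a b : S a -> S b -> S (a + b) by move=> /SL h /h => /(_ 1); rewrite scale1r.
have SZ k a : S a -> S (k *: a) by move=> /SL h; have := h k _ S0; rewrite addr0.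
have SN a : S a -> S (- a) by move=> /(SZ (-1)); rewrite scaleN1r.
pose V := [set nm (x - y) ^+ 2 | y in S].
have V0 : V !=set0 by exists (nm (x - 0) ^+ 2), 0.
have Vb : lbound V 0 by move=> _ [y _ <-]; rewrite sqr_ge0.
have Vi : has_inf V by split => //; exists 0.
set m := inf V.
have mle y : S y -> m <= nm (x - y) ^+ 2.
  by move=> Sy; apply: ge_inf; [exists 0|exists y].
have /choice[u uP] : forall n : nat, exists y,
    S y /\ nm (x - y) ^+ 2 < m + n.+1%:R^-1.
  move=> n; have n0 : 0 < n.+1%:R^-1 :> R by rewrite invr_gt0.
  by have [_ [y Sy <-] h] := inf_adherent n0 Vi; exists y.
(* Parallelogram law for x - a and x - b: the midpoint of [a] and [b] lies in [S], so its squared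
   distance from [x] is at least m, which leaves 4 (m + e) - 4 m. *)
have key a b (e : R) : S a -> S b -> nm (x - a) ^+ 2 < m + e ->
    nm (x - b) ^+ 2 < m + e -> nm (a - b) ^+ 2 <= 4 * e.
  move=> Sa Sb ha hb; have := parallelogram (x - a) (x - b).
  have Sc : S ((2^-1)%:C%C *: (a + b)) by apply: SZ; exact: SD.
  have := mle _ Sc.
  have -> : (x - a) + (x - b) = 2%:C%C *: (x - (2^-1)%:C%C *: (a + b)).
    rewrite scalerBr scalerA -rmorphM/= mulfV ?pnatr_eq0// scale1r.
    by rewrite -[2]/(1 + 1) rmorphD/= scalerDl scale1r opprD addrACA.
  have -> : x - a - (x - b) = b - a by rewrite opprB addrC addrA subrK addrC.
  rewrite ipZl ipZr -!nm2 (nm_distC b a); lra.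
have [l ul] : exists l, tends u l.
  apply: nm_complete => e e0.
  have [|N hN] := @small_inv _ (e ^+ 2 / 4); first by rewrite divr_gt0// exprn_gt0.
  exists N => i j Ni Nj.
  have hk k : (N <= k)%N -> nm (x - u k) ^+ 2 < m + N.+1%:R^-1.
    move=> Nk; rewrite (lt_le_trans (uP k).2)// lerD2l lef_pV2 ?posrE//.
    by rewrite ler_nat.
  have := key _ _ _ (uP j).1 (uP i).1 (hk _ (leq_trans Ni Nj)) (hk _ Ni).
  move=> h; rewrite -(@ltr_pXn2r _ 2)// ?nnegrE ?(ltW e0)//.
  by apply: le_lt_trans h _; rewrite mulrC -ltr_pdivlMr.
have Sl : S l by apply: (closed_tends cS _ ul) => n; case: (uP n).
exists l; split => // z Sz.
have lm : nm (x - l) ^+ 2 <= m.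
  rewrite leNgt; apply/negP => h.
  have hm : 0 <= m by apply: lb_le_inf => //; exact: V0.
  pose r := Num.sqrt m.
  have rm : r ^+ 2 = m by rewrite sqr_sqrtr.
  have r0 : 0 <= r by exact: sqrtr_ge0.
  have hr : r < nm (x - l) by rewrite -(@ltr_pXn2r _ 2)// ?nnegrE// rm.
  pose d := nm (x - l) - r; have d0 : 0 < d by rewrite subr_gt0.
  have [|N uN] := ul (d / 2); first by rewrite divr_gt0.
  have [|N' hN'] := @small_inv _ ((r + d / 2) ^+ 2 - m).
    rewrite -rm subr_gt0 ltr_pXn2r// ?nnegrE ?ltrDl ?divr_gt0//.
    by rewrite addr_ge0// divr_ge0// ltW.
  pose k := maxn N N'.
  have h1 := uN k (leq_maxl _ _).
  have h2 : nm (x - u k) < r + d / 2.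
    rewrite -(@ltr_pXn2r _ 2)// ?nnegrE ?addr_ge0 ?divr_ge0 ?(ltW d0)//.
    apply: lt_trans (uP k).2 _; rewrite addrC -ltrBrDr.
    apply: le_lt_trans hN'; rewrite lef_pV2 ?posrE// ler_nat ltnS.
    exact: leq_maxr.
  have := nmB_trans (u k) x l.
  suff : nm (x - l) = r + d by move: h1 h2; lra.
  by rewrite /d addrCA subrr addr0.
have hz t : 0 <= t * (t * ip z z - 2 * ip (x - l) z).
  have := mle (l + t%:C%C *: z) (SD _ _ Sl (SZ _ _ Sz)).
  rewrite opprD addrA !nm2 !(ipBl (x - l), ipBr _ (x - l), ipBr (_ *: _) (x - l)).
  rewrite !(ipZl, ipZr) (ipC z (x - l)) -(nm2 (x - l)); move: lm; lra.
set q := ip z z in hz *; set p := ip (x - l) z in hz *.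
have q0 : 0 <= q by exact: ip_ge0.
(* The quadratic in t is minimal at p / q; the denominator q + 1 also covers z = 0 and still gives a
   negative value unless p = 0. *)
have := hz (p / (q + 1)).
have q1 : 0 < q + 1 by rewrite ltr_wpDl.
have -> : p / (q + 1) * (p / (q + 1) * q - 2 * p) =
   - (p ^+ 2 * ((q + 2) / (q + 1) ^+ 2)) by field; rewrite gt_eqF.
rewrite oppr_ge0 pmulr_lle0; last by rewrite divr_gt0 ?exprn_gt0// ltr_wpDl.
by move=> h; apply/eqP; rewrite -sqrf_eq0 eq_le h sqr_ge0.
Qed.

Definition selfadj (T : bop H H) := forall x y, ip (T x) y = ip x (T y).
Definition is_proj (Q : bop H H) := Q * Q = Q /\ selfadj Q.

(** The foot of the perpendicular is unique ([funi]), which makes the chosen foot linear and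
    idempotent; Pythagoras bounds it by 1. *)
Lemma proj_exists (S : set H) : closed_subspace S ->
  exists Q : bop H H, [/\ is_proj Q, forall x, S (Q x) & forall x, S x -> Q x = x].
Proof.
move=> Ssub; have /choice[f fP] := fun x => projection_theorem x Ssub.
have [S0 SL cS] := Ssub.
have SZ k a : S a -> S (k *: a) by move=> /SL h; have := h k _ S0; rewrite addr0.
have SB a b : S a -> S b -> S (a - b).
  by move=> Sa Sb; have := SL (-1) _ _ Sb Sa; rewrite scaleN1r addrC.
have funi x y : S y -> (forall z, S z -> ip (x - y) z = 0) -> f x = y.
  move=> Sy h; apply/eqP; rewrite -subr_eq0; apply/eqP/ipxx_eq0.
  have Sfy := SB _ _ (fP x).1 Sy; have := h _ Sfy; have := (fP x).2 _ Sfy.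
  have {3}-> : f x - y = (x - y) - (x - f x) by rewrite opprB [RHS]addrC addrA subrK.
  by rewrite (ipBl (x - y)) => -> ->; rewrite subrr.
have fl : linear f.
  move=> k x y; apply: funi; first exact: SL (fP x).1 (fP y).1.
  move=> z Sz; have -> : k *: x + y - (k *: f x + f y) = k *: (x - f x) + (y - f y).
    by rewrite scalerBr opprD addrACA.
  (* The complex scalar moves onto [z], where it is absorbed because [S] is a complex subspace. *)
  by rewrite ipDl (fP y).2// addr0 ipZC (fP x).2//; exact: SZ.
have fb : exists M, forall x, nm (f x) <= M * nm x.
  exists 1 => x; rewrite mul1r -(@ler_pXn2r _ 2)// ?nnegrE//.
  have := pythagoras ((fP x).2 _ (fP x).1); rewrite subrK => ->.
  by rewrite lerDr sqr_ge0.
exists (Bop fl fb); split.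
- split.
    apply: bopP => x; apply: funi; first exact: (fP x).1.
    by move=> z _; rewrite subrr ip0l.
  move=> x y /=; have := (fP x).2 _ (fP y).1; have := (fP y).2 _ (fP x).1.
  by rewrite !ipBl (ipC y) (ipC (f y)); lra.
- by move=> x; exact: (fP x).1.
- by move=> x Sx; apply: funi => // z _; rewrite subrr ip0l.
Qed.

End Projections.

(** * Riesz representation and adjoints *)

Section Adjoint.
Variable R : realType.
Implicit Types H G K : hilbertType R.

(** The kernel of [f] is closed, and a vector [e] orthogonal to it represents [f] after
    multiplication by the conjugate of f e / <e, e>. *)
Lemma riesz H (f : H -> R[i]) (M : R) : (forall k x y, f (k *: x + y) = k * f x + f y) ->
  (forall x, complex.Re `|f x| <= M * nm x) ->
  exists z, forall x, f x = inner x z.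
Proof.
move=> fl fM.
have f0 : f 0 = 0 by have := fl (-1) 0 0; rewrite scaleN1r oppr0 addr0 mulN1r addNr.
have fB x y : f (x - y) = f x - f y.
  by have := fl (-1) y x; rewrite scaleN1r mulN1r ![- _ + _]addrC.
have fZ k x : f (k *: x) = k * f x by have := fl k x 0; rewrite f0 !addr0.
have cN : closed_subspace [set x | f x = 0].
  split; [exact: f0|by move=> k x y /= fx fy; rewrite fl fx fy mulr0 addr0|].
  apply: tends_closed => u l /= fu ul; apply/eqP; rewrite -normr_eq0.
  rewrite -[`|_|]RRe_real ?normr_real// -[0]/(0%:C)%C (inj_eq (@complexI R)).
  have r0 y : 0 <= complex.Re `|f y| by rewrite -ler0c RRe_real ?normr_real.
  rewrite eq_le r0 andbT leNgt; apply/negP => p.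
  have M1 : 0 < `|M| + 1 by rewrite ltr_wpDl.
  have [|N uN] := ul (complex.Re `|f l| / (`|M| + 1)); first by rewrite divr_gt0.
  have := uN N (leqnn _); rewrite ltr_pdivlMr//; apply/negP; rewrite -leNgt.
  have := fM (l - u N); rewrite fB fu subr0 nm_distC => /le_trans; apply.
  by rewrite mulrC ler_wpM2l// (le_trans (ler_norm _))// lerDl.
have [z0|/existsNP[x0 fx0]] := pselect (forall x, f x = 0).
  by exists 0 => x; rewrite z0 linear0r.
  have [y [fy ey]] := projection_theorem x0 cN.
  pose e := x0 - y; have fe : f e != 0 by rewrite fB fy subr0; apply/eqP.
  have e0 : e != 0 by apply: contra fe => /eqP ->; rewrite f0.
  have ee : inner e e != 0 by rewrite dnorm_eq0.
  exists ((f e / inner e e)^* *: e) => x; rewrite (linearZr_LR inner) /= conjCK.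
  have h : f (x - (f x / f e) *: e) = 0 by rewrite fB fZ divfK// subrr.
  (* So far [e] is orthogonal to the kernel for [ip]; the kernel is stable under i, so [innerE]
     gives orthogonality for [inner]. *)
  have hz (w : H) : f w = 0 -> inner w e = 0.
    move=> fw; apply/eqP; rewrite (herm_eq0C inner); apply/eqP.
    by apply: etrans (innerE e w) _; rewrite !ey//= fZ fw mulr0.
  have := hz _ h; rewrite linearBl /= (linearZl_LR inner) /= => /eqP.
  rewrite subr_eq0 => /eqP ->; field; rewrite fe ee //.
Qed.

Lemma adj_exists H G (T : bop H G) :
  exists S : bop G H, forall x y, ip (T x) y = ip x (S y).
Proof.
have [M M0 TM] := bop_bound T.
have /choice[f fP] : forall y, exists z, forall x, inner (T x) y = inner x z.
  move=> y; apply: (@riesz _ (fun x => inner (T x) y) (M * nm y)).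
    by move=> k a b; rewrite linearP linearDl /= (linearZl_LR inner).
  by move=> x; rewrite (le_trans (inner_CS _ _))// mulrAC ler_wpM2r.
have fip x y : ip (T x) y = ip x (f y) by rewrite /ip fP.
have fl : linear f.
  move=> k x y; apply: ip_inj => z.
  by rewrite -fip !ipDr !ipZCr -linearZ !fip.
have fb : exists M, forall x, nm (f x) <= M * nm x.
  exists M => x; have [->|fx] := eqVneq (f x) 0; first by rewrite nm0 mulr_ge0// ltW.
  rewrite -(@ler_pM2l _ (nm (f x))) ?nm_gt0// -expr2 nm2 -fip.
  by rewrite (le_trans (ip_CS _ _))// mulrA ler_wpM2r// mulrC.
by exists (Bop fl fb).
Qed.

Definition adj H G (T : bop H G) : bop G H := projT1 (cid (adj_exists T)).

Lemma adjP H G (T : bop H G) x y : ip (T x) y = ip x (adj T y).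
Proof. exact: (projT2 (cid (adj_exists T))). Qed.

Lemma adjP' H G (T : bop H G) x y : ip (adj T x) y = ip x (T y).
Proof. by rewrite ipC -adjP ipC. Qed.

Lemma adj_unique H G (T : bop H G) (S : bop G H) :
  (forall x y, ip (T x) y = ip x (S y)) -> adj T = S.
Proof. by move=> h; apply: bopP => y; apply: ip_inj => z; rewrite -adjP h. Qed.

Lemma adjK H G (T : bop H G) : adj (adj T) = T.
Proof. by apply: adj_unique => x y; rewrite adjP'. Qed.

Lemma adj_comp H G K (T : bop G K) (S : bop H G) :
  adj (bcomp T S) = bcomp (adj S) (adj T).
Proof. by apply: adj_unique => x y /=; rewrite !adjP. Qed.

Lemma adjM H (T S : bop H H) : adj (T * S) = adj S * adj T.
Proof. exact: adj_comp. Qed.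

Lemma adjD H G (T S : bop H G) : adj (T + S) = adj T + adj S.
Proof. by apply: adj_unique => x y; rewrite !bopDE ipDl ipDr !adjP. Qed.

Lemma adjN H G (T : bop H G) : adj (- T) = - adj T.
Proof. by apply: adj_unique => x y; rewrite !bopNE ipNl ipNr !adjP. Qed.

Lemma adjB H G (T S : bop H G) : adj (T - S) = adj T - adj S.
Proof. by rewrite adjD adjN. Qed.

Lemma adj0 H G : adj (0 : bop H G) = 0.
Proof. by apply: adj_unique => x y; rewrite !bop0E ip0l ip0r. Qed.

Lemma adj1 H : adj (1 : bop H H) = 1.
Proof. exact: adj_unique. Qed.

Lemma adjZ H G (c : R) (T : bop H G) : adj (c%:C%C *: T) = c%:C%C *: adj T.
Proof. by apply: adj_unique => x y; rewrite !bopZE ipZl ipZr adjP. Qed.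

Lemma selfadjP H (T : bop H H) : selfadj T <-> adj T = T.
Proof. by split=> [|Ts x y]; [exact: adj_unique|rewrite adjP Ts]. Qed.

Lemma inner_adj H G (T : bop H G) (S : G -> H) :
  (forall x y, ip (T x) y = ip x (S y)) <-> (forall x y, inner (T x) y = inner x (S y)).
Proof.
split=> h x y; last by rewrite /ip h.
by rewrite [LHS]innerE [RHS]innerE h !ipZCr -linearZ h.
Qed.

Lemma is_adjoint_adj H G (T : bop H G) : is_adjoint T (adj T).
Proof.
by split; [exact: bop_bounded_op|apply/inner_adj; exact: adjP].
Qed.

(** Since [adj T] is a candidate, [xget] does not return its default, and adjoints are unique. *)
Lemma adjointE H G (T : bop H G) : adjoint T = adj T.
Proof.
rewrite /adjoint; case: xgetP => [S _ [_ TS]|/(_ (adj T))]; last first.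
  by case; exact: is_adjoint_adj.
by apply/funext => y; apply: ip_inj => x; rewrite -adjP /ip TS.
Qed.

End Adjoint.

(** * Uniform boundedness and closed ranges *)

Section UniformBoundedness.
Variables (R : realType) (H : hilbertType R).
Implicit Types (u : nat -> H) (l x : H).

Lemma tends_dist_le u l x (C : R) N : tends u l ->
  (forall n, (N <= n)%N -> nm (u n - x) <= C) -> nm (l - x) <= C.
Proof.
move=> ul h; apply/ler_addgt0Pr => e /ul[M uM].
have := uM _ (leq_maxr N M); have := h _ (leq_maxl N M).
have := nmB_trans (u (maxn N M)) l x; rewrite (nm_distC l (u _)); lra.
Qed.

Lemma cauchy_majorant u (r : nat -> R) :
  (forall e, 0 < e -> exists N, forall n, (N <= n)%N -> r n < e) ->
  (forall m n, (m <= n)%N -> nm (u n - u m) <= r m) -> nm_cauchy u.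
Proof.
move=> r0 ur e /r0[N rN]; exists N => m n Nm mn.
exact: le_lt_trans (ur _ _ mn) (rN _ Nm).
Qed.

Lemma expV_small (b : nat) (C e : R) : (1 < b)%N -> 0 < C -> 0 < e ->
  exists N, forall n, (N <= n)%N -> C * (b%:R ^+ n)^-1 < e.
Proof.
move=> b1 C0 e0; have [|N hN] := @small_inv R (e / C); first by rewrite divr_gt0.
exists N => n Nn; rewrite mulrC -ltr_pdivlMr//; apply: le_lt_trans hN.
rewrite lef_pV2 ?posrE ?exprn_gt0 ?ltr0n ?(ltn_trans _ b1)// -natrX ler_nat.
exact: leq_ltn_trans Nn (ltn_expl _ b1).
Qed.

(* The gliding-hump argument of Sokal: perturbing the current point by
   [+- 3^-n v_n / |v_n|] makes the pairing with [v_n] large, and all later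
   perturbations together are at most half as large. *)
Lemma weakly_bounded_bounded (V : set H) :
  (forall z, exists M : R, forall v, V v -> `|ip z v| <= M) ->
  exists M : R, forall v, V v -> nm v <= M.
Proof.
move=> Vb; apply: contrapT => nb.
have /choice[v vP] : forall n : nat, exists v, V v /\ n%:R * 3 ^+ n < nm v.
  move=> n; apply: contrapT => h; apply: nb; exists (n%:R * 3 ^+ n) => w Vw.
  by rewrite leNgt; apply/negP => hw; apply: h; exists w.
have v0 n : 0 < nm (v n) by apply: le_lt_trans (vP n).2; rewrite mulr_ge0// exprn_ge0.
pose s n := (3 ^+ n)^-1 : R.
have s0 n : 0 < s n by rewrite invr_gt0 exprn_gt0.
pose e n := ((s n / nm (v n))%:C%C *: v n).
have ne n : nm (e n) = s n by rewrite nmZ ger0_norm ?divr_ge0 ?(ltW (s0 n))// divfK//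
  gt_eqF.
have iev n : ip (e n) (v n) = s n * nm (v n).
  by rewrite ipZl -nm2 expr2 mulrA divfK// gt_eqF.
pose step n x := if s n * nm (v n) <= `|ip (x + e n) (v n)| then x + e n else x - e n.
pose fix x n := if n is m.+1 then step m (x m) else 0.
have xv n : s n * nm (v n) <= `|ip (x n.+1) (v n)|.
  rewrite /= /step; case: ifPn => // ; rewrite -ltNge ipDl ipBl iev.
  have : 0 < s n * nm (v n) by rewrite mulr_gt0.
  set b := s n * _; set a := ip _ _ => b0; rewrite ltr_norml => /andP[_ ab].
  by rewrite ler0_norm; lra.
have xx n : nm (x n.+1 - x n) <= s n.
  by rewrite /= /step; case: ifPn => _; rewrite addrAC subrr add0r ?nmN ne.
(* The steps sum as a geometric series of ratio 1/3. Started at n + 1, the series stays below s n /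
   2, half of the pairing secured at step n. *)
have xmn m n : (m <= n)%N -> nm (x n - x m) <= 3 / 2 * (s m - s n).
  elim: n => [|n IH]; first by rewrite leqn0 => /eqP ->; rewrite subrr nm0 subrr mulr0.
  rewrite leq_eqVlt => /orP[/eqP ->|/IH h]; first by rewrite !subrr nm0 mulr0.
  have := xx n; have := nmB_trans (x n) (x n.+1) (x m).
  have : s n.+1 = s n / 3 by rewrite /s exprS invfM mulrC.
  by move: h; lra.
have [l xl] : exists l, tends x l.
  apply: nm_complete; apply: (@cauchy_majorant _ (fun n => 3 / 2 * s n)).
    by move=> r r0; apply: expV_small.
  move=> m n /xmn h; apply: le_trans h _; have := s0 n; lra.
have ln n : nm (l - x n.+1) <= s n / 2.
  apply: (tends_dist_le (N := n.+1) xl) => m /xmn h; apply: le_trans h _.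
  have : s n.+1 = s n / 3 by rewrite /s exprS invfM mulrC.
  have := s0 m; lra.
have [M lM] := Vb l.
(* At this index the pairing of [l] with [v n] exceeds n / 2, hence |M|. *)
pose n := (Num.truncn (2 * `|M|)).+1.
have hn : 2 * `|M| < n%:R by exact: truncnS_gt.
have := lM _ (vP n).1; apply/negP; rewrite -ltNge.
have h1 : `|ip (x n.+1) (v n)| <= `|ip l (v n)| + `|ip (l - x n.+1) (v n)|.
  have {1}-> : x n.+1 = l - (l - x n.+1) by rewrite subKr.
  by rewrite (ipBl l); exact: ler_normB.
have h2 : `|ip (l - x n.+1) (v n)| <= s n / 2 * nm (v n).
  by rewrite (le_trans (ip_CSn _ _))// ler_wpM2r.
have h3 : n%:R < s n * nm (v n).
  have := (vP n).2; rewrite -ltr_pdivlMr ?exprn_gt0//; by rewrite /s mulrC.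
have := xv n; have := ler_norm M; lra.
Qed.

End UniformBoundedness.

(** * The closed range theorem *)

Section ClosedRange.
Variables (R : realType) (H G : hilbertType R).
Variable T : bop H G.
Hypothesis Tcl : closed (range T).

Lemma range_subspace : closed_subspace (range T).
Proof.
split=> //; first by exists 0; rewrite ?linear0.
by move=> k _ _ [x _ <-] [y _ <-]; exists (k *: x + y); rewrite ?linearP.
Qed.

(** Closedness provides the projection Q onto ran T. For [y] in ran T and any [z], writing Q z = T w
    gives <z, y> = <w, T^* y>; so the [y] in ran T with |T^* y| <= 1 are weakly bounded, hence
    bounded. *)
Lemma adj_lower_bound :
  exists2 c : R, 0 < c & forall y, range T y -> nm y <= c * nm (adj T y).
Proof.
have [Q [[_ Qs] QT TQ]] := proj_exists range_subspace.
have [|M0 hM0] := @weakly_bounded_bounded R G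
    [set y | range T y /\ nm (adj T y) <= 1].
  move=> z; have [w _ wz] := QT z; exists (nm w) => y [Ty y1].
  rewrite -(TQ y Ty) -Qs -wz adjP (le_trans (ip_CSn _ _))//.
  by rewrite -[leRHS]mulr1 ler_wpM2l.
pose M := `|M0|; have hM y : range T y -> nm (adj T y) <= 1 -> nm y <= M.
  by move=> Ty y1; apply: le_trans (hM0 _ (conj Ty y1)) (ler_norm _).
have M1 : 0 < M + 1 by rewrite ltr_wpDl// normr_ge0.
exists (M + 1) => // y Ty; rewrite leNgt; apply/negP => h.
have y0 : 0 < nm y by apply: le_lt_trans h; rewrite mulr_ge0// ltW.
have s0 : 0 <= (M + 1) / nm y by rewrite divr_ge0// ltW.
have Ts : range T (((M + 1) / nm y)%:C%C *: y).
  have [T0 TL _] := range_subspace.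
  by have := TL ((M + 1) / nm y)%:C%C _ _ Ty T0; rewrite addr0.
have := hM _ Ts; rewrite linearZ /= !nmZ ger0_norm// divfK ?gt_eqF//.
rewrite mulrAC ler_pdivrMr// mul1r => /(_ (ltW h)); lra.
Qed.

(** The lower bound makes the image of ran T under T^* closed. The part of [v] orthogonal to this
    image lies in ker T, to which [v] is orthogonal, so it vanishes. *)
Lemma kernel_orthogonal_range v : (forall x, T x = 0 -> ip x v = 0) ->
  exists2 y, range T y & v = adj T y.
Proof.
move=> hv; have [c c0 hc] := adj_lower_bound.
have [T0 TL _] := range_subspace.
pose W := adj T @` range T.
have Wsub : closed_subspace W.
  split; first by exists 0 => //; rewrite linear0.
    by move=> k _ _ [x Tx <-] [y Ty <-]; exists (k *: x + y); [exact: TL|rewrite linearP].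
  apply: tends_closed => u l Wu ul.
  have /choice[y yP] : forall n, exists y, range T y /\ adj T y = u n.
    by move=> n; have [y Ty <-] := Wu n; exists y.
  have [z yz] : exists z, tends y z.
    apply: nm_complete => e e0; have [|N uN] := ul (e / (2 * c)).
      by rewrite divr_gt0// mulr_gt0.
    exists N => m n Nm mn.
    have Tmn : range T (y n - y m).
      by have := TL (-1) _ _ (yP m).1 (yP n).1; rewrite scaleN1r addrC.
    have := hc _ Tmn; rewrite linearB /= !(yP _).2 => /le_lt_trans; apply.
    have h1 := uN _ Nm; have h2 := uN _ (leq_trans Nm mn).
    have := nmB_trans l (u n) (u m); rewrite (nm_distC l (u m)) => h.
    rewrite mulrC -ltr_pdivlMr//; apply: le_lt_trans h _.
    have -> : e / c = e / (2 * c) + e / (2 * c) by field; rewrite gt_eqF.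
    exact: ltrD.
  exists z; first by apply: (closed_tends Tcl _ yz) => n; case: (yP n).
  apply: (tends_unique (u := u)) => //.
  have -> : u = adj T \o y by apply/funext => n /=; rewrite (yP n).2.
  exact: bop_tends.
have [p [[y Ty py] hp]] := projection_theorem v Wsub.
exists y => //; rewrite py; apply/eqP; rewrite -subr_eq0; apply/eqP/ipxx_eq0.
rewrite ipBr [X in _ - X]hp; last by exists y.
rewrite hv ?subrr//; apply: ipxx_eq0; rewrite adjP hp//.
by exists (T (v - p)) => //; exists (v - p).
Qed.

(** With v = T^* y and [y] in ran T, |v|^2 = <T v, y> <= |T v| |y| <= c |T v| |v|. *)
Lemma closed_range_lower_bound : exists2 c : R, 0 < c &
  forall v, (forall x, T x = 0 -> ip x v = 0) -> nm v <= c * nm (T v).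
Proof.
have [c c0 hc] := adj_lower_bound; exists c => // v hv.
have [->|/nm_gt0 v0] := eqVneq v 0; first by rewrite nm0 mulr_ge0// ltW.
have [y Ty vy] := kernel_orthogonal_range hv.
rewrite -(@ler_pM2l _ (nm v))// -expr2 nm2 {2}vy -adjP.
rewrite (le_trans (ip_CS _ _))// mulrC mulrCA mulrA ler_wpM2r//.
by rewrite vy; exact: hc.
Qed.

Lemma ker_subspace : closed_subspace [set x | T x = 0].
Proof.
split=> [|k x y /= Tx Ty|]; first exact: linear0.
  by rewrite linearP /= Tx Ty scaler0 addr0.
apply: tends_closed => u l Tu /(bop_tends T) h; apply: tends_unique h _ => e e0.
by exists 0%N => n _ /=; rewrite Tu subrr nm0.
Qed.

(** Removing the kernel component of a preimage makes the lower bound applicable. Such bounded lifts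
    later carry compactness over to ran T. *)
Lemma closed_range_lift : exists2 c : R, 0 < c &
  forall y, range T y -> exists2 v, T v = y & nm v <= c * nm y.
Proof.
have [c c0 hc] := closed_range_lower_bound; exists c => // _ [w _ <-].
have [p [Tp hp]] := projection_theorem w ker_subspace.
have Twp : T (w - p) = T w by rewrite linearB /= Tp subr0.
exists (w - p) => //; rewrite -Twp; apply: hc => x Tx.
by rewrite ipC hp.
Qed.

End ClosedRange.

(** * Square roots and absolute values *)

Notation "c ':r*:' T" := ((c)%:C%C *: T)
  (at level 40, left associativity, format "c  ':r*:'  T") : ring_scope.

Section RealScaling.
Variable R : realType.

Lemma rscaleA (V : lmodType R[i]) (a b : R) (v : V) : a :r*: (b :r*: v) = (a * b) :r*: v.
Proof. by rewrite scalerA -rmorphM. Qed.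
Lemma rscaleDl (V : lmodType R[i]) (a b : R) (v : V) : (a + b) :r*: v = a :r*: v + b
  :r*: v.
Proof. by rewrite rmorphD /= scalerDl. Qed.
Lemma rscaleNl (V : lmodType R[i]) (a : R) (v : V) : (- a) :r*: v = - (a :r*: v).
Proof. by rewrite rmorphN /= scaleNr. Qed.
Lemma rscaleBl (V : lmodType R[i]) (a b : R) (v : V) : (a - b) :r*: v = a :r*: v - b
  :r*: v.
Proof. by rewrite rscaleDl rscaleNl. Qed.
Lemma rscale1 (V : lmodType R[i]) (v : V) : (1 : R) :r*: v = v.
Proof. by rewrite rmorph1 scale1r. Qed.
Lemma rscale0 (V : lmodType R[i]) (v : V) : (0 : R) :r*: v = 0.
Proof. by rewrite rmorph0 scale0r. Qed.
Lemma rscale2 (V : lmodType R[i]) (v : V) : (2 : R) :r*: v = v + v.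
Proof. by rewrite -[2]/(1 + 1) rscaleDl rscale1. Qed.

End RealScaling.

Section SelfAdjoint.
Variables (R : realType) (H : hilbertType R).
Implicit Types T S X : bop H H.

Lemma selfadj0 : selfadj (0 : bop H H).
Proof. by move=> x y; rewrite !bop0E ip0l ip0r. Qed.
Lemma selfadjD T S : selfadj T -> selfadj S -> selfadj (T + S).
Proof. by move=> hT hS x y; rewrite !bopDE ipDl ipDr hT hS. Qed.
Lemma selfadjN T : selfadj T -> selfadj (- T).
Proof. by move=> hT x y; rewrite !bopNE ipNl ipNr hT. Qed.
Lemma selfadjB T S : selfadj T -> selfadj S -> selfadj (T - S).
Proof. by move=> hT hS; apply: selfadjD => //; exact: selfadjN. Qed.
Lemma selfadjZ (c : R) T : selfadj T -> selfadj (c :r*: T).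
Proof. by move=> hT x y; rewrite !bopZE ipZl ipZr hT. Qed.
Lemma selfadjM T S : selfadj T -> selfadj S -> T * S = S * T -> selfadj (T * S).
Proof. by move=> hT hS TS x y; rewrite {2}TS !bopME hT hS. Qed.

(** Polarisation with [y], the multiple of T x of norm |x|: 4 <T x, y> is the difference of the
    forms at x + y and x - y, and the parallelogram law bounds it by 4 d |x|^2. *)
Lemma selfadj_bound T (d : R) : selfadj T ->
  (forall x, `|ip (T x) x| <= d * nm x ^+ 2) -> bounded_by T d.
Proof.
move=> Ts Td x.
have [->|x0] := eqVneq x 0; first by rewrite linear0 nm0 mulr0.
have [->|T0] := eqVneq (T x) 0; first by rewrite nm0; have := Td x; rewrite expr2 mulrA;
  move=> h; have := le_trans (normr_ge0 _) h; rewrite pmulr_lge0 ?nm_gt0.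
have hx := nm_gt0 x0; have hT := nm_gt0 T0.
pose y := (nm x / nm (T x)) :r*: T x.
have ny : nm y = nm x by rewrite nmZ ger0_norm ?divr_ge0// divfK// gt_eqF.
have iy : ip (T x) y = nm x * nm (T x).
  by rewrite ipZr -nm2 expr2 mulrA divfK// gt_eqF.
have := Td (x + y); have := Td (x - y).
rewrite linearB linearD /= !(ipDl, ipDr, ipNl, ipNr) (Ts y x) (ipC y (T x)) iy.
have := parallelogram x y; rewrite -!nm2 ny => hp.
rewrite !ler_norml => /andP[h1 _] /andP[_ h2].
have h3 : d * nm (x + y) ^+ 2 + d * nm (x - y) ^+ 2 = 4 * (d * (nm x * nm x)).
  by rewrite -mulrDr hp; ring.
rewrite -(@ler_pM2l _ (nm x))// mulrCA; lra.
Qed.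

Lemma bounded_by_adj (G : hilbertType R) (T : bop H G) (M : R) : 0 <= M ->
  bounded_by T M -> bounded_by (adj T) M.
Proof.
move=> M0 TM y; have [->|/nm_gt0 h] := eqVneq (adj T y) 0.
  by rewrite nm0 mulr_ge0.
rewrite -(@ler_pM2l _ (nm (adj T y)))// -expr2 nm2 -adjP.
by rewrite (le_trans (ip_CS _ _))// mulrA ler_wpM2r// mulrC.
Qed.

Definition vanishing (r : nat -> R) := (forall n, 0 <= r n) /\
  forall e, 0 < e -> exists N, forall n, (N <= n)%N -> r n < e.

(** Pointwise limits exist by completeness of [H]; the rate [r] is uniform on the unit ball and
    survives the limit. *)
Lemma bop_complete (T : nat -> bop H H) (r : nat -> R) : vanishing r ->
  (forall m n, (m <= n)%N -> bounded_by (T n - T m) (r m)) ->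
  exists L : bop H H, forall n, bounded_by (L - T n) (r n).
Proof.
move=> [rp r0] hT.
have /choice[f fP] : forall x, exists l, tends (fun n => T n x) l.
  move=> x; apply: nm_complete; apply: (@cauchy_majorant _ _ _ (fun n => r n * nm x)).
    move=> e e0; have [|N rN] := r0 (e / (nm x + 1)).
      by rewrite divr_gt0// ltr_wpDl.
    exists N => n /rN; rewrite ltr_pdivlMr ?ltr_wpDl//; apply: le_lt_trans.
    by rewrite ler_wpM2l// lerDl.
  by move=> m n /hT; apply.
have fr n x : nm (f x - T n x) <= r n * nm x.
  by apply: (tends_dist_le (N := n) (fP x)) => m /hT; apply.
have fl : linear f.
  move=> k x y; apply: (tends_unique (fP (k *: x + y))) => e e0.
  pose k' := complex.Re `|k|.
  have k'0 : 0 <= k' by rewrite -ler0c RRe_real ?normr_real.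
  have [|N hN] := fP x (e / (2 * (k' + 1))); first by rewrite divr_gt0// mulr_gt0//
    ltr_wpDl.
  have [|M hM] := fP y (e / 2); first by rewrite divr_gt0.
  exists (maxn N M) => n; rewrite geq_max => /andP[/hN h1 /hM h2].
  rewrite linearP opprD addrACA -scalerBr.
  apply: le_lt_trans (nmD _ _) _; rewrite nmZC -/k'.
  apply: (@le_lt_trans _ _ ((k' + 1) * nm (T n x - f x) + nm (T n y - f y))).
    by rewrite lerD2r ler_wpM2r// lerDl.
  rewrite [ltRHS](_ : e = (k' + 1) * (e / (2 * (k' + 1))) + e / 2); last first.
    by field; rewrite gt_eqF// ltr_wpDl.
  by rewrite ltrD// ltr_pM2l// ltr_wpDl.
have fb : exists M : R, forall x, nm (f x) <= M * nm x.
  have [M _ hM] := bop_bound (T 0%N); exists (r 0%N + M) => x.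
  by have := nmD (f x - T 0%N x) (T 0%N x); rewrite subrK mulrDl => /le_trans; apply;
    rewrite lerD.
by exists (Bop fl fb).
Qed.

Lemma bounded_by_vanishing T (C : R) (r : nat -> R) : vanishing r ->
  (forall n, bounded_by T (C * r n)) -> T = 0.
Proof.
move=> [rp r0] hT; apply: bounded_by0 => e e0.
have C1 : 0 < `|C| + 1 by rewrite ltr_wpDl.
have [|N hN] := r0 (e / (`|C| + 1)); first by rewrite divr_gt0.
have h := hN _ (leqnn N); rewrite ltr_pdivlMr// in h.
apply: bounded_byW (hT N); apply: le_trans (ltW h); rewrite mulrC ler_wpM2l//.
by rewrite (le_trans (ler_norm C))// lerDl.
Qed.

Lemma limit_selfadj (T : nat -> bop H H) L r : vanishing r ->
  (forall n, bounded_by (L - T n) (r n)) -> (forall n, selfadj (T n)) -> selfadj L.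
Proof.
move=> r0 hL hT; apply/selfadjP/eqP; rewrite -subr_eq0; apply/eqP.
apply: (@bounded_by_vanishing _ 2 _ r0) => n.
have -> : adj L - L = adj (L - T n) - (L - T n).
  by rewrite adjB ((selfadjP _).1 (hT n)) opprB addrA subrK.
rewrite mulr2n mulrDl mul1r; apply: bounded_byD; last exact: bounded_byN.
by apply: bounded_by_adj => //; have [] := r0.
Qed.

Lemma limit_comm (T : nat -> bop H H) L r X : vanishing r ->
  (forall n, bounded_by (L - T n) (r n)) -> (forall n, X * T n = T n * X) ->
  X * L = L * X.
Proof.
move=> r0 hL hT; apply/eqP; rewrite -subr_eq0; apply/eqP.
have [M M0 XM] := bop_bound X.
apply: (@bounded_by_vanishing _ (M + M) _ r0) => n.
have -> : X * L - L * X = X * (L - T n) - (L - T n) * X.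
  by rewrite mulrBr mulrBl hT opprB addrA subrK.
have r0n : 0 <= r n by have [] := r0.
rewrite [X in bounded_by _ X]mulrDl; apply: bounded_byD; first exact: bounded_byM (ltW
  M0) XM (hL n).
by apply: bounded_byN; rewrite [X in bounded_by _ X]mulrC; apply: bounded_byM.
Qed.

End SelfAdjoint.

Section AbsoluteValue.
Variables (R : realType) (H : hilbertType R).
Implicit Types T S X : bop H H.

Fixpoint sqrt_scalar n : R := if n is m.+1 then (1 + sqrt_scalar m ^+ 2) / 2 else 0.

Fixpoint sqrt_iter (B : bop H H) n : bop H H :=
  if n is m.+1 then 2^-1 :r*: (B + sqrt_iter B m * sqrt_iter B m) else 0.

(** For z = 1 - y the recursion reads z -> z (1 - z / 2), which decays like 2 / n. This explicit
    rate becomes the rate of convergence of the operator iteration. *)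
Lemma sqrt_scalar_bounds n :
  0 <= sqrt_scalar n <= 1 /\ 1 - sqrt_scalar n <= 2 / n.+2%:R.
Proof.
elim: n => [|n [/andP[h0 h1] IH]] /=; first by rewrite subr0 divff ?pnatr_eq0// lexx
  ler01.
have n0 : 0 < n.+2%:R :> R by rewrite ltr0n.
split; first by apply/andP; split; nra.
have -> : n.+3%:R = n.+2%:R + 1 :> R by rewrite -[in LHS]addn1 natrD.
set m := n.+2%:R in IH n0 *; set y := sqrt_scalar n in h0 h1 IH *.
have m2 : 2 <= m by rewrite /m -[n.+2]addn2 natrD lerDr.
have hz : (1 - y) * m <= 2 by rewrite -ler_pdivlMr.
rewrite ler_pdivlMr ?addr_gt0//.
have -> : (1 - (1 + y ^+ 2) / 2) = (1 - y) * (1 + y) / 2 by field.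
nra.
Qed.

Lemma vanishing_inv : vanishing (fun n => 2 / n.+2%:R : R).
Proof.
split=> [n|e e0]; first by rewrite divr_ge0.
have [|N hN] := @small_inv R (e / 2); first by rewrite divr_gt0.
exists N => n Nn; rewrite mulrC -ltr_pdivlMr//; apply: le_lt_trans hN.
by rewrite lef_pV2 ?posrE ?ltr0n// ler_nat ltnS (leq_trans Nn).
Qed.

Lemma sqrt_iter_comm B n X : X * B = B * X -> X * sqrt_iter B n = sqrt_iter B n * X.
Proof.
move=> XB; elim: n => [|n IH] /=; first by rewrite mulr0 mul0r.
rewrite -scalebAr -scalebAl; congr (_ *: _).
by rewrite mulrDr mulrDl XB mulrA IH -mulrA IH mulrA.
Qed.

Lemma sqrt_iter_selfadj B n : selfadj B -> selfadj (sqrt_iter B n).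
Proof.
move=> Bs; elim: n => [|n IH] /=; first exact: selfadj0.
by apply: selfadjZ; apply: selfadjD => //; exact: selfadjM.
Qed.

Lemma sqrt_iter_bound B n : bounded_by B 1 -> bounded_by (sqrt_iter B n) (sqrt_scalar n).
Proof.
move=> B1; elim: n => [|n IH] /=; first by move=> x; rewrite bop0E nm0 mul0r.
have [/andP[h0 h1] _] := sqrt_scalar_bounds n.
rewrite [X in bounded_by _ X](_ : _ = `|2^-1| * (1 + sqrt_scalar n ^+ 2)); last first.
  by rewrite ger0_norm ?invr_ge0// mulrC.
apply: bounded_byZ.
by apply: bounded_byD => //; rewrite expr2; exact: bounded_byM.
Qed.

(** Iterates commute, so the difference of squares factors as (Y' - Y) (Y' + Y), and the scalar
    increments dominate by induction. *)
Lemma sqrt_iter_step B n : bounded_by B 1 ->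
  bounded_by (sqrt_iter B n.+1 - sqrt_iter B n) (sqrt_scalar n.+1 - sqrt_scalar n).
Proof.
move=> B1; elim: n => [|n IH].
  rewrite /= subr0 expr0n /= addr0 mulr0 addr0 subr0 mul1r.
  by rewrite -[2^-1 in X in bounded_by _ X]ger0_norm ?invr_ge0// -[`|_|]mulr1; apply:
    bounded_byZ.
rewrite [sqrt_iter B n.+2]/= [X in _ - X]/= -[2^-1 :r*: _ - _]scalerBr.
rewrite -/(sqrt_iter B n.+1) opprD addrACA subrr add0r.
set Y' := sqrt_iter B n.+1 in IH *; set Y := sqrt_iter B n in IH *.
have YY : Y' * Y = Y * Y'.
  apply: sqrt_iter_comm; apply/esym; exact: sqrt_iter_comm.
have -> : Y' * Y' - Y * Y = (Y' - Y) * (Y' + Y).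
  by rewrite mulrDr !mulrBl YY addrA subrK.
have -> : sqrt_scalar n.+2 - sqrt_scalar n.+1 =
   `|2^-1| * ((sqrt_scalar n.+1 - sqrt_scalar n) * (sqrt_scalar n.+1 + sqrt_scalar n)).
  by rewrite ger0_norm ?invr_ge0//=; field.
apply: bounded_byZ; apply: bounded_byM => //.
  by rewrite /= ; have [/andP[h0 h1] _] := sqrt_scalar_bounds n; nra.
by apply: bounded_byD; exact: sqrt_iter_bound.
Qed.

Lemma sqrt_iter_cauchy B m n : bounded_by B 1 -> (m <= n)%N ->
  bounded_by (sqrt_iter B n - sqrt_iter B m) (2 / m.+2%:R).
Proof.
move=> B1 mn; suff h : bounded_by (sqrt_iter B n - sqrt_iter B m) (sqrt_scalar n -
  sqrt_scalar m).
  apply: bounded_byW h; have [_] := sqrt_scalar_bounds m.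
  have [/andP[_ h1] _] := sqrt_scalar_bounds n; apply: le_trans.
  by rewrite lerD2r.
elim: n mn => [|n IH].
  by rewrite leqn0 => /eqP ->; rewrite !subrr => x; rewrite bop0E nm0 mul0r.
rewrite leq_eqVlt => /orP[/eqP ->|/IH h].
  by rewrite !subrr => x; rewrite bop0E nm0 mul0r.
have := bounded_byD (sqrt_iter_step n B1) h.
by rewrite addrA subrK addrA subrK.
Qed.

Definition nonneg T := forall x, 0 <= ip (T x) x.

(* The iteration [Y <- (B + Y^2) / 2] converges to [1 - sqrt (1 - B)]; all its
   steps are polynomials in [B] with nonnegative coefficients, so the scalar
   iteration with [B = 1] dominates it in norm. *)
Lemma sqrt_exists B : selfadj B -> bounded_by B 1 ->
  exists S, [/\ S * S = 1 - B, selfadj S, nonneg S &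
    forall X, X * B = B * X -> X * S = S * X].
Proof.
move=> Bs B1.
have [Y hY] := bop_complete vanishing_inv (fun m n => @sqrt_iter_cauchy B m n B1).
have Yi n : bounded_by (sqrt_iter B n) 1.
  by apply: bounded_byW (sqrt_iter_bound n B1); have [/andP[]] := sqrt_scalar_bounds n.
have Y1 : bounded_by Y 1.
  move=> x; rewrite mul1r; apply/ler_addgt0Pr => e e0.
  have [_ /(_ (e / (nm x + 1)))[|N hN]] := vanishing_inv.
    by rewrite divr_gt0// ltr_wpDl.
  have := hN _ (leqnn N); rewrite ltr_pdivlMr ?ltr_wpDl// => h.
  have := hY N x; have := Yi N x; have := nmD ((Y - sqrt_iter B N) x) (sqrt_iter B N x).
  rewrite bopBE subrK mul1r; set r := 2 / _ in h *.
  have r0 : 0 <= r by rewrite divr_ge0.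
  by move: h r0; set t := r * nm x; rewrite mulrDr mulr1 -/t; lra.
have YY : Y = 2^-1 :r*: (B + Y * Y).
  apply/eqP; rewrite -subr_eq0; apply/eqP.
  apply: (@bounded_by_vanishing _ _ _ 2 _ vanishing_inv) => n.
  set Z := sqrt_iter B n.
  (* The defect of the fixed-point equation is rewritten so that each term contains a difference
     from the limit, of norm at most 2 / (n + 2). *)
  have -> : Y - 2^-1 :r*: (B + Y * Y) = (Y - sqrt_iter B n.+1)
      + 2^-1 :r*: ((Z - Y) * Z + Y * (Z - Y)).
    rewrite /= -/Z mulrBl mulrBr addrA subrK -addrA; congr (_ + _).
    by rewrite -!scalerN -scalerDr; congr (_ *: _); rewrite !opprD addrA subrK.
  rewrite [X in bounded_by _ X](_ : _ = 2 / n.+2%:R + 2 / n.+2%:R); last by ring.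
  apply: bounded_byD.
    apply: bounded_byW (hY n.+1).
    by rewrite ler_wpM2l// lef_pV2 ?posrE ?ltr0n// ler_nat.
  have ZY : bounded_by (Z - Y) (2 / n.+2%:R) by rewrite -opprB; apply: bounded_byN;
    exact: hY.
  have r0 : 0 <= 2 / n.+2%:R :> R by rewrite divr_ge0.
  rewrite [X in bounded_by _ X](_ : _ = `|2^-1| * (2 / n.+2%:R * 1 + 1 * (2 /
    n.+2%:R))); last first.
    by rewrite ger0_norm ?invr_ge0// mulr1 mul1r; field.
  have Z1 : bounded_by Z 1 by exact: Yi.
  by apply: bounded_byZ; apply: bounded_byD; apply: bounded_byM.
have YX X : X * B = B * X -> X * Y = Y * X.
  by move=> XB; apply: (limit_comm vanishing_inv hY) => n; exact: sqrt_iter_comm.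
exists (1 - Y); split.
- have h : Y + Y = B + Y * Y.
    by rewrite {1 2}YY -rscale2 rscaleA mulfV ?pnatr_eq0// rscale1.
  have -> : (1 - Y) * (1 - Y) = 1 - (Y + Y) + Y * Y.
    by rewrite mulrBl mul1r mulrBr mulr1 opprB opprD -!addrA [Y * Y - Y]addrC.
  by rewrite h opprD addrA subrK.
- apply: selfadjB => //; apply: limit_selfadj vanishing_inv hY _ => n.
  exact: sqrt_iter_selfadj.
- move=> x; rewrite bopBE ipBl subr_ge0 -nm2 (le_trans (ip_CS _ _))// expr2 ler_wpM2r//.
  by rewrite -[leRHS]mul1r.
- by move=> X /YX h; rewrite mulrBr mulrBl mulr1 mul1r h.
Qed.

(** B = 1 - T^2 / M^2 has norm at most 1 because 0 <= T^2 <= M^2, and |T| = M sqrt (1 - B). *)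
Lemma abs_exists T : selfadj T ->
  exists S, [/\ S * S = T * T, selfadj S, nonneg S &
    forall X, X * T = T * X -> X * S = S * X].
Proof.
move=> Ts; have [M M0 TM] := bop_bound T.
have TTs : selfadj (T * T) by apply: selfadjM.
pose B := 1 - (M ^- 2) :r*: (T * T).
have Bs : selfadj B by apply: selfadjB => //; exact: selfadjZ.
have B1 : bounded_by B 1.
  apply: selfadj_bound => // x; rewrite mul1r /B bopBE bopZE ipBl ipZl bopME Ts -!nm2.
  rewrite ler_norml; have : M ^- 2 * nm (T x) ^+ 2 <= nm x ^+ 2.
    by rewrite mulrC ler_pdivrMr ?exprn_gt0// mulrC -exprMn ler_pXn2r// nnegrE//
      mulr_ge0// ltW.
  have : 0 <= M ^- 2 * nm (T x) ^+ 2 by rewrite mulr_ge0 ?invr_ge0 ?exprn_ge0// ltW.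
  move=> h1 h2; apply/andP; split; nra.
have [S [S2 Ss S0 Sc]] := sqrt_exists Bs B1.
exists (M :r*: S); split.
- rewrite -scalebAl -scalebAr S2 /B subKr !rscaleA -expr2 mulfV ?rscale1//.
  by rewrite expf_neq0// gt_eqF.
- exact: selfadjZ.
- by move=> x; rewrite bopZE ipZl mulr_ge0// ltW.
- move=> X XT; rewrite -scalebAr -scalebAl Sc//.
  by rewrite /B mulrBr mulrBl mulr1 mul1r -scalebAr -scalebAl mulrA XT -mulrA XT mulrA.
Qed.

End AbsoluteValue.

(** * Spectral theorem *)

Section SpectralFamily.
Variables (R : realType) (H : hilbertType R).
Implicit Types (T S X E : bop H H) (x y : H).

Lemma selfadj_adj T : selfadj T -> adj T = T.
Proof. by move/selfadjP. Qed.

(** Once <T x, x> = 0, nonnegativity at x - t T x reads t (t q - 2 p) >= 0 with p = |T x|^2; a small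
    positive t forces p = 0. *)
Lemma nonneg_ip0 T x : selfadj T -> nonneg T -> ip (T x) x <= 0 -> T x = 0.
Proof.
move=> Ts T0 h; apply: ipxx_eq0; apply/eqP; rewrite eq_le ip_ge0 andbT.
have {}h : ip (T x) x = 0 by apply/eqP; rewrite eq_le h T0.
set p := ip (T x) (T x); set q := ip (T (T x)) (T x).
have p0 : 0 <= p by exact: ip_ge0.
have q0 : 0 <= q by exact: T0.
have key t : 0 <= t * (t * q - 2 * p).
  have := T0 (x - t :r*: T x).
  rewrite linearB linearZ /= !(ipBl, ipBr, ipZl, ipZr) h (Ts (T x) x) -/p -/q; lra.
have := key (p / (q + 1)); have q1 : 0 < q + 1 by rewrite ltr_wpDl.
have -> : p / (q + 1) * (p / (q + 1) * q - 2 * p) =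
   - (p ^+ 2 * ((q + 2) / (q + 1) ^+ 2)) by field; rewrite gt_eqF.
rewrite oppr_ge0 pmulr_lle0; last by rewrite divr_gt0 ?exprn_gt0// ltr_wpDl.
by move=> hp; rewrite le_eqVlt -sqrf_eq0 eq_le hp sqr_ge0.
Qed.

Lemma is_projC E : is_proj E -> is_proj (1 - E).
Proof.
move=> [EE Es]; split; last by apply: selfadjB.
by rewrite mulrBr mulr1 mulrBl mul1r EE subrr subr0.
Qed.

Lemma proj_ip E x : is_proj E -> ip (E x) x = nm (E x) ^+ 2.
Proof. by move=> [EE Es]; rewrite nm2 -Es -bopME EE. Qed.

Lemma proj_nm E x : is_proj E -> nm (E x) <= nm x.
Proof.
move=> hE; have [->|h] := eqVneq (E x) 0; first by rewrite nm0.
rewrite -(@ler_pM2l _ (nm (E x))) ?nm_gt0// -expr2 -proj_ip//; exact: ip_CS.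
Qed.

(* [E] is the projection onto the kernel of [|S| + S]. *)
Lemma spectral_split S : selfadj S -> exists E, [/\ is_proj E,
  forall X, selfadj X -> X * S = S * X -> X * E = E * X,
  forall x, E x = x -> ip (S x) x <= 0,
  forall x, E x = 0 -> 0 <= ip (S x) x &
  forall x, E x = 0 -> ip (S x) x <= 0 -> x = 0].
Proof.
move=> Ss; have [A [AA As A0 Ac]] := abs_exists Ss.
have SA : S * A = A * S by exact: Ac.
have [E [Ep ET TE]] := proj_exists (ker_subspace (A + S)).
have [EE Es] := Ep.
have SE : (A + S) * E = 0 by apply: bopP => x; exact: ET.
(* Since (A + S) (A - S) = 0, the range of A - S lies in ran E; taking adjoints, A and S agree on
   the kernel of E. *)
have EAS : E * (A - S) = A - S.
  have h : (A + S) * (A - S) = 0 by rewrite mulrDl !mulrBr AA SA addrA subrK subrr.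
  by apply: bopP => x; apply: TE; exact: (congr1 (fun Z : bop H H => Z x) h).
have AE : (A - S) * E = A - S.
  have ASs : selfadj (A - S) by exact: selfadjB.
  by rewrite -[RHS]selfadj_adj// -{2}EAS adjM !selfadj_adj.
have AS x : E x = 0 -> A x = S x.
  by move=> Ex; apply/eqP; rewrite -subr_eq0 -bopBE -AE bopME Ex linear0.
exists E; split => //.
- move=> X Xs XS; have XAS : X * (A + S) = (A + S) * X by rewrite mulrDr mulrDl XS Ac.
  have XE : E * (X * E) = X * E.
    have h : (A + S) * (X * E) = 0 by rewrite mulrA -XAS -mulrA SE mulr0.
    by apply: bopP => x; apply: TE; exact: (congr1 (fun Z : bop H H => Z x) h).
  have := congr1 (@adj _ _ _) XE; rewrite !adjM !selfadj_adj// => h.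
  by rewrite -XE mulrA h.
- move=> x Ex; have := congr1 (fun Z : bop H H => ip (Z x) x) SE.
  rewrite bopME Ex bopDE bop0E ipDl ip0l; have := A0 x; lra.
- by move=> x Ex; rewrite -AS.
(* The kernel of S is contained in ran E, so E belongs to the closed half-line (-oo, 0]. This strict
   clause is what yields right continuity later. *)
- move=> x Ex; rewrite -AS// => /(nonneg_ip0 As A0) Ax.
  by rewrite -Ex; apply/esym/TE; rewrite /= -(AS x Ex) Ax addr0.
Qed.

Lemma bop_orthogonal_projection E : is_proj E -> orthogonal_projection E.
Proof.
move=> [EE Es]; split; first exact: bop_bounded_op.
- by move=> x; rewrite -bopME EE.
- exact/inner_adj.
Qed.

Lemma orthogonal_projection_bop (Q : H -> H) : orthogonal_projection Q ->
  exists2 E : bop H H, is_proj E & Q = E.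
Proof.
move=> [Qb QQ Qs]; have [E QE] := bounded_op_bop Qb; exists E => //.
by rewrite QE in QQ Qs; split; [exact: bopP|exact/inner_adj].
Qed.

(** [E l] splits T - l: the form of T is at most l on ran (E l) and at least l on its complement.
    Comparing these bounds at different parameters gives monotonicity, right continuity and the mesh
    estimate. *)
Lemma spectral_family_exists T : selfadj T ->
  exists E : R -> H -> H, is_spectral_family T E.
Proof.
move=> Ts; have Tl l : selfadj (T - l :r*: (1 : bop H H)) by apply: selfadjB => //;
  exact: selfadjZ.
have /choice[E EP] := fun l => spectral_split (Tl l).
have Ep l : is_proj (E l) by case: (EP l).
have EE l x : E l (E l x) = E l x by rewrite -bopME (Ep l).1.
have ipTl l y : ip ((T - l :r*: (1 : bop H H)) y) y = ip (T y) y - l * nm y ^+ 2.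
  by rewrite bopBE bopZE bop1E ipBl ipZl -nm2.
have XTl X l : X * T = T * X -> X * (T - l :r*: (1 : bop H H)) = (T - l :r*: (1 : bop H
  H)) * X.
  by move=> XT; rewrite mulrBr mulrBl XT -scalebAr -scalebAl mulr1 mul1r.
have ET l : T * E l = E l * T by case: (EP l) => _ h _ _ _; apply: h => //; exact: XTl.
have EEc l m : E m * E l = E l * E m.
  by case: (EP l) => _ h _ _ _; apply: h; [exact: (Ep m).2|exact: XTl].
have Eneg l y : E l y = y -> ip (T y) y <= l * nm y ^+ 2.
  by case: (EP l) => _ _ h _ _ /h; rewrite ipTl subr_le0.
have Epos l y : E l y = 0 -> l * nm y ^+ 2 <= ip (T y) y.
  by case: (EP l) => _ _ _ h _ /h; rewrite ipTl subr_ge0.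
have Ezero l y : E l y = 0 -> ip (T y) y <= l * nm y ^+ 2 -> y = 0.
  by case: (EP l) => _ _ _ _ h /h; rewrite ipTl subr_le0.
have sq0 (y : H) (c : R) : 0 < c -> c * nm y ^+ 2 <= 0 -> y = 0.
  move=> c0; rewrite pmulr_rle0// => h; apply: nm0_eq0; apply/eqP.
  by rewrite -sqrf_eq0 eq_le h sqr_ge0.
have Emon l m : l <= m -> E l * E m = E l.
  rewrite le_eqVlt => /orP[/eqP ->|lm]; first exact: (Ep m).1.
  apply: bopP => x; apply/eqP; rewrite -subr_eq0 -oppr_eq0 opprB; apply/eqP.
  (* A vector of ran (E l) in the kernel of [E m] satisfies m |y|^2 <= <T y, y> <= l |y|^2 with l <
     m, so it is 0. *)
  rewrite -EEc bopME; set y := _ - _.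
  have Emy : E m y = 0 by rewrite linearB /= EE subrr.
  have Ely : E l y = y by rewrite linearB /= EE -(bopME (E l) (E m)) (EEc m l) bopME EE.
  apply: (sq0 _ (m - l)); rewrite ?subr_gt0//.
  have := Eneg _ _ Ely; have := Epos _ _ Emy; lra.
have Emon' l m : l <= m -> E m * E l = E l by move=> lm; rewrite EEc Emon.
have Edm l m m' x : l <= m -> m <= m' -> nm (E m x - E l x) <= nm (E m' x - E l x).
  move=> lm mm'; have -> : E m x - E l x = E m (E m' x - E l x).
    by rewrite linearB /= -!bopME Emon// Emon'.
  exact: proj_nm.
exists (fun l => E l); split.
- by move=> l; exact: bop_orthogonal_projection.
- by move=> l m x lm; rewrite -bopME Emon.
- move=> l x; apply/cvgrPdist_lt => e; rewrite ltcE /= => /andP[/eqP e2 e0].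
  suff [d d0 hd] : exists2 d, 0 < d & nm (E (l + d) x - E l x) < complex.Re e.
    near=> m; rewrite nmE nm_distC ltcE /= -e2 eqxx /=.
    apply: le_lt_trans hd; apply: Edm; first by apply: ltW; near: m; exact: nbhs_right_gt.
    by apply: ltW; near: m; apply: nbhs_right_lt; rewrite ltrDl.
  (* Convergence is tested along this sequence, [Edm] covering the values in between; the squares |E
     (m k) x|^2 decrease, and Pythagoras turns this into the Cauchy property. *)
  pose m k := l + k.+1%:R^-1 : R.
  have lm k : l < m k by rewrite ltrDl invr_gt0.
  have mm j k : (j <= k)%N -> m k <= m j by move=> jk; rewrite lerD2l lef_pV2 ?posrE//
    ler_nat.
  pose u k := E (m k) x.
  pose V := [set nm (u k) ^+ 2 | k in setT].
  have Vi : has_inf V.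
    by split; [exists (nm (u 0%N) ^+ 2), 0%N|exists 0 => _ [k _ <-]; rewrite sqr_ge0].
  have [y uy] : exists y, tends u y.
    apply: nm_complete => r r0.
    have [_ [N _ <-] hN] := inf_adherent (exprn_gt0 2 r0) Vi.
    exists N => j k Nj jk.
    have hp : nm (u j) ^+ 2 = nm (u j - u k) ^+ 2 + nm (u k) ^+ 2.
      rewrite -pythagoras ?subrK// ipBl /u (Ep _).2 -bopME (Emon' _ _ (mm _ _ jk)) (Ep
        (m k)).2.
      by rewrite EE subrr.
    have h1 : inf V <= nm (u k) ^+ 2.
      by apply: ge_inf; [case: Vi|exists k].
    have h2 : nm (u j) ^+ 2 <= nm (u N) ^+ 2.
      rewrite ler_pXn2r ?nnegrE// /u -(Emon _ _ (mm _ _ Nj)) bopME; exact: proj_nm.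
    rewrite nm_distC -(@ltr_pXn2r _ 2) ?nnegrE// ?(ltW r0)//; lra.
  have Ey k : E (m k) y = y.
    apply: (tends_unique (u := u) _ uy) => r r0.
    have [N hN] := bop_tends (E (m k)) uy r0.
    exists (maxn N k) => n; rewrite geq_max => /andP[/hN /= h kn].
    by move: h; rewrite /u -bopME Emon'// mm.
  have yl : y = E l x.
    have ly : E l y = E l x.
      apply: (tends_unique (bop_tends (E l) uy)) => r r0; exists 0%N => n _ /=.
      by rewrite -bopME Emon ?(ltW (lm n))// subrr nm0.
    (* This [z] lies in ran (E (m k)) for every k, so <T z, z> <= l |z|^2 in the limit, while E l z
       = 0; [Ezero] then gives z = 0. *)
    rewrite -ly; apply/eqP; rewrite -subr_eq0; apply/eqP; set z := _ - _.
    have Elz : E l z = 0 by rewrite linearB /= EE subrr.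
    apply: (Ezero l) => //; apply/ler_addgt0Pr => r r0.
    have [|k hk] := @small_inv _ (r / (nm z ^+ 2 + 1)); first by rewrite divr_gt0//
      ltr_wpDl// sqr_ge0.
    have Ekz : E (m k) z = z by rewrite linearB /= Ey -bopME Emon' ?ly ?(ltW (lm k))//
      -ly.
    apply: le_trans (Eneg _ _ Ekz) _; rewrite mulrDl lerD2l.
    move: hk; rewrite ltr_pdivlMr ?ltr_wpDl ?sqr_ge0// => /ltW; apply: le_trans.
    by rewrite ler_wpM2l// lerDl.
  have [N hN] := uy _ e0; exists N.+1%:R^-1; first by rewrite invr_gt0.
  by have := hN N (leqnn _); rewrite /u yl.
- have [M M0 TM] := bop_bound T.
  have TM2 y : `|ip (T y) y| <= M * nm y ^+ 2.
    by rewrite (le_trans (ip_CSn _ _))// expr2 mulrA ler_wpM2r.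
  have E0 l x : l <= - M - 1 -> E l x = 0.
    move=> lM; apply: (sq0 _ (- M - l)); first lra.
    have := Eneg l _ (EE l x); have := TM2 (E l x); rewrite ler_norml => /andP[h _]; lra.
  have E1 l x : M + 1 <= l -> E l x = x.
    move=> lM; apply/eqP; rewrite eq_sym -subr_eq0; apply/eqP.
    apply: (sq0 _ (l - M)); first lra.
    have Ely : E l (x - E l x) = 0 by rewrite linearB /= EE subrr.
    have := Epos l _ Ely; have := TM2 (x - E l x); rewrite ler_norml => /andP[_ h]; lra.
  (* The margin 1 beyond the bound M makes the comparisons strict. A mesh below e suffices, because
     on the slice [D i] the form of T lies between two consecutive nodes, hence within e of
     [xi i]. *)
  exists (- M - 1), (M + 1); split=> // e e0; exists e => // N s xi s0 sN hs x.
  pose D (i : 'I_N) := E (s i.+1) - E (s i).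
  have Dp i : is_proj (D i).
    split; last by apply: selfadjB; exact: (Ep _).2.
    have [h1 h2 _] := hs i (ltn_ord i); have h := le_trans h1 h2.
    by rewrite mulrBr !mulrBl (Ep _).1 Emon// Emon'// (Ep _).1 subrr subr0.
  have Dsum : \sum_i D i = 1.
    rewrite -(big_mkord xpredT (fun i => E (s i.+1) - E (s i))) telescope_sumr//.
    by apply: bopP => z; rewrite bopBE E1// E0// subr0.
  pose W := T - \sum_(i < N) xi i :r*: D i.
  have Wb : bounded_by W e.
    apply: selfadj_bound.
      apply: selfadjB => //; elim/big_ind: _ => //; first exact: selfadj0.
        by move=> ? ?; exact: selfadjD.
      by move=> i _; apply: selfadjZ; exact: (Dp i).2.
    move=> z; have -> : nm z ^+ 2 = \sum_i nm (D i z) ^+ 2.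
      rewrite nm2 -{1}[z]bop1E -Dsum bop_sumE ip_suml; apply: eq_bigr => i _.
      exact: proj_ip.
    have -> : ip (W z) z = \sum_i (ip (T (D i z)) (D i z) - xi i * nm (D i z) ^+ 2).
      rewrite bopBE ipBl big_split /= -{1}[T]mulr1 -Dsum mulr_sumr !bop_sumE !ip_suml
        sumrN.
      congr (_ - _); apply: eq_bigr => i _; last by rewrite bopZE ipZl proj_ip.
      have DT : D i * T = T * D i by rewrite mulrBr mulrBl !ET.
      have -> : T * D i = D i * (T * D i) by rewrite mulrA DT -mulrA (Dp i).1.
      by rewrite bopME (Dp i).2.
    rewrite mulr_sumr (le_trans (ler_norm_sum _ _ _))//; apply: ler_sum => i _.
    have [h1 h2 h3] := hs i (ltn_ord i); have h := le_trans h1 h2.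
    have z1 : E (s i) * D i = 0 by rewrite mulrBr Emon// (Ep _).1 subrr.
    have z2 : E (s i.+1) * D i = D i by rewrite mulrBr (Ep _).1 Emon'//.
    have := Epos (s i) (D i z); rewrite -bopME z1 bop0E => /(_ erefl).
    have := Eneg (s i.+1) (D i z); rewrite -bopME z2 => /(_ erefl).
    have := sqr_ge0 (nm (D i z)); set q := _ ^+ 2; set p := ip _ _ => q0 g1 g2.
    by rewrite ler_norml; apply/andP; split; nra.
  rewrite !nmE -rmorphM lecR; have := Wb x.
  by rewrite bopBE bop_sumE.
Unshelve. all: by end_near. Qed.

(** F = 1 - 2 E 0. On a grid having 0 as a node, F is -1 on the slices to the left of 0 and +1 on
    those to the right, so for each Riemann sum S the product F S = S F is nonnegative; both facts
    pass to the norm limit T. *)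
Lemma sign_of_family T (E : R -> H -> H) : is_spectral_family T E ->
  exists F : bop H H, [/\ F * F = 1, selfadj F, F * T = T * F, nonneg (F * T) &
    forall x, x - E 0 x = 2^-1 :r*: (x + F x)].
Proof.
move=> [Ep Emon _ [a [b [Ea Eb Esum]]]].
have /choice[G GP] : forall l, exists G : bop H H, is_proj G /\ E l = G.
  by move=> l; have [G] := orthogonal_projection_bop (Ep l); exists G.
have Gp l : is_proj (G l) := (GP l).1.
have EG l x : E l x = G l x by rewrite (GP l).2.
have GG l m : l <= m -> G l * G m = G l.
  by move=> lm; apply: bopP => x; rewrite bopME -!EG Emon.
have GG' l m : l <= m -> G m * G l = G l.
  move=> lm; rewrite -[RHS](selfadj_adj (Gp l).2) -[in RHS](GG _ _ lm) adjM.
  by rewrite (selfadj_adj (Gp l).2) (selfadj_adj (Gp m).2).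
have Gc l m : G l * G m = G m * G l.
  case: (leP l m) => [lm|/ltW lm]; first by rewrite GG// GG'.
  by rewrite GG'// GG.
pose F := 1 - 2 :r*: G 0.
have FF : F * F = 1.
  have gg : (2 :r*: G 0) * (2 :r*: G 0) = 2 :r*: G 0 + 2 :r*: G 0.
    by rewrite -scalebAl -scalebAr (Gp 0).1 [LHS]rscale2.
  by rewrite /F mulrBl mul1r mulrBr mulr1 gg opprB addrK subrK.
have Fs : selfadj F by apply: selfadjB => //; apply: selfadjZ; exact: (Gp 0).2.
have Fn x : nm (F x) = nm x.
  by rewrite /nm Fs -bopME FF bop1E.
have approx (e : R) : 0 < e -> exists S : bop H H,
    [/\ bounded_by (T - S) e, F * S = S * F & nonneg (F * S)].
  move=> /Esum[d d0 hd].
  (* The step d / 2 keeps the mesh strictly below d, and K steps on either side of 0 reach beyond a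
     and b. *)
  pose q := d / 2; have q0 : 0 < q by rewrite divr_gt0.
  pose K := (Num.truncn ((`|a| + `|b|) / q)).+1.
  have hK : `|a| + `|b| < K%:R * q by rewrite -ltr_pdivrMr//; exact: truncnS_gt.
  pose s (i : nat) := (i%:R - K%:R) * q : R.
  have sS i : s i.+1 = s i + q by rewrite /s -natr1; ring.
  have := hd (K + K)%N s s _ _ _; rewrite /s natrD.
  move=> h; have {}h : forall x, `|T x - \sum_(i < K + K) s i :r*: (E (s i.+1) x - E (s
    i) x)|
      <= e%:C%C * `|x|.
    apply: h.
    - by have := ler_norm (- a); rewrite normrN; have := normr_ge0 b; lra.
    - by have := ler_norm b; have := normr_ge0 a; lra.
    - by move=> i _; rewrite -/(s i) -/(s i.+1) sS /q; split; lra.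
  pose D (i : 'I_(K + K)) := G (s i.+1) - G (s i).
  have Dp i : is_proj (D i).
    split; last by apply: selfadjB; exact: (Gp _).2.
    have ss : s i <= s i.+1 by rewrite sS; lra.
    by rewrite mulrBr !mulrBl (Gp _).1 GG// GG'// (Gp _).1 subrr subr0.
  exists (\sum_(i < K + K) s i :r*: D i); split.
  - move=> x; have := h x; rewrite !nmE -rmorphM lecR bopBE bop_sumE.
    apply: le_trans; rewrite le_eqVlt; apply/orP; left; apply/eqP.
    by congr (nm (_ - _)); apply: eq_bigr => i _; rewrite bopZE bopBE !EG.
  - rewrite mulr_sumr mulr_suml; apply: eq_bigr => i _.
    rewrite -scalebAl -scalebAr /F /D; congr (_ *: _).
    rewrite mulrBl mul1r [RHS]mulrBr mulr1 -scalebAl -scalebAr mulrBr mulrBl.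
    by rewrite (Gc 0 (s i)) (Gc 0 (s i.+1)).
  - move=> x; rewrite mulr_sumr bop_sumE ip_suml; apply: sumr_ge0 => i _.
    rewrite -scalebAr bopZE ipZl.
    have [iK|Ki] := ltnP i K.
      have s0 : s i.+1 <= 0 by rewrite /s mulr_le0_ge0 ?(ltW q0)// subr_le0 ler_nat.
      have -> : F * D i = - D i.
        rewrite /F /D mulrBl mul1r -scalebAl mulrBr !GG'//; last by rewrite (le_trans _
          s0)// sS; lra.
        by rewrite rscale2 opprD addrA subrr sub0r.
      rewrite bopNE ipNl mulrN -mulNr mulr_ge0//; last by rewrite proj_ip// sqr_ge0.
      by rewrite oppr_ge0; move: s0; rewrite sS; lra.
    have s0 : 0 <= s i by rewrite /s mulr_ge0 ?(ltW q0)// subr_ge0 ler_nat.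
    have -> : F * D i = D i.
      rewrite /F /D mulrBl mul1r -scalebAl mulrBr !GG//; first by rewrite subrr scaler0
        subr0.
      by rewrite sS; lra.
    by rewrite mulr_ge0// proj_ip// sqr_ge0.
exists F; split => //.
- apply/eqP; rewrite -subr_eq0; apply/eqP; apply: bounded_by0 => e e0.
  have [|S [Sb SF _]] := approx (e / 2); first by rewrite divr_gt0.
  have -> : F * T - T * F = F * (T - S) - (T - S) * F.
    by rewrite [F * (T - S)]mulrBr [(T - S) * F]mulrBl SF opprB addrA subrK.
  rewrite [e](_ : e = e / 2 + e / 2); last by field.
  apply: bounded_byD; first by move=> x; rewrite bopME Fn.
  by apply: bounded_byN => x; rewrite bopME -(Fn x).
- move=> x; rewrite leNgt; apply/negP => h.
  (* This radius keeps the error at x below half the size of the supposed negative value. *)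
  have [|S [Sb _ S0]] := approx (- ip ((F * T) x) x / (2 * (nm x ^+ 2 + 1))).
    by rewrite divr_gt0 ?oppr_gt0// mulr_gt0// ltr_wpDl// sqr_ge0.
  have := S0 x; have := ip_CSn (F ((T - S) x)) x; rewrite Fn.
  have := Sb x; set r := _ / _ => h1.
  have -> : ip (F ((T - S) x)) x = ip ((F * T) x) x - ip ((F * S) x) x.
    by rewrite bopBE linearB ipBl.
  rewrite ler_norml => /andP[h2 _] h3.
  have h4 : nm ((T - S) x) * nm x <= r * nm x ^+ 2 by rewrite expr2 mulrA ler_wpM2r.
  have : r * (2 * (nm x ^+ 2 + 1)) = - ip ((F * T) x) x.
    by rewrite divfK// gt_eqF// mulr_gt0// ltr_wpDl// sqr_ge0.
  have r0 : 0 < r by rewrite divr_gt0 ?oppr_gt0// mulr_gt0// ltr_wpDl// sqr_ge0.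
  have := sqr_ge0 (nm x); set N := nm x ^+ 2 in h4 *.
  have := mulr_ge0 (ltW r0) (sqr_ge0 (nm x)); rewrite -/N; lra.
- move=> x; rewrite EG /F bopBE bopZE bop1E addrA -[x + x]rscale2 -scalerBr.
  by rewrite rscaleA mulVf ?pnatr_eq0// rscale1.
Qed.

(** A spectral family exists, so the one chosen by [xget] is genuine and its default does not
    arise. *)
Lemma positive_spectral_projection_sign T : selfadj T ->
  exists F : bop H H, [/\ F * F = 1, selfadj F, F * T = T * F, nonneg (F * T) &
    forall x, positive_spectral_projection T x = 2^-1 :r*: (x + F x)].
Proof.
move=> Ts; apply: sign_of_family; rewrite /spectral_family.
by case: xgetP => [E _ //|h]; have [E] := spectral_family_exists Ts; move=> /h.
Qed.

End SpectralFamily.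

(** * Compact operators and the Sylvester equation *)

Section TotallyBounded.
Variable R : realType.
Implicit Types H G L : hilbertType R.

(** Finite nets for the image of the unit ball: in this form compactness adds, composes and lifts by
    elementary estimates. [compact_op_tb] and [tb_compact_op] match it with [compact_op]. *)
Definition tb H G (K : bop H G) := forall e : R, 0 < e ->
  exists ys : seq G, forall x, nm x <= 1 -> exists2 y, y \in ys & nm (K x - y) < e.

Lemma compact_op_tb H G (K : bop H G) : compact_op K -> tb K.
Proof.
move=> [_ [U KU [Uc _]]] e e0.
move: Uc; rewrite compact_cover => /(_ G setT (fun y => ball y e%:C%C)).
case=> [y _|y _|D' _ UD].
- by apply: ball_open; rewrite ltcR.
- by exists y => //; apply: ballxx; rewrite ltcR.
exists (finmap.enum_fset D') => x x1.
have [|y yD] := UD (K x).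
  by apply: KU; exists x => //=; rewrite nmE -(rmorph1 (real_complex R)) lecR.
rewrite -ball_normE /ball_ /= nmE nm_distC ltcR => h.
by exists y.
Qed.

Lemma ultra_finite_union (T : choiceType) (F : set_system T) (I : eqType)
    (s : seq I) (B : I -> set T) : UltraFilter F ->
  F [set t | exists2 i, i \in s & B i t] -> exists2 i, i \in s & F (B i).
Proof.
move=> FU; elim: s => [|i s IH] Fs.
  by have [t [? //]] := filter_ex Fs.
have [FB|FB] := in_ultra_setVsetC (B i) FU; first by exists i; rewrite ?mem_head.
have [|j js FBj] := IH.
  apply: filterS (filterI Fs FB) => t [[j]]; rewrite inE => /orP[/eqP ->|js] Bt nBt.
    by have := nBt Bt.
  by exists j.
by exists j => //; rewrite inE js orbT.
Qed.

(** An ultrafilter on the closure of the image contains a ball around some point of each finite net,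
    so it is Cauchy and converges by completeness. *)
Lemma tb_compact_op H G (K : bop H G) : tb K -> compact_op K.
Proof.
move=> Ktb; split; first exact: bop_bounded_op.
rewrite precompactE compact_ultra => F FU FA.
have Fc : cauchy F.
  apply/cauchyP => e; rewrite ltcE /= => /andP[/eqP e2 e0].
  have [|ys hys] := Ktb (complex.Re e / 2); first by rewrite divr_gt0.
  have [|y _ Fy] := @ultra_finite_union _ F _ ys (fun y => ball y e) FU; last by exists y.
  apply: filterS FA => z /(_ (ball z (complex.Re e / 2)%:C%C)) [].
    by apply: nbhsx_ballx; rewrite ltcR divr_gt0.
  move=> _ [[x /= x1 <-]]; rewrite -ball_normE /ball_ /= nmE nm_distC ltcR => h.
  have [|y yys hy] := hys x.
    by move: x1; rewrite nmE -(rmorph1 (real_complex R)) lecR.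
  exists y => //; rewrite /ball_ /= nmE ltcE /= -e2 eqxx /=.
  have := nmB_trans (K x) y z; rewrite (nm_distC y (K x)); lra.
have Fp : cvg F by exact: cauchy_cvg.
exists (lim F); split => //.
apply: (@closed_cvg _ _ F _ id) => //; first exact: closed_closure.
Qed.

Lemma tb_centers H G (K : bop H G) (e : R) : tb K -> 0 < e ->
  exists xs : seq H, (forall x, x \in xs -> nm x <= 1) /\
    forall x, nm x <= 1 -> exists2 x', x' \in xs & nm (K x - K x') < e.
Proof.
move=> Ktb e0; have [|ys hys] := Ktb (e / 2); first by rewrite divr_gt0.
have /choice[f fP] : forall y, exists x', nm x' <= 1 /\
    forall x, nm x <= 1 -> nm (K x - y) < e / 2 -> nm (K x' - y) < e / 2.
  move=> y; have [[x [x1 hx]]|h] := pselect (exists x, nm x <= 1 /\ nm (K x - y) < e / 2).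
    by exists x.
  (* No image point is close to this [y], so the default 0 satisfies the condition vacuously. *)
  by exists 0; rewrite nm0; split => // x x1 hx; exfalso; apply: h; exists x.
exists (map f ys); split=> [_ /mapP[y _ ->]|x x1]; first exact: (fP y).1.
have [y yys hy] := hys _ x1; exists (f y); first exact: map_f.
have := (fP y).2 _ x1 hy; have := nmB_trans y (K x) (K (f y)).
rewrite (nm_distC y); lra.
Qed.

Lemma tb0 H G : tb (0 : bop H G).
Proof. by move=> e e0; exists [:: 0] => x _; exists 0; rewrite ?mem_head// subrr nm0. Qed.

Lemma tbD H G (K K' : bop H G) : tb K -> tb K' -> tb (K + K').
Proof.
move=> hK hK' e e0; have e2 : 0 < e / 2 by rewrite divr_gt0.
have [ys hys] := hK _ e2; have [zs hzs] := hK' _ e2.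
exists [seq y + z | y <- ys, z <- zs] => x x1.
have [y yys hy] := hys _ x1; have [z zzs hz] := hzs _ x1.
exists (y + z); first by apply/allpairsP; exists (y, z).
rewrite bopDE opprD addrACA; have := nmD (K x - y) (K' x - z); lra.
Qed.

Lemma tb_compl H G L (T : bop G L) (K : bop H G) : tb K -> tb (bcomp T K).
Proof.
move=> hK e e0; have [M M0 TM] := bop_bound T.
have [|ys hys] := hK (e / M); first by rewrite divr_gt0.
exists (map T ys) => x /hys[y yys hy]; exists (T y); first exact: map_f.
by rewrite /= -linearB (le_lt_trans (TM _))// mulrC -ltr_pdivlMr.
Qed.

(** The image of the unit ball under [K'] lies in c times that under [K]. The lift [v] may depend on
    [x] in any way, which suits preimages under an operator with closed range. *)
Lemma tb_lift H H' G (K : bop H G) (K' : bop H' G) (c : R) : 0 < c ->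
  (forall x, nm x <= 1 -> exists2 v, K v = K' x & nm v <= c) -> tb K -> tb K'.
Proof.
move=> c0 h hK e e0; have [|ys hys] := hK (e / c); first by rewrite divr_gt0.
exists (map (fun y => c :r*: y) ys) => x /h[v <- vc].
have [|y yys hy] := hys (c^-1 :r*: v).
  by rewrite nmZ ger0_norm ?invr_ge0 ?(ltW c0)// ler_pdivrMl// mulr1.
exists (c :r*: y); first exact: map_f.
have -> : K v - c :r*: y = c :r*: (K (c^-1 :r*: v) - y).
  by rewrite scalerBr [K (_ *: _)]linearZ /= rscaleA mulfV ?gt_eqF// rscale1.
by rewrite nmZ gtr0_norm// mulrC -ltr_pdivlMr.
Qed.

Lemma tb_compr H G L (S : bop L H) (K : bop H G) : tb K -> tb (bcomp K S).
Proof.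
have [M M0 SM] := bop_bound S; apply: (@tb_lift _ _ _ _ _ M) => // x x1.
by exists (S x) => //; rewrite (le_trans (SM x))// -[leRHS]mulr1 ler_wpM2l// ltW.
Qed.

Lemma tb_sum H G (I : Type) (r : seq I) (Q : pred I) (F : I -> bop H G) :
  (forall i, Q i -> tb (F i)) -> tb (\sum_(i <- r | Q i) F i).
Proof. by move=> h; elim/big_ind: _ => //; [exact: tb0|exact: tbD]. Qed.

Lemma tbN H G (K : bop H G) : tb K -> tb (- K).
Proof.
move=> hK; have -> : - K = bcomp (- bid G) K by apply: bopP.
exact: tb_compl.
Qed.

Lemma tbB H G (K K' : bop H G) : tb K -> tb K' -> tb (K - K').
Proof. by move=> hK hK'; apply: tbD => //; exact: tbN. Qed.

Lemma tb_lim H G (K : bop H G) :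
  (forall e, 0 < e -> exists2 K', tb K' & bounded_by (K - K') e) -> tb K.
Proof.
move=> h e e0; have e2 : 0 < e / 2 by rewrite divr_gt0.
have [K' hK' KK'] := h _ e2; have [ys hys] := hK' _ e2.
exists ys => x x1; have [y yys hy] := hys _ x1; exists y => //.
have := KK' x; rewrite bopBE; have := nmB_trans (K' x) (K x) y.
have : e / 2 * nm x <= e / 2 by rewrite -[leRHS]mulr1 ler_wpM2l// ltW.
lra.
Qed.

(** |K^* w|^2 = <K K^* w, w>, and |w| <= 2 for a difference w of points of the unit ball; so centers
    for K K^* at accuracy e^2 / 2 are centers for K^* at accuracy e. *)
Lemma tb_adj H G (K : bop H G) : tb K -> tb (adj K).
Proof.
move=> hK e e0; have e2 : 0 < e ^+ 2 / 2 by rewrite divr_gt0// exprn_gt0.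
have [xs [xs1 hxs]] := tb_centers (tb_compr (adj K) hK) e2.
exists (map (adj K) xs) => x x1; have [x' xx' hx'] := hxs _ x1.
exists (adj K x'); first exact: map_f.
rewrite -(@ltr_pXn2r _ 2) ?nnegrE ?(ltW e0)// -linearB nm2 -adjP.
apply: le_lt_trans (ip_CS _ _) _; rewrite linearB linearB /=.
move: hx'; set a := nm _ => ha.
have hb : nm (x - x') <= 2 by have := nmB x x'; have := xs1 _ xx'; lra.
have a0 : 0 <= a by exact: nm_ge0.
have : a * nm (x - x') <= a * 2 by rewrite ler_wpM2l.
lra.
Qed.

End TotallyBounded.

Section ClosedIdeals.
Variables (R : realType) (H : hilbertType R).
Implicit Types (J : bop H H -> Prop) (S Y K D F a : bop H H).

Record closed_ideal J := ClosedIdeal {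
  ideal0 : J 0 ;
  idealD : forall K K', J K -> J K' -> J (K + K') ;
  idealMl : forall X K, J K -> J (X * K) ;
  idealMr : forall X K, J K -> J (K * X) ;
  ideal_lim : forall K,
    (forall e, 0 < e -> exists2 K', J K' & bounded_by (K - K') e) -> J K }.

Lemma compact_ideal : closed_ideal (@tb R H H).
Proof.
split; [exact: tb0|exact: tbD|move=> X K; exact: tb_compl|move=> X K; exact: tb_compr|].
exact: tb_lim.
Qed.

Lemma zero_ideal : closed_ideal (fun K => K = 0).
Proof.
split=> [//|K K' -> ->|X K ->|X K ->|K h]; rewrite ?addr0 ?mulr0 ?mul0r//.
by apply: bounded_by0 => e /h[K' ->]; rewrite subr0.
Qed.

Lemma idealZ J k K : closed_ideal J -> J K -> J (k *: K).
Proof. by move=> hJ hK; rewrite -[K]mul1r scalebAl; exact: (idealMl hJ). Qed.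

Lemma idealB J K K' : closed_ideal J -> J K -> J K' -> J (K - K').
Proof.
by move=> hJ hK hK'; rewrite -scaleN1r; apply: idealD => //; exact: idealZ.
Qed.

Lemma expr_small (r C e : R) : 0 <= r < 1 -> 0 < C -> 0 < e -> exists m, r ^+ m * C < e.
Proof.
move=> /andP[r0 r1] C0 e0.
have eC : 0 < e / C by rewrite divr_gt0.
have : `|r| < 1 by rewrite ger0_norm.
move=> /cvg_expr/cvgrPdist_lt/(_ _ eC)[N _ /(_ N (leqnn N))] /=.
rewrite sub0r normrN ger0_norm ?exprn_ge0// => h.
by exists N; rewrite -ltr_pdivlMr.
Qed.

(** The operator inequality S^2 <= M S, obtained from nonnegativity at x - S x / M. *)
Lemma nonneg_lower S (M : R) x : selfadj S -> nonneg S -> 0 < M -> bounded_by S M ->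
  nm (S x) ^+ 2 / M <= ip (S x) x.
Proof.
move=> Ss S0 M0 SM; have := S0 (x - M^-1 :r*: S x).
rewrite linearB linearZ /= !(ipBl, ipBr, ipZl, ipZr) (Ss (S x) x) -nm2.
have : ip (S (S x)) (S x) <= M * nm (S x) ^+ 2.
  by rewrite (le_trans (ip_CS _ _))// expr2 mulrA ler_wpM2r.
set q := ip (S (S x)) _; set p := ip _ x; set a := nm _ ^+ 2 => h.
have : M^-1 * (M^-1 * q) <= M^-1 * a.
  by rewrite ler_pM2l ?invr_gt0// ler_pdivrMl.
rewrite [a / M]mulrC; lra.
Qed.

Definition sylvester_map Z (s : R) S Y := Z * Y * Z - s :r*: (S * Y * S).

Lemma sylvester_mapB Z s S Y K :
  sylvester_map Z s S (Y - K) = sylvester_map Z s S Y - sylvester_map Z s S K.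
Proof.
rewrite /sylvester_map 2!mulrBr 2!mulrBl scalerBr !opprB.
by rewrite [LHS](AC (2*2) ((1*4)*(3*2)))%AC.
Qed.

(** Subtracting s^2 S Y S removes the quadratic term of (1 - s S) Y (1 - s S) and leaves Y - s (S Y
    + Y S). *)
Lemma sylvester_mapE (s : R) S Y :
  Y = s :r*: (S * Y + Y * S) + sylvester_map (1 - s :r*: S) (s * s) S Y.
Proof.
have -> : s :r*: (S * Y + Y * S) = (s :r*: S) * Y + Y * (s :r*: S).
  by rewrite scalerDr scalebAl scalebAr.
have e : (s * s) :r*: (S * Y * S) = (s :r*: S) * Y * (s :r*: S).
  by rewrite -!scalebAl -scalebAr rscaleA.
rewrite /sylvester_map e; set g := _ :r*: S.
have -> : (1 - g) * Y * (1 - g) = Y - g * Y - (Y * g - g * Y * g).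
  by rewrite [LHS]mulrBr mulr1 [(1 - g) * Y]mulrBl mul1r [(_ - _) * g]mulrBl.
set x := g * Y; set y := Y * g; set z := x * g.
rewrite opprB -[Y - x + _ - z]addrA [z - y - z]addrAC subrr sub0r.
by rewrite -[Y - x - y]addrA -opprD addrCA subrr addr0.
Qed.

(* With [eta] small, [Y |-> (1 - eta S) Y (1 - eta S) - eta^2 S Y S] is a
   contraction and moves [Y] by [eta (S Y + Y S)]. *)
Lemma sylvester J S Y (c : R) : closed_ideal J -> selfadj S -> nonneg S ->
  (forall x, nm x <= c * nm (S x)) -> J (S * Y + Y * S) -> J Y.
Proof.
move=> hJ Ss S0 Sc hL; have [M0 M00 SM0] := bop_bound S.
pose M := M0 + 1; have M1 : 1 <= M by rewrite lerDr ltW.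
have M0' : 0 < M by lra.
have SM : bounded_by S M by move=> x; rewrite (le_trans (SM0 x))// ler_wpM2r// lerDl.
pose C := `|c| + 1; have C1 : 1 <= C by rewrite lerDr.
have C0 : 0 < C by lra.
have {}Sc x : nm x <= C * nm (S x).
  rewrite (le_trans (Sc x))// ler_wpM2r// /C; have := ler_norm c; lra.
(* k bounds |S x|^2 / (M |x|)^2 from below, and |eta S| <= t. With |Z|^2 <= q2 the contraction
   factor is r = q2 + t^2 = 1 - 3 k^2 / 4 + k^3 / 4, which is below 1 because 0 < k <= 1; M and C
   are taken at least 1 to ensure k <= 1. *)
pose k := (C * M)^-2.
have k0 : 0 < k by rewrite invr_gt0 exprn_gt0// mulr_gt0.
have k1 : k <= 1.
  by rewrite invf_le1 ?exprn_gt0 ?mulr_gt0// exprn_ege1// -[1]mulr1 ler_pM.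
pose t := k / 2; have t0 : 0 < t by rewrite divr_gt0.
pose eta := t / M.
have eta0 : 0 < eta by rewrite divr_gt0.
pose q2 := 1 - (2 * t - t ^+ 2) * k.
have q20 : 0 <= q2 by rewrite /q2 /t; nra.
pose q := Num.sqrt q2.
have qq : q * q = q2 by rewrite -expr2 sqr_sqrtr.
have q0 : 0 <= q by exact: sqrtr_ge0.
pose Z := 1 - eta :r*: S.
have Zq : bounded_by Z q.
  move=> x; rewrite -(@ler_pXn2r _ 2) ?nnegrE ?mulr_ge0// exprMn [q ^+ 2]expr2 qq.
  rewrite bopBE bop1E bopZE nm2 !(ipBl, ipBr, ipZl, ipZr) (ipC x (S x)) -!nm2.
  have h1 := nonneg_lower x Ss S0 M0' SM.
  have h2 : k * M ^+ 2 * nm x ^+ 2 <= nm (S x) ^+ 2.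
    have -> : k * M ^+ 2 = (C ^+ 2)^-1 by rewrite /k exprMn invfM mulfVK// expf_neq0//
      gt_eqF.
    by rewrite ler_pdivrMl ?exprn_gt0// -exprMn ler_pXn2r ?nnegrE ?mulr_ge0// ltW.
  have h3 : eta * M = t by rewrite divfK// gt_eqF.
  set X := nm x ^+ 2 in h2 *; set A := nm (S x) ^+ 2 in h1 h2 *; set p := ip _ _ in h1 *.
  have h4 : eta * (A / M) <= eta * p by rewrite ler_pM2l.
  have h5 : eta * (A / M) = t * (A / M ^+ 2) by rewrite /eta; field; rewrite gt_eqF.
  have h6 : eta * (eta * A) = t ^+ 2 * (A / M ^+ 2) by rewrite /eta; field; rewrite
    gt_eqF.
  have h7 : k * X <= A / M ^+ 2 by rewrite ler_pdivlMr ?exprn_gt0// mulrAC.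
  set B := A / M ^+ 2 in h5 h6 h7.
  have t1 : 0 <= 2 * t - t ^+ 2 by rewrite /t; nra.
  have : (2 * t - t ^+ 2) * (k * X) <= (2 * t - t ^+ 2) * B by rewrite ler_wpM2l.
  rewrite /q2 h6; nra.
pose Phi := sylvester_map Z (eta * eta) S.
pose r := q2 + t ^+ 2.
have r01 : 0 <= r < 1.
  apply/andP; split; first by rewrite addr_ge0// sqr_ge0.
  by rewrite /r /q2 /t; nra.
have PhiB V W : Phi (V - W) = Phi V - Phi W by exact: sylvester_mapB.
have Phib V N : 0 <= N -> bounded_by V N -> bounded_by (Phi V) (r * N).
  move=> N0 VN; rewrite /Phi /sylvester_map /r [X in bounded_by _ X]mulrDl -qq; apply:
    bounded_byD.
    rewrite [X in bounded_by _ X](_ : _ = (q * N) * q); last by ring.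
    by apply: bounded_byM => //; [rewrite mulr_ge0|apply: bounded_byM].
  apply: bounded_byN.
  rewrite [X in bounded_by _ X](_ : _ = `|eta * eta| * ((M * N) * M)); last first.
    rewrite ger0_norm; last by rewrite mulr_ge0// ltW.
    have {1}<- : eta * M = t by rewrite divfK// gt_eqF.
    by rewrite exprMn; ring.
  apply: bounded_byZ; apply: bounded_byM => //; first by rewrite mulr_ge0// ltW.
  by apply: bounded_byM => //; rewrite ltW.
have YPhi : Y = eta :r*: (S * Y + Y * S) + Phi Y by exact: sylvester_mapE.
have [N N0 YN] := bop_bound Y.
apply: ideal_lim => // e e0.
have [m hm] := expr_small r01 N0 e0.
suff [K JK hK] : exists2 K, J K & bounded_by (Y - K) (r ^+ m * N).
  by exists K => //; exact: bounded_byW (ltW hm) hK.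
(* Fixed-point iteration from 0 with the known element eta (S Y + Y S) of J: the iterates stay in J
   and each step multiplies the error bound by r. *)
elim: m {hm} => [|m [K JK hK]]; first by exists 0; [exact: ideal0|rewrite subr0 expr0
  mul1r].
exists (eta :r*: (S * Y + Y * S) + Phi K).
  apply: idealD => //; first exact: idealZ.
  apply: idealB => //; first by apply: idealMr => //; exact: idealMl.
  by apply: idealZ => //; apply: idealMr => //; exact: idealMl.
rewrite {1}YPhi opprD addrACA subrr add0r -PhiB exprS -mulrA; apply: Phib => //.
by have /andP[r0 _] := r01; rewrite mulr_ge0 ?exprn_ge0// ltW.
Qed.

(** [eps] is 1 for commutators and -1 for anticommutators. With S = F D and K = D a - eps a D, the
    element Y = a - eps F a F satisfies S Y + Y S = F K - eps K F, and F Y is the element to be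
    placed in J. *)
Lemma sign_commutator J D F a (c eps : R) : closed_ideal J -> selfadj D ->
  (forall x, nm x <= c * nm (D x)) ->
  F * F = 1 -> selfadj F -> F * D = D * F -> nonneg (F * D) -> eps * eps = 1 ->
  J (D * a - eps :r*: (a * D)) -> J (F * a - eps :r*: (a * F)).
Proof.
move=> hJ Ds Dc FF Fs FD FD0 e1 hK.
pose Y := a - eps :r*: (F * a * F).
have Fn x : nm (F x) = nm x by rewrite /nm Fs -bopME FF.
suff JY : J Y.
  have -> : F * a - eps :r*: (a * F) = F * Y.
    by rewrite /Y mulrBr -scalebAr !mulrA FF mul1r.
  exact: idealMl.
apply: (@sylvester J (F * D) Y c) => //; first by apply: selfadjM.
  by move=> x; rewrite bopME Fn.
have -> : F * D * Y + Y * (F * D) = F * (D * a - eps :r*: (a * D))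
   - eps :r*: ((D * a - eps :r*: (a * D)) * F).
  rewrite /Y mulrBr [(a - _) * _]mulrBl [in RHS]mulrBr [(_ - _) * F]mulrBl.
  rewrite scalerBr -!scalebAl -!scalebAr rscaleA e1 rscale1.
  rewrite -(mulrA a D F) -FD.
  have -> : F * D * (F * a * F) = D * a * F by rewrite FD -!mulrA (mulrA F F) FF mul1r.
  have -> : F * a * F * (F * D) = F * (a * D) by rewrite -!mulrA (mulrA F F) FF mul1r.
  by rewrite !mulrA opprB [LHS](AC (2*2) ((1*4)*(3*2)))%AC.
by apply: idealB => //; [exact: idealMl|apply: idealZ => //; exact: idealMr].
Qed.

End ClosedIdeals.

(** * The Hodge operator of a complex *)

Section CompactCommutators.
Variable R : realType.

Definition comm_mod (H : hilbertType R) (J : bop H H -> Prop) (X a : bop H H) :=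
  J (X * a - a * X).

Section CommMod.
Variables (H : hilbertType R) (J : bop H H -> Prop).
Hypothesis hJ : closed_ideal J.
Implicit Types X Y a : bop H H.

Lemma comm_modD X Y a : comm_mod J X a -> comm_mod J Y a -> comm_mod J (X + Y) a.
Proof.
rewrite /comm_mod => hX hY; rewrite mulrDl mulrDr opprD addrACA.
exact: (idealD hJ).
Qed.

Lemma comm_modZ k X a : comm_mod J X a -> comm_mod J (k *: X) a.
Proof.
by rewrite /comm_mod => hX; rewrite -scalebAl -scalebAr -scalerBr; exact: idealZ.
Qed.

Lemma comm_modN X a : comm_mod J X a -> comm_mod J (- X) a.
Proof. by move=> hX; rewrite -scaleN1r; exact: comm_modZ. Qed.

Lemma comm_modB X Y a : comm_mod J X a -> comm_mod J Y a -> comm_mod J (X - Y) a.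
Proof. by move=> hX hY; apply: comm_modD => //; exact: comm_modN. Qed.

Lemma comm_mod1 a : comm_mod J 1 a.
Proof. by rewrite /comm_mod mul1r mulr1 subrr; exact: ideal0. Qed.

Lemma comm_modM X Y a : comm_mod J X a -> comm_mod J Y a -> comm_mod J (X * Y) a.
Proof.
rewrite /comm_mod => hX hY.
have -> : X * Y * a - a * (X * Y) = X * (Y * a - a * Y) + (X * a - a * X) * Y.
  by rewrite mulrBr mulrBl !mulrA addrA subrK.
by apply: (idealD hJ); [exact: (idealMl hJ)|exact: (idealMr hJ)].
Qed.

End CommMod.

Lemma comm_mod_adj (H : hilbertType R) (X a : bop H H) :
  comm_mod (@tb R H H) X (adj a) -> comm_mod (@tb R H H) (adj X) a.
Proof.
move=> /tb_adj; rewrite /comm_mod adjB !adjM adjK => h.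
by rewrite -opprB; exact: tbN.
Qed.

(** As 1 - Q kills ran T, (1 - Q) a T v = - (1 - Q) (T b - a T) v, which is compact in v. Lifting Q
    y to T v with |v| bounded transfers compactness to y. *)
Lemma range_proj_offdiag (H G : hilbertType R) (T : bop H G) (Q a : bop G G) (b : bop H
  H) :
  closed (range T) -> is_proj Q -> (forall y, range T (Q y)) ->
  (forall y, range T y -> Q y = y) ->
  tb (bcomp T b - bcomp a T) -> tb ((1 - Q) * a * Q).
Proof.
move=> Tcl hQ QT TQ hK; have [c c0 hc] := closed_range_lift Tcl.
have hK' : tb (bcomp (1 - Q) (- (bcomp T b - bcomp a T))) by apply: tb_compl; exact: tbN.
apply: (tb_lift c0 _ hK') => y y1; have [v Tv vc] := hc _ (QT y).
exists v; last by rewrite (le_trans vc)// -[leRHS]mulr1 ler_wpM2l ?(ltW c0)// (le_trans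
  (proj_nm _ hQ)).
rewrite 2!bopME -[LHS]/((1 - Q) (- (T (b v) - a (T v)))) Tv opprB 2!bopBE 2!bop1E.
by rewrite linearB /= (TQ (T (b v))) ?opprB ?addrA ?subrK//; exists (b v).
Qed.

(** [Q, a] = Q a (1 - Q) - (1 - Q) a Q, and the first term is the adjoint of (1 - Q) a^* Q; hence
    the second hypothesis, on the adjoints. *)
Lemma range_proj_comm (H G : hilbertType R) (T : bop H G) (Q a : bop G G) (b : bop H H) :
  closed (range T) -> is_proj Q -> (forall y, range T (Q y)) ->
  (forall y, range T y -> Q y = y) ->
  tb (bcomp T b - bcomp a T) -> tb (bcomp T (adj b) - bcomp (adj a) T) ->
  comm_mod (@tb R G G) Q a.
Proof.
move=> Tcl hQ QT TQ h1 h2.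
have k1 := range_proj_offdiag Tcl hQ QT TQ h1.
have /tb_adj k2 := range_proj_offdiag Tcl hQ QT TQ h2.
move: k2; rewrite !adjM adjB adjK adj1 (selfadj_adj hQ.2) => k2.
rewrite /comm_mod; have -> : Q * a - a * Q = Q * (a * (1 - Q)) - (1 - Q) * a * Q.
  by rewrite mulrBr mulr1 mulrBr mulrBl mul1r mulrBl !mulrA opprB addrA subrK.
exact: tbB.
Qed.

End CompactCommutators.

Section HodgeOperator.
Variables (R : realType) (H : hilbertType R).
(** [A] plays the total differential, [Pi] the projection onto the harmonic space, the intersection
    of ker A and ker A^*, and [sig] its signed version. *)
Variables (A Pi sig D : bop H H).
Hypotheses (Pip : is_proj Pi) (sigs : selfadj sig).
Hypotheses (sigsig : sig * sig = Pi) (Pisig : Pi * sig = sig).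
Hypotheses (AA : A * A = 0) (APi : A * Pi = 0) (PiA : Pi * A = 0).
Hypothesis Aexact : forall x, A x = 0 -> Pi x = 0 -> range A x.
Hypothesis Acl : closed (range A).
Hypothesis DE : D = A + adj A + sig.

Let sigPi : sig * Pi = sig.
Proof. by rewrite -[LHS]adjK adjM (selfadj_adj sigs) (selfadj_adj Pip.2) Pisig
  (selfadj_adj sigs). Qed.
Let AaPi : adj A * Pi = 0.
Proof. by rewrite -[Pi]adjK (selfadj_adj Pip.2) -adjM PiA adj0. Qed.
Let PiAa : Pi * adj A = 0.
Proof. by rewrite -[Pi]adjK (selfadj_adj Pip.2) -adjM APi adj0. Qed.
Let sigA : sig * A = 0. Proof. by rewrite -sigPi -mulrA PiA mulr0. Qed.

Let DPi : D * Pi = sig.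
Proof. by rewrite DE !mulrDl APi AaPi add0r add0r sigPi. Qed.
Let PiD : Pi * D = sig.
Proof. by rewrite DE !mulrDr PiA PiAa add0r add0r Pisig. Qed.

Lemma hodge_selfadj : selfadj D.
Proof.
apply/selfadjP; rewrite DE !adjD adjK (selfadj_adj sigs).
by rewrite [adj A + A]addrC.
Qed.

(* The three summands of [D x = A v + A^* (Q x) + sig x], where [Q] projects onto
   [ran A] and [v = x - Q x - Pi x] is orthogonal to [ker A], are mutually
   orthogonal. *)
Lemma hodge_lower_bound : exists c : R, forall x, nm x <= c * nm (D x).
Proof.
have [c c0 hc] := closed_range_lower_bound Acl.
have [c' c'0 hc'] := adj_lower_bound Acl.
have [Q [Qp QA AQ]] := proj_exists (range_subspace Acl).
exists (c + c' + 1) => x.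
have PiQ : Pi * Q = 0.
  by apply: bopP => y; have [z _ e] := QA y; rewrite bopME -e -bopME PiA.
have QPi : Q * Pi = 0.
  by rewrite -[LHS]adjK adjM (selfadj_adj Qp.2) (selfadj_adj Pip.2) PiQ adj0.
have AQ0 : A * Q = 0.
  by apply: bopP => y; have [z _ e] := QA y; rewrite bopME -e -bopME AA.
pose v := x - Q x - Pi x.
have xE : x = v + Q x + Pi x by rewrite /v addrAC subrK subrK.
(* By exactness z - Pi z is in ran A, hence equals Q z; in the pairing with v = x - Q x - Pi x
   everything then cancels. *)
have hv z : A z = 0 -> ip z v = 0.
  move=> Az; have h : Q (z - Pi z) = z - Pi z.
    apply: AQ; apply: Aexact; rewrite linearB /=.
    - by rewrite Az -bopME APi bop0E subr0.
    - by rewrite -bopME Pip.1 subrr.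
  have {}h : Q z = z - Pi z by rewrite -h linearB /= -(bopME Q) QPi bop0E subr0.
  by rewrite /v !ipBr -Qp.2 -Pip.2 h -!ipBl opprB addrCA subrr addr0 subrr ip0l.
have Av : A x = A v.
  by rewrite /v !linearB /= -!bopME AQ0 APi !bop0E !subr0.
have Aax : adj A x = adj A (Q x).
  have h : adj A v = 0.
    by apply: ip_inj => z; rewrite -adjP ip0r hv// -bopME AA.
  by rewrite {1}xE linearD linearD /= h -(bopME (adj A) Pi) AaPi bop0E add0r addr0.
have Dx : D x = A v + adj A (Q x) + sig x by rewrite DE !bopDE Av Aax.
have o1 : ip (A v + adj A (Q x)) (sig x) = 0.
  rewrite ipDl -!sigs -!bopME sigA ip0l add0r -sigPi -(mulrA sig) PiAa mulr0.
  by rewrite bop0E ip0l.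
have o2 : ip (A v) (adj A (Q x)) = 0 by rewrite -adjP -bopME AA ip0l.
have := pythagoras o1; rewrite -Dx (pythagoras o2).
have -> : nm (sig x) ^+ 2 = nm (Pi x) ^+ 2.
  by rewrite nm2 -sigs -bopME sigsig proj_ip.
have le_nm (y : H) (q : R) : 0 <= q -> nm (D x) ^+ 2 = nm y ^+ 2 + q -> nm y <= nm (D x).
  by move=> q0 h; rewrite -(@ler_pXn2r _ 2) ?nnegrE// h lerDl.
move=> e; have sq (y : H) : 0 <= nm y ^+ 2 by exact: sqr_ge0.
have h1 : nm (A v) <= nm (D x).
  by apply: (le_nm _ (nm (adj A (Q x)) ^+ 2 + nm (Pi x) ^+ 2)); rewrite ?addr_ge0// e;
    ring.
have h2 : nm (adj A (Q x)) <= nm (D x).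
  by apply: (le_nm _ (nm (A v) ^+ 2 + nm (Pi x) ^+ 2)); rewrite ?addr_ge0// e; ring.
have h3 : nm (Pi x) <= nm (D x).
  by apply: (le_nm _ (nm (A v) ^+ 2 + nm (adj A (Q x)) ^+ 2)); rewrite ?addr_ge0// e;
    ring.
have g1 : nm v <= c * nm (D x) by rewrite (le_trans (hc v hv))// ler_pM2l.
have g2 : nm (Q x) <= c' * nm (D x) by rewrite (le_trans (hc' _ (QA x)))// ler_pM2l.
rewrite {1}xE (le_trans (nmD _ _))// (mulrDl (c + c')) mul1r lerD//.
by rewrite (le_trans (nmD _ _))// mulrDl lerD.
Qed.

Section Sign.
Variable F : bop H H.
Hypotheses (FF : F * F = 1) (Fs : selfadj F) (FD : F * D = D * F) (FD0 : nonneg (F * D)).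

Lemma hodge_sign_commutator (J : bop H H -> Prop) (a : bop H H) (eps : R) :
  closed_ideal J -> eps * eps = 1 ->
  J (D * a - eps :r*: (a * D)) -> J (F * a - eps :r*: (a * F)).
Proof.
have [c hc] := hodge_lower_bound; move=> hJ e1.
exact: (sign_commutator hJ hodge_selfadj hc FF Fs FD FD0 e1).
Qed.

(** D Pi and Pi D both equal [sig], so the zero ideal yields exact commutation. *)
Let FPi : F * Pi = Pi * F.
Proof.
have := @hodge_sign_commutator _ Pi 1 (@zero_ideal R H) (mulr1 1).
by rewrite !rscale1 DPi PiD subrr => /(_ erefl) /eqP; rewrite subr_eq0 => /eqP.
Qed.

(** S = F D squares to 1 on ran Pi, so every vector S Pi x - Pi x is sent to its opposite by S;
    nonnegativity of S makes it 0, that is F sig = Pi. *)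
Lemma sign_Pi : F * Pi = sig.
Proof.
have SPi : F * sig = Pi.
  pose S := F * D; have SPiE : S * Pi = F * sig by rewrite /S -mulrA DPi.
  have SS : S * S = D * D.
    by rewrite /S -mulrA (mulrA D) -FD -(mulrA F) mulrA FF mul1r.
  have SSPi : S * (S * Pi) = Pi.
    by rewrite mulrA SS -mulrA DPi -Pisig mulrA DPi sigsig.
  rewrite -SPiE; apply/eqP; rewrite -subr_eq0; apply/eqP.
  apply: bopP => x; set y := (S * Pi - Pi) x.
  have Sy : S y = - y.
    by rewrite /y -bopME mulrBr SSPi -bopNE opprB.
  have := FD0 y; rewrite -/S Sy ipNl => h.
  by apply: ipxx_eq0; apply/eqP; rewrite eq_le ip_ge0 andbT -oppr_ge0.
by rewrite -SPi mulrA FF mul1r.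
Qed.

Variables (g C : bop H H).
Hypotheses (gs : selfadj g) (gg : g * g = 1) (gA : g * A = - (A * g)) (gPi : g * Pi =
  Pi * g).
Hypothesis CE : C = 1 - Pi.

Let gAa : g * adj A = - (adj A * g).
Proof.
have := congr1 (@adj _ _ _) gA; rewrite adjN !adjM (selfadj_adj gs) => ->.
by rewrite opprK.
Qed.

Let CC : C * C = C. Proof. by rewrite CE mulrBl mul1r mulrBr mulr1 Pip.1 subrr subr0. Qed.
Let Cs : selfadj C. Proof. by rewrite CE; apply: selfadjB => //; exact: Pip.2. Qed.
Let gC : g * C = C * g. Proof. by rewrite CE mulrBl mul1r mulrBr mulr1 gPi. Qed.
Let FC : F * C = C * F. Proof. by rewrite CE mulrBl mul1r mulrBr mulr1 FPi. Qed.
Let CPi : C * Pi = 0. Proof. by rewrite CE mulrBl mul1r Pip.1 subrr. Qed.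
Let Csig : C * sig = 0. Proof. by rewrite -Pisig mulrA CPi mul0r. Qed.
Let sigC : sig * C = 0.
Proof. by rewrite -sigPi -mulrA CE mulrBr mulr1 Pip.1 subrr mulr0. Qed.
Let DC : D * C = A + adj A. Proof. by rewrite CE mulrBr mulr1 DPi DE addrK. Qed.
Let CD : C * D = A + adj A. Proof. by rewrite CE mulrBl mul1r PiD DE addrK. Qed.

(** The factor C strips [sig] from D and leaves A + A^*, with which g anticommutes; the zero ideal
    with eps = -1 transfers this to F. *)
Let Fg : F * (g * C) = - (g * C * F).
Proof.
have e1 : (-1 : R) * -1 = 1 by ring.
have := hodge_sign_commutator (a := g * C) (@zero_ideal R H) e1.
rewrite !rscaleNl !rscale1 !opprK.
have -> : D * (g * C) + g * C * D = 0.
  by rewrite {1}gC mulrA DC -mulrA CD mulrDl mulrDr gA gAa -opprD subrr.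
by move=> /(_ erefl) /eqP; rewrite addr_eq0 => /eqP.
Qed.

Definition rotation (c u : R) := c :r*: (F * C) + u :r*: (g * C) + sig.

Lemma rotation_selfadj c u : selfadj (rotation c u).
Proof.
by apply: selfadjD => //; apply: selfadjD; apply: selfadjZ; exact: selfadjM.
Qed.

Lemma rotation_sq c u : c ^+ 2 + u ^+ 2 = 1 -> rotation c u * rotation c u = 1.
Proof.
move=> cu; rewrite /rotation.
have XY : F * C * (g * C) + g * C * (F * C) = 0.
  have -> : F * C * (g * C) = F * (g * C) by rewrite gC -mulrA (mulrA C) CC.
  have -> : g * C * (F * C) = g * C * F by rewrite FC -mulrA (mulrA C C) CC mulrA.
  by rewrite Fg addNr.
have XX : F * C * (F * C) = C by rewrite {1}FC -mulrA (mulrA F) FF mul1r CC.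
have YY : g * C * (g * C) = C by rewrite {1}gC -mulrA (mulrA g) gg mul1r CC.
have sX : sig * (F * C) = 0 by rewrite FC mulrA sigC mul0r.
have sY : sig * (g * C) = 0 by rewrite gC mulrA sigC mul0r.
have Xs : F * C * sig = 0 by rewrite -mulrA Csig mulr0.
have Ys : g * C * sig = 0 by rewrite -mulrA Csig mulr0.
move: (F * C) (g * C) XY XX YY sX sY Xs Ys => X Y XY XX YY sX sY Xs Ys.
set W := c :r*: X + u :r*: Y.
have Ws : W * sig = 0 by rewrite mulrDl -!scalebAl Xs Ys !scaler0 addr0.
have sW : sig * W = 0 by rewrite mulrDr -!scalebAr sX sY !scaler0 addr0.
have WW : W * W = C.
  rewrite mulrDl !mulrDr -!scalebAl -!scalebAr !rscaleA.
  rewrite [LHS](AC (2*2) ((1*4)*(2*3)))%AC /= XX YY -rscaleDl -!expr2 cu rscale1.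
  by rewrite [u * c]mulrC -scalerDr XY scaler0 addr0.
move: W Ws sW WW => W Ws sW WW.
by rewrite mulrDl !mulrDr WW Ws sW sigsig addr0 add0r CE subrK.
Qed.

Lemma rotation0 : rotation 1 0 = F.
Proof. by rewrite /rotation rscale1 rscale0 addr0 CE mulrBr mulr1 sign_Pi subrK. Qed.

Lemma rotation1 : rotation 0 1 = g * C + sig.
Proof. by rewrite /rotation rscale1 rscale0 add0r. Qed.

Lemma rotation_comm (a : bop H H) (c u : R) : let J := @tb R H H in
  comm_mod J A a -> comm_mod J (adj A) a -> comm_mod J Pi a -> comm_mod J sig a ->
  comm_mod J g a -> comm_mod J (rotation c u) a.
Proof.
move=> J hA hAa hPi hsig hg; have hJ := @compact_ideal R H.
have hC : comm_mod J C a.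
  by rewrite CE; apply: (comm_modB hJ) => //; exact: (comm_mod1 hJ).
have hD : comm_mod J D a.
  by rewrite DE; apply: (comm_modD hJ) => //; exact: (comm_modD hJ).
have hF : comm_mod J F a.
  have := hodge_sign_commutator (a := a) hJ (mulr1 1).
  by rewrite !rscale1; apply.
apply: (comm_modD hJ) => //; apply: (comm_modD hJ) => //; apply: (comm_modZ hJ);
  exact: (comm_modM hJ).
Qed.

End Sign.
End HodgeOperator.

(** * Operators on finite Hilbert sums *)

Section HilbertSumOperators.
Variables (R : realType) (I : finType) (Hs : I -> hilbertType R).
Local Notation V := (hsum Hs).

Lemma hsum_ip (x y : V) : ip x y = \sum_i ip (x i) (y i).
Proof. by rewrite /ip -[inner x y]/(hsum_inner x y) /hsum_inner raddf_sum. Qed.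

Lemma hsum_bounded (G : hilbertType R) (f : G -> V) :
  (forall i, bounded_op (fun x => f x i)) -> bounded_op f.
Proof.
move=> fb; split.
  by move=> k x y; apply: functional_extensionality_dep => i; exact: (fb i).1.
have /choice[M MP] : forall i, exists M : R[i], 0 <= M /\ forall x, `|f x i| <= M * `|x|.
  by move=> i; have [M M0 fM] := bounded_op_ge0 (fb i); exists M.
exists (\sum_i M i) => x; rewrite (le_trans (hsum_norm_le _))// mulr_suml.
by apply: ler_sum => i _; exact: (MP i).2.
Qed.

Lemma hsum_pr_bounded i : exists M : R, forall x : V, nm (x i) <= M * nm x.
Proof. by exists 1 => x; rewrite mul1r -lecR -!nmE; exact: hsum_norm_ge. Qed.

Lemma hsum_pr_linear i : linear (fun x : V => x i).
Proof. by []. Qed.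

Definition hpr i : bop V (Hs i) := Bop (@hsum_pr_linear i) (hsum_pr_bounded i).

(** Built with [dfwith], as [on_component] is, so that [on_componentE] holds by conversion. *)
Definition hinj_fun i (y : Hs i) : V := @dfwith I Hs (fun k => 0) i y.

Lemma hinj_funE i (y : Hs i) : hinj_fun y i = y.
Proof. exact: dfwithin. Qed.

Lemma hinj_fun_neq i j (y : Hs i) : i != j -> hinj_fun y j = 0.
Proof. by move=> ij; exact: dfwithout. Qed.

Lemma hinj_linear i : linear (@hinj_fun i).
Proof.
move=> k x y; apply: functional_extensionality_dep => j.
rewrite -[RHS]/(k *: hinj_fun x j + hinj_fun y j).
have [<-|ij] := eqVneq i j; first by rewrite !hinj_funE.
by rewrite !hinj_fun_neq// scaler0 addr0.
Qed.

Lemma hinj_ip i (x : V) (y : Hs i) : ip x (hinj_fun y) = ip (x i) y.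
Proof.
rewrite hsum_ip (bigD1 i)//= hinj_funE big1 ?addr0// => j ji.
by rewrite hinj_fun_neq ?ip0r// eq_sym.
Qed.

Lemma hinj_bounded i : exists M : R, forall x : Hs i, nm (hinj_fun x) <= M * nm x.
Proof. by exists 1 => x; rewrite mul1r /nm hinj_ip hinj_funE. Qed.

Definition hinj i : bop (Hs i) V := Bop (@hinj_linear i) (hinj_bounded i).

Lemma hinjE i (y : Hs i) : hinj i y i = y. Proof. exact: hinj_funE. Qed.
Lemma hinj_neq i j (y : Hs i) : i != j -> hinj i y j = 0.
Proof. exact: hinj_fun_neq. Qed.

Lemma ip_hinj i (x : V) (y : Hs i) : ip x (hinj i y) = ip (x i) y.
Proof. exact: hinj_ip. Qed.

Lemma hsum_decomp (x : V) : x = \sum_i hinj i (x i).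
Proof.
apply: ip_inj => z; rewrite [RHS]ipC ip_suml hsum_ip; apply: eq_bigr => i _.
by rewrite [RHS]ipC ip_hinj.
Qed.

Lemma hsum_tb (G : hilbertType R) (K : bop G V) :
  (forall i, tb (bcomp (hpr i) K)) -> tb K.
Proof.
move=> hK; have -> : K = \sum_i bcomp (hinj i) (bcomp (hpr i) K).
  by apply: bopP => x; rewrite bop_sumE [LHS]hsum_decomp.
by apply: tb_sum => i _; exact: tb_compl.
Qed.

Definition hcomponent i (T : bop (Hs i) (Hs i)) : bop V V :=
  bcomp (hinj i) (bcomp T (hpr i)).

Lemma on_componentE i (T : bop (Hs i) (Hs i)) : on_component T = hcomponent T.
Proof. by []. Qed.

Lemma hcomponent_proj i (Q : bop (Hs i) (Hs i)) : is_proj Q -> is_proj (hcomponent Q).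
Proof.
move=> [QQ Qs]; split=> [|x y].
  apply: bopP => x; rewrite bopME /hcomponent /= hinj_funE.
  by rewrite -[Q (Q _)]bopME QQ.
by rewrite [RHS]ip_hinj [LHS]ipC [LHS]ip_hinj /= [LHS]ipC Qs.
Qed.

Lemma hdiag_bounded (c : I -> R) :
  exists M : R, forall x : V, nm ((fun i => c i :r*: x i) : V) <= M * nm x.
Proof.
have hb : bounded_op (fun x : V => (fun i => c i :r*: x i) : V).
  by apply: hsum_bounded => i; exact: bop_bounded_op (c i :r*: hpr i).
have [T e] := bounded_op_bop hb; have [M TM] := bop_bounded T.
by exists M => x; have := TM x; rewrite -e.
Qed.

Lemma hdiag_linear (c : I -> R) : linear (fun x : V => (fun i => c i :r*: x i) : V).
Proof.
move=> k x y; apply: functional_extensionality_dep => i.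
by rewrite -[RHS]/(k *: (c i :r*: x i) + c i :r*: y i) scalerDr !scalerA [k * _]mulrC.
Qed.

Definition hdiag (c : I -> R) : bop V V := Bop (@hdiag_linear c) (hdiag_bounded c).

Lemma hdiagE c x i : hdiag c x i = c i :r*: x i. Proof. by []. Qed.

Lemma hdiag_selfadj c : selfadj (hdiag c).
Proof.
move=> x y; rewrite !hsum_ip; apply: eq_bigr => i _.
by rewrite !hdiagE ipZl ipZr.
Qed.

Lemma hdiag_sq c : (forall i, c i * c i = 1) -> hdiag c * hdiag c = 1.
Proof.
move=> cc; apply: bopP => x; apply: functional_extensionality_dep => i.
by rewrite bopME !hdiagE rscaleA cc rscale1.
Qed.

Lemma hdiag_component c i (T : bop (Hs i) (Hs i)) :
  hdiag c * hcomponent T = c i :r*: hcomponent T.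
Proof.
apply: bopP => x; rewrite bopME bopZE; apply: functional_extensionality_dep => j.
rewrite hdiagE -[RHS]/(c i :r*: hcomponent T x j) /hcomponent /=.
have [<-//|ij] := eqVneq i j.
by rewrite hinj_fun_neq// !scaler0.
Qed.

End HilbertSumOperators.

(** * Module actions and commutators modulo compact operators *)

Section ModuleOperators.
Variables (R : realType) (A : cstarAlgType R).
Implicit Types M N : hilbertModule A.

Definition actb M (a : A) : bop M M := projT1 (cid (bounded_op_bop (act_bounded M a))).

Lemma actbE M (a : A) : act a = actb M a :> (M -> M).
Proof. exact: (projT2 (cid (bounded_op_bop (act_bounded M a)))). Qed.

Lemma adj_actb M (a : A) : adj (actb M a) = actb M (astar a).
Proof. by apply: adj_unique; apply/inner_adj => x y; rewrite -!actbE act_star. Qed.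

(** Quantifying over the whole algebra makes the condition available at [astar a], which is how
    adjoints are handled. *)
Definition tb_comm M N (T : bop M N) :=
  forall a, tb (bcomp T (actb M a) - bcomp (actb N a) T).

Lemma tb_commP M N (T : bop M N) : tb_comm T <->
  forall a : A, compact_op (fun x => T (act a x) - act a (T x)).
Proof.
have e a : (fun x => T (act a x) - act a (T x)) = bcomp T (actb M a) - bcomp (actb N a) T.
  by apply/funext => x; rewrite !actbE.
split=> h a; first by rewrite e; apply: tb_compact_op.
by apply: compact_op_tb; rewrite -e.
Qed.

Lemma admissible_bop M N (T : M -> N) : admissible T ->
  exists2 T' : bop M N, T = T' & closed (range T') /\ tb_comm T'.
Proof.
move=> [Tb Tcl Tc]; have [T' e] := bounded_op_bop Tb; exists T' => //.
by rewrite e in Tcl Tc; split => //; apply/tb_commP.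
Qed.

Lemma proj_closed_range (H : hilbertType R) (E : bop H H) : is_proj E -> closed (range E).
Proof.
move=> [EE _]; apply: tends_closed => u l Eu ul; exists l => //.
apply: (tends_unique (bop_tends E ul)) => e e0.
have [N hN] := ul e e0; exists N => n /hN /=; have [x _ <-] := Eu n.
by rewrite -bopME EE.
Qed.

Lemma reflection_sq (H : hilbertType R) (E : bop H H) : is_proj E ->
  (2 :r*: E - 1) * (2 :r*: E - 1) = 1.
Proof.
move=> [EE _]; rewrite mulrBl mul1r mulrBr mulr1 -scalebAl -scalebAr EE.
by rewrite (rscale2 (2 :r*: E)) addrK subKr.
Qed.

Lemma proj_admissible M (E : bop M M) : is_proj E -> tb_comm E -> admissible_projection E.
Proof.
move=> Ep Ec; split; first exact: bop_orthogonal_projection.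
split; [exact: bop_bounded_op|exact: proj_closed_range|exact/tb_commP].
Qed.

Lemma involution_fredholm M (F : bop M M) :
  F * F = 1 -> selfadj F -> tb_comm F -> is_fredholm (KCycle F).
Proof.
move=> FF Fs Fc; split; first exact: bop_bounded_op.
move=> a; split => /=.
- apply: eq_compact_op (compact_op0 M M) => v.
  by rewrite -(bopME F F) FF bop1E subrr.
- apply: eq_compact_op (compact_op0 M M) => v.
  by rewrite adjointE (selfadj_adj Fs) subrr.
- by move/tb_commP : Fc => /(_ a).
Qed.

End ModuleOperators.

(** * Admissible resolutions *)

Section CokernelProjection.
Variable R : realType.

(** Equal ranges give F E = E and E F = F; the adjoint of the first relation is E F = E. *)
Lemma proj_range_inj (H : hilbertType R) (E F : bop H H) : is_proj E -> is_proj F ->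
  range E = range F -> E = F.
Proof.
move=> Ep Fp EF.
have h (X Y : bop H H) : is_proj X -> is_proj Y -> range X = range Y -> Y * X = X.
  move=> [XX _] [YY _] XY; apply: bopP => x; rewrite bopME.
  have : range Y (X x) by rewrite -XY; exists x.
  by move=> [y _ <-]; rewrite -bopME YY.
have h1 := h _ _ Ep Fp EF; have h2 := h _ _ Fp Ep (esym EF).
have := congr1 (@adj _ _ _) h1.
by rewrite adjM (selfadj_adj Ep.2) (selfadj_adj Fp.2) h2.
Qed.

Lemma projection_onto_orthocomplement (H : hilbertType R) (Q : bop H H) :
  is_proj Q -> projection_onto (orthocomplement (range Q)) = 1 - Q.
Proof.
move=> Qp; have Cp := is_projC Qp.
have rC : range (1 - Q) = orthocomplement (range Q).
  apply/seteqP; split=> [_ [x _ <-] _ [y _ <-]|x hx].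
    have Q0 : Q * (1 - Q) = 0 by rewrite mulrBr mulr1 Qp.1 subrr.
    have Qi := (inner_adj Q Q).1 (Qp.2).
    have -> : inner ((1 - Q) x) (Q y) = inner (Q ((1 - Q) x)) y by rewrite Qi.
    by rewrite -bopME Q0 bop0E linear0l.
  exists x => //; rewrite bopBE bop1E; suff -> : Q x = 0 by rewrite subr0.
  apply: ipxx_eq0; rewrite Qp.2 -bopME Qp.1; apply: inner_eq0_ip; apply: hx.
  by exists x.
rewrite /projection_onto; case: xgetP => [E _ [Eo rE]|/(_ (1 - Q))]; last first.
  by case; split; [exact: bop_orthogonal_projection|].
have [E' E'p EE'] := orthogonal_projection_bop Eo.
rewrite EE'; congr bfun; apply: proj_range_inj => //.
by rewrite -EE' rE rC.
Qed.

End CokernelProjection.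

Section Resolution.
Variables (R : realType) (A : cstarAlgType R) (n : nat).
Variables (H : nat -> hilbertModule A) (P : H 0%N -> H 0%N) (d : forall j, H j -> H j.+1).
Hypotheses (hP : admissible_projection P) (hd : admissible_resolution P d n).

Local Notation I := 'I_n.+1.
Local Notation Hs := (fun k : I => hmod_space (H k)).
Local Notation V := (total_module H n).
Local Notation W := (hmod_space (total_module H n)).
Local Notation inc k := (@incoming_range R A H P d k).
Local Notation td := (@total_differential R A H d n).

Lemma act_component (a : A) (x : V) (k : I) : (act a x : hsum Hs) k = act a ((x : hsum
  Hs) k).
Proof. by []. Qed.

(** In degree 0 the operator is [P] itself. This also covers length 0, where the cokernel projection
    is 1 - P. *)
Lemma incoming_admissible k : (k <= n)%N ->
  exists (M : hilbertModule A) (T : M -> H k), admissible T /\ inc k = range T.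
Proof.
case: k => [|j] jn; first by exists (H 0%N), P; split => //; case: hP.
by exists (H j), (@d j); split => //; apply: hd.1.
Qed.

Lemma incoming_projection k : (k <= n)%N ->
  exists Q : bop (H k) (H k), [/\ is_proj Q, range Q = inc k & tb_comm Q].
Proof.
move=> /incoming_admissible[M [T0 [/admissible_bop[T -> [Tcl Tc]] ->]]].
have [Q [Qp QT TQ]] := proj_exists (range_subspace Tcl).
exists Q; split => //.
  by apply/seteqP; split=> [_ [x _ <-]//|y Ty]; exists y => //; exact: TQ.
move=> a; apply: (range_proj_comm Tcl Qp QT TQ (Tc a)).
by rewrite !adj_actb; exact: Tc.
Qed.

Lemma incoming0 k : (k <= n)%N -> inc k 0.
Proof.
move=> /incoming_projection[Q [_ <- _]].
by exists 0 => //; rewrite linear0.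
Qed.

Lemma d_bounded j : (j < n)%N -> bounded_op (@d j).
Proof. by move=> /hd.1 []. Qed.

Lemma d_incoming k y : (k < n)%N -> inc k y -> d y = 0.
Proof. by move=> kn; rewrite -(hd.2 k kn). Qed.

Lemma total_differentialS j (lt : (j.+1 < n.+1)%N) (x : V) :
  (td x : hsum Hs) (Ordinal lt) = d ((x : hsum Hs) (Ordinal (ltnW lt))).
Proof. by []. Qed.

Lemma total_differential_incoming (x : V) (k : I) : inc k ((td x : hsum Hs) k).
Proof.
case: k => [[|j] lt]; last by exists ((x : hsum Hs) (Ordinal (ltnW lt))).
exact: incoming0.
Qed.

Lemma total_differential_bounded : bounded_op td.
Proof.
apply: hsum_bounded => -[[|j] lt] /=; first exact: bop_bounded_op (0 : bop W (H 0%N)).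
have [D e] := bounded_op_bop (d_bounded lt).
rewrite e; exact: bop_bounded_op (bcomp D (hpr Hs (Ordinal (ltnW lt)))).
Qed.

Definition total_d : bop W W := projT1 (cid (bounded_op_bop total_differential_bounded)).

Lemma total_dE : td = total_d.
Proof. exact: (projT2 (cid (bounded_op_bop total_differential_bounded))). Qed.

(** Preimages are chosen degree by degree, 0 in degree n. Degree 0 has its own hypothesis because
    [incoming_range] is there [range P], while the total differential has no component in degree
    0. *)
Lemma total_d_range (x : W) : (x : hsum Hs) ord0 = 0 ->
  (forall k : I, inc k ((x : hsum Hs) k)) -> range total_d x.
Proof.
move=> x0 hx.
have h (k : I) : exists y : H k,
    forall lt : (k.+1 < n.+1)%N, d y = (x : hsum Hs) (Ordinal lt).
  have [lt|ge] := pselect (is_true (k.+1 < n.+1)%N); last by exists 0 => lt; case: (ge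
    lt).
  have [y _ hy] := hx (Ordinal lt); exists y => lt'.
  by rewrite hy (bool_irrelevance lt lt').
exists ((fun k => projT1 (cid (h k))) : hsum Hs) => //.
rewrite -total_dE; apply: functional_extensionality_dep => -[[|j] lt].
  by rewrite -[RHS]/((x : hsum Hs) (Ordinal lt)) (bool_irrelevance lt (ltn0Sn n))
    -[Ordinal _]/ord0 x0.
by rewrite total_differentialS; exact: (projT2 (cid (h (Ordinal (ltnW lt))))).
Qed.

(** The range is cut out by x_0 = 0 and by membership of each component in a closed incoming range;
    both conditions pass to limits. *)
Lemma total_d_closed : closed (range total_d).
Proof.
apply: tends_closed => u l hu ul.
have uk (k : I) : tends (fun m => (u m : hsum Hs) k) ((l : hsum Hs) k).
  exact: (bop_tends (hpr Hs k) ul).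
apply: total_d_range => [|k].
  apply: (tends_unique (uk ord0)) => e e0; exists 0%N => m _.
  by have [y _ <-] := hu m; rewrite -total_dE subrr nm0.
have [M [T [[_ Tcl _] hT]]] := incoming_admissible (ltn_ord k : (k <= n)%N).
rewrite hT in Tcl *; apply: (closed_tends _ _ (uk k)) => // m.
by have [y _ <-] := hu m; rewrite -hT -total_dE; exact: total_differential_incoming.
Qed.

Lemma total_d_sq : total_d * total_d = 0.
Proof.
apply: bopP => x; rewrite bopME -!total_dE.
apply: functional_extensionality_dep => -[[|j] lt] //.
rewrite total_differentialS (@d_incoming j)//.
exact: (total_differential_incoming x (Ordinal (ltnW lt))).
Qed.

Lemma head_projection : exists Q : bop (H 0%N) (H 0%N),
  [/\ is_proj Q, P = Q & tb_comm Q].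
Proof.
have [Po [_ _ Pc]] := hP; have [Q Qp PQ] := orthogonal_projection_bop Po.
by exists Q; split => //; apply/tb_commP; rewrite -PQ.
Qed.

Definition Pb : bop (H 0%N) (H 0%N) := projT1 (cid head_projection).
Definition Qb : bop (H n) (H n) := projT1 (cid (incoming_projection (leqnn n))).

Lemma PbP : [/\ is_proj Pb, P = Pb & tb_comm Pb].
Proof. exact: (projT2 (cid head_projection)). Qed.
Lemma QbP : [/\ is_proj Qb, range Qb = inc n & tb_comm Qb].
Proof. exact: (projT2 (cid (incoming_projection (leqnn n)))). Qed.

Definition Cb : bop (H n) (H n) := 1 - Qb.

Lemma cokernel_projectionE : @cokernel_projection R A H P d n = Cb.
Proof.
have [Qp e _] := QbP; rewrite /cokernel_projection -e.
exact: projection_onto_orthocomplement.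
Qed.

Lemma Cb_proj : is_proj Cb. Proof. by have [Qp _ _] := QbP; exact: is_projC. Qed.

Lemma Cb_incoming y : inc n y -> Cb y = 0.
Proof.
have [Qp <- _] := QbP => -[x _ <-].
by rewrite /Cb bopBE bop1E -(bopME Qb) Qp.1 subrr.
Qed.

Lemma Cb_eq0 y : Cb y = 0 -> inc n y.
Proof.
have [Qp <- _] := QbP; rewrite /Cb bopBE bop1E => /eqP.
by rewrite subr_eq0 => /eqP ->; exists y.
Qed.

Definition total_P : bop W W := hcomponent (Hs := Hs) (i := ord0) Pb.
Definition total_C : bop W W := hcomponent (Hs := Hs) (i := ord_max) Cb.
Definition sgn (k : nat) : R := (-1) ^+ k.+1.
Definition grading : bop W W := hdiag Hs (fun k : I => sgn k).
Local Notation s := (sgn n).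
Definition total_Pi := total_P + total_C.
Definition total_sig := total_P + s :r*: total_C.

Lemma sgn_sq k : sgn k * sgn k = 1.
Proof. by rewrite /sgn -expr2 sqrr_sign. Qed.

Lemma total_P_proj : is_proj total_P.
Proof. by have [Pp _ _] := PbP; exact: (hcomponent_proj (Hs := Hs)). Qed.
Lemma total_C_proj : is_proj total_C.
Proof. exact: (@hcomponent_proj R _ Hs ord_max Cb Cb_proj). Qed.

Lemma total_PC : total_P * total_C = 0.
Proof.
(* Stated for an arbitrary degree because [ord_max] and [ord0] coincide when n = 0. In degree 0 the
   vector is orthogonal to ran P; otherwise its degree 0 component is 0. *)
have h (k : I) (y : H k) : (forall z, inc k z -> ip y z = 0) ->
    Pb ((hinj Hs k y : hsum Hs) ord0) = 0.
  have [k0|k0] := eqVneq k ord0; last by move=> _; rewrite hinj_neq// linear0.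
  rewrite k0 in y * => hy; rewrite hinjE; have [Pp PE _] := PbP.
  apply: ipxx_eq0; rewrite Pp.2 -bopME Pp.1; apply: hy => /=.
  by exists y => //; rewrite PE.
apply: bopP => x; rewrite bopME bop0E /total_P /hcomponent.
rewrite -[LHS]/(hinj Hs ord0 (Pb ((hinj Hs ord_max (Cb ((x : hsum Hs) ord_max)) : hsum
  Hs) ord0))).
rewrite (h ord_max) ?linear0// => z iz.
by rewrite (Cb_proj).2 (Cb_incoming iz) ip0r.
Qed.

Lemma total_P_head (x : W) :
  (total_P x : hsum Hs) ord0 = Pb ((x : hsum Hs) ord0).
Proof. exact: hinj_funE. Qed.

Lemma total_P_tail (x : W) (i : 'I_n) : (total_P x : hsum Hs) (lift ord0 i) = 0.
Proof. by rewrite -[LHS]/(hinj Hs ord0 _ (lift ord0 i)) hinj_neq// neq_lift. Qed.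

Lemma total_CP : total_C * total_P = 0.
Proof.
rewrite -[LHS]adjK adjM (selfadj_adj total_P_proj.2) (selfadj_adj total_C_proj.2).
by rewrite total_PC adj0.
Qed.

Lemma total_dP : total_d * total_P = 0.
Proof.
have h (k : I) (y : H 0%N) : (k < n)%N -> range P y ->
    d ((hinj Hs ord0 y : hsum Hs) k) = 0.
  move=> kn hy; have [k0|k0] := eqVneq k ord0.
    by rewrite k0 in kn *; rewrite hinjE; apply: d_incoming.
  rewrite hinj_neq 1?eq_sym//; have [D ->] := bounded_op_bop (d_bounded kn).
  exact: linear0.
apply: bopP => x; rewrite bopME -total_dE.
apply: functional_extensionality_dep => -[[|j] lt] //.
rewrite total_differentialS; apply: (h (Ordinal (ltnW lt))) => //.
by have [_ -> _] := PbP; exists ((x : hsum Hs) ord0).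
Qed.

Lemma total_Pd : total_P * total_d = 0.
Proof.
apply: bopP => x; rewrite bopME -total_dE.
rewrite -[LHS]/(hinj Hs ord0 (Pb ((td x : hsum Hs) ord0))).
by rewrite -[(td x : hsum Hs) ord0]/(0 : H 0%N) !linear0.
Qed.

Lemma total_dC : total_d * total_C = 0.
Proof.
apply: bopP => x; rewrite bopME -total_dE.
apply: functional_extensionality_dep => -[[|j] lt] //.
rewrite total_differentialS.
rewrite -[total_C x]/(hinj Hs ord_max (Cb ((x : hsum Hs) ord_max))) hinj_neq; last first.
  by rewrite -val_eqE /= gtn_eqF.
have [D ->] := bounded_op_bop (d_bounded (lt : (j < n)%N)); exact: linear0.
Qed.

Lemma total_Cd : total_C * total_d = 0.
Proof.
apply: bopP => x; rewrite bopME -total_dE.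
rewrite -[LHS]/(hinj Hs ord_max (Cb ((td x : hsum Hs) ord_max))).
by rewrite (Cb_incoming (total_differential_incoming x ord_max)) linear0.
Qed.

(** Exactness handles the degrees below n and [Cb] handles degree n. In degree 0 the component lies
    in ran P and is killed by P, so it is 0, as [total_d_range] requires. *)
Lemma total_exact (x : W) : total_d x = 0 -> total_Pi x = 0 -> range total_d x.
Proof.
move=> dx Px.
have P0 : Pb ((x : hsum Hs) ord0) = 0.
  have : total_P x = 0.
    have <- : total_P * total_Pi = total_P by rewrite mulrDr total_P_proj.1 total_PC
      addr0.
    by rewrite bopME Px linear0.
  move=> /(congr1 (fun z : W => (z : hsum Hs) ord0)).
  by rewrite -[LHS]/((hinj Hs ord0 (Pb ((x : hsum Hs) ord0)) : hsum Hs) ord0) hinjE.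
have C0 : Cb ((x : hsum Hs) ord_max) = 0.
  have : total_C x = 0.
    have <- : total_C * total_Pi = total_C by rewrite mulrDr total_C_proj.1 total_CP
      add0r.
    by rewrite bopME Px linear0.
  move=> /(congr1 (fun z : W => (z : hsum Hs) ord_max)).
  by rewrite -[LHS]/((hinj Hs ord_max (Cb ((x : hsum Hs) ord_max)) : hsum Hs) ord_max)
    hinjE.
have hx (k : I) : inc k ((x : hsum Hs) k).
  have [kn|nk] := ltnP k n.
    rewrite -(hd.2 k kn) /=.
    have lt : (k.+1 < n.+1)%N by [].
    have <- : Ordinal (ltnW lt) = k by exact: val_inj.
    by rewrite -total_differentialS total_dE dx.
  have -> : k = ord_max by apply/val_inj/eqP; rewrite eqn_leq nk -ltnS ltn_ord.
  exact: Cb_eq0.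
apply: total_d_range => //.
have [Pp PE _] := PbP; have := hx ord0; rewrite /= PE => -[y _ hy].
by rewrite -hy -Pp.1 bopME hy P0.
Qed.

Lemma total_Pi_proj : is_proj total_Pi.
Proof.
split; last by apply: selfadjD; [exact: total_P_proj.2|exact: total_C_proj.2].
rewrite /total_Pi mulrDl !mulrDr total_P_proj.1 total_C_proj.1 total_PC total_CP.
by rewrite addr0 add0r.
Qed.

Lemma total_sig_selfadj : selfadj total_sig.
Proof.
apply: selfadjD; first exact: total_P_proj.2.
by apply: selfadjZ; exact: total_C_proj.2.
Qed.

Lemma total_sig_sq : total_sig * total_sig = total_Pi.
Proof.
rewrite /total_sig mulrDl !mulrDr -!scalebAl -!scalebAr total_P_proj.1 total_C_proj.1.
by rewrite total_PC total_CP !scaler0 addr0 add0r rscaleA sgn_sq rscale1.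
Qed.

Lemma total_Pi_sig : total_Pi * total_sig = total_sig.
Proof.
rewrite mulrDl !mulrDr -!scalebAr total_P_proj.1 total_C_proj.1.
by rewrite total_PC total_CP !scaler0 addr0 add0r.
Qed.

Lemma total_dPi : total_d * total_Pi = 0.
Proof. by rewrite mulrDr total_dP total_dC addr0. Qed.
Lemma total_Pid : total_Pi * total_d = 0.
Proof. by rewrite mulrDl total_Pd total_Cd addr0. Qed.

Lemma grading_sq : grading * grading = 1.
Proof. by apply: hdiag_sq => k; exact: sgn_sq. Qed.

Lemma grading_selfadj : selfadj grading.
Proof. exact: hdiag_selfadj. Qed.

Lemma grading_d : grading * total_d = - (total_d * grading).
Proof.
apply: bopP => x; rewrite bopNE !bopME -total_dE.
apply: functional_extensionality_dep => k.
rewrite hdiagE -[RHS]/(- ((td (grading x) : hsum Hs) k)).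
case: k => [[|j] lt]; first by rewrite -[td x _]/(0 : H 0%N) scaler0 -[td _ _]/(0 : H
  0%N) oppr0.
rewrite !total_differentialS hdiagE.
have [D ->] := bounded_op_bop (d_bounded (lt : (j < n)%N)).
rewrite [D (_ *: _)]linearZ /= -rscaleNl.
by have -> : sgn j.+1 = - sgn j by rewrite /sgn [in LHS]exprS mulN1r.
Qed.

Lemma grading_P : grading * total_P = - total_P.
Proof. by rewrite hdiag_component /sgn expr1 rscaleNl rscale1. Qed.

Lemma grading_C : grading * total_C = s :r*: total_C.
Proof. by rewrite hdiag_component. Qed.

Lemma grading_Pi : grading * total_Pi = total_Pi * grading.
Proof.
have h : grading * total_Pi = - total_P + s :r*: total_C.
  by rewrite mulrDr grading_P grading_C.
rewrite h -[RHS]adjK adjM (selfadj_adj grading_selfadj) (selfadj_adj total_Pi_proj.2) h.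
by rewrite adjD adjN adjZ (selfadj_adj total_P_proj.2) (selfadj_adj total_C_proj.2).
Qed.

(** The grading times Pi is - P + s C; replacing it by P + s C adds 2 P. *)
Lemma rotation_end : grading * (1 - total_Pi) + total_sig = grading + 2 :r*: total_P.
Proof.
rewrite mulrBr mulr1 mulrDr grading_P grading_C /total_sig rscale2 opprD opprK.
by rewrite -addrA addrACA addNr addr0.
Qed.

Lemma component_tb_comm (k : I) (T : bop (H k) (H k)) : tb_comm T ->
  @tb_comm R A V V (hcomponent (Hs := Hs) T).
Proof.
move=> hT a.
have -> : bcomp (hcomponent (Hs := Hs) T : bop W W) (actb V a) - bcomp (actb V a)
  (hcomponent (Hs := Hs) T : bop W W)
    = bcomp (hinj Hs k) (bcomp (bcomp T (actb (H k) a) - bcomp (actb (H k) a) T) (hpr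
      Hs k)).
  apply: bopP => x; apply: functional_extensionality_dep => j.
  rewrite bopBE /= -!actbE.
  set y := T _; set z := T _.
  rewrite -[LHS]/(hinj_fun (Hs := Hs) y j - act a (hinj_fun (Hs := Hs) z j)).
  have [<-|kj] := eqVneq k j; first by rewrite !hinj_funE.
  by rewrite !hinj_fun_neq// actbE linear0 subrr.
by apply: tb_compl; exact: tb_compr.
Qed.

Lemma total_d_tb_comm : @tb_comm R A V V total_d.
Proof.
move=> a; apply: (hsum_tb (Hs := Hs)) => -[[|j] lt].
  have -> : bcomp (hpr Hs (Ordinal lt)) (bcomp total_d (actb V a) - bcomp (actb V a)
    total_d) = 0.
    apply: bopP => x; rewrite /= -total_dE -!actbE.
    by rewrite -[LHS]/(0 - act a (0 : H 0%N)) actbE linear0 subrr.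
  exact: tb0.
have [D e [_ Dc]] := admissible_bop (hd.1 j lt).
have -> : bcomp (hpr Hs (Ordinal lt)) (bcomp total_d (actb V a) - bcomp (actb V a)
  total_d) =
    bcomp (bcomp D (actb (H j) a) - bcomp (actb (H j.+1) a) D) (hpr Hs (Ordinal (ltnW
      lt))).
  apply: bopP => x; rewrite /= -total_dE -!actbE -e.
  by [].
exact: tb_compr.
Qed.

Lemma grading_comm a : grading * actb V a = actb V a * grading.
Proof.
apply: bopP => x; rewrite !bopME -!actbE; apply: functional_extensionality_dep => k.
rewrite hdiagE act_component actbE.
by rewrite -[RHS]/(act a (sgn k :r*: (x : hsum Hs) k)) actbE linearZ.
Qed.

Lemma resolution_operatorE (x : V) : @resolution_operator R A H P d n x =
  (total_d + adj total_d + total_sig) x.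
Proof.
have [_ PE _] := PbP.
rewrite /resolution_operator cokernel_projectionE PE total_dE adjointE.
rewrite (on_componentE (Hs := Hs) (i := ord0)) (on_componentE (Hs := Hs) (i := ord_max)).
rewrite !bopDE bopZE addrA; congr (_ + _ *: _).
by rewrite /sgn rmorphXn rmorphN1.
Qed.

End Resolution.

(** * Operator K-homology *)

Section KHomologySteps.
Variables (R : realType) (A : cstarAlgType R).

Lemma K1_class_eq (x y : kcycle A) (hx : is_fredholm x) (hy : is_fredholm y) :
  K1_equiv x y -> K1_class hx = K1_class hy.
Proof.
move=> xy; apply: eq_exist; apply/funext => z; apply/propext.
by split=> h; [apply: rst_trans h; exact: rst_sym|exact: rst_trans h].
Qed.

Lemma involution_degenerate (M : hilbertModule A) (G : bop M M) :
  G * G = 1 -> selfadj G -> (forall a, G * actb M a = actb M a * G) ->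
  is_degenerate (KCycle G).
Proof.
move=> GG Gs Ga; split; first exact: bop_bounded_op.
move=> a v /=; split.
- by rewrite -(bopME G G) GG.
- by rewrite adjointE (selfadj_adj Gs).
- by rewrite actbE -!bopME Ga.
Qed.

(** [K1_unitary] asks for Fredholm modules at both ends; the direct sum of F and G is again a
    self-adjoint involution. *)
Lemma kc_sum_fredholm (M N : hilbertModule A) (F : bop M M) (G : bop N N) :
  F * F = 1 -> selfadj F -> tb_comm F ->
  G * G = 1 -> selfadj G -> tb_comm G ->
  is_fredholm (kc_sum (KCycle F) (KCycle G)).
Proof.
move=> FF Fs Fc GG Gs Gc.
pose c b := if b then KCycle F else KCycle G.
have opb b : bounded_op (@kc_op R A (c b)) by case: b; exact: bop_bounded_op.
have [S SE] := bounded_op_bop (bounded_hsum_map opb).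
have -> : kc_sum (KCycle F) (KCycle G) =
    @KCycle R A (hsum_module (fun b => c b : hilbertModule A)) S by rewrite -SE.
have SEb (x : hsum (fun b => c b : hilbertModule A)) b : (S x : hsum (fun b => c b :
  hilbertModule A)) b = @kc_op R A (c b) (x b).
  by rewrite -SE.
apply: involution_fredholm.
- apply: bopP => x; apply: functional_extensionality_dep => b.
  rewrite bopME !SEb; case: b => /=; first by rewrite -(bopME F F) FF.
  by rewrite -(bopME G G) GG.
- move=> x y; rewrite !hsum_ip; apply: eq_bigr => b _; rewrite !SEb.
  by case: b; [exact: Fs|exact: Gs].
- move=> a; apply: (hsum_tb (Hs := fun b => c b : hilbertModule A)) => b.
  set K := bcomp _ _.
  have KE x : K x = @kc_op R A (c b) (act a (hpr (fun b => c b : hilbertModule A) b x))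
    - act a (@kc_op R A (c b) (hpr (fun b => c b : hilbertModule A) b x)).
    by rewrite /K /= -!actbE -SE.
  case: b @K KE => K KE.
    have -> : K = bcomp (bcomp F (actb M a) - bcomp (actb M a) F) (hpr (fun b => c b :
      hilbertModule A) true).
      by apply: bopP => x; rewrite KE /= !actbE.
    exact: tb_compr.
  have -> : K = bcomp (bcomp G (actb N a) - bcomp (actb N a) G) (hpr (fun b => c b :
    hilbertModule A) false).
    by apply: bopP => x; rewrite KE /= !actbE.
  exact: tb_compr.
Qed.

(** Rational parametrisation of the quarter circle from (1, 0) to (0, 1) over [0, 1]; its Lipschitz
    bounds reduce to polynomial estimates. *)
Definition circle_cos (t : R) : R := (1 - t ^+ 2) / (1 + t ^+ 2).
Definition circle_sin (t : R) : R := (t + t) / (1 + t ^+ 2).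

Lemma circle_den (t : R) : 1 <= 1 + t ^+ 2.
Proof. by rewrite lerDl sqr_ge0. Qed.

Lemma circle_eq1 (t : R) : circle_cos t ^+ 2 + circle_sin t ^+ 2 = 1.
Proof.
rewrite /circle_cos /circle_sin; field.
by rewrite gt_eqF// (lt_le_trans ltr01 (circle_den t)).
Qed.

Lemma circle_cos_lip (s t : R) : 0 <= s <= 1 -> 0 <= t <= 1 ->
  `|circle_cos s - circle_cos t| <= 4 * `|s - t|.
Proof.
move=> /andP[s0 s1] /andP[t0 t1].
have ds := circle_den s; have dt := circle_den t.
have d0 : 0 < (1 + s ^+ 2) * (1 + t ^+ 2) by rewrite mulr_gt0//; lra.
have -> : circle_cos s - circle_cos t = (s - t) * (- (2 * (s + t))) / ((1 + s ^+ 2) *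
  (1 + t ^+ 2)).
  by rewrite /circle_cos; field; apply/andP; split; rewrite gt_eqF//; lra.
rewrite normrM normfV (gtr0_norm d0) ler_pdivrMr// normrM [4 * _]mulrC -mulrA ler_wpM2l//.
have : 1 * 1 <= (1 + s ^+ 2) * (1 + t ^+ 2) by rewrite ler_pM.
rewrite normrN ger0_norm; lra.
Qed.

Lemma circle_sin_lip (s t : R) : 0 <= s <= 1 -> 0 <= t <= 1 ->
  `|circle_sin s - circle_sin t| <= 4 * `|s - t|.
Proof.
move=> /andP[s0 s1] /andP[t0 t1].
have ds := circle_den s; have dt := circle_den t.
have d0 : 0 < (1 + s ^+ 2) * (1 + t ^+ 2) by rewrite mulr_gt0//; lra.
have -> : circle_sin s - circle_sin t = (s - t) * (2 * (1 - s * t)) / ((1 + s ^+ 2) *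
  (1 + t ^+ 2)).
  by rewrite /circle_sin; field; apply/andP; split; rewrite gt_eqF//; lra.
have st : 0 <= s * t <= 1 by rewrite mulr_ge0// mulr_ile1.
move/andP : st => [st0 st1].
rewrite normrM normfV (gtr0_norm d0) ler_pdivrMr// normrM [4 * _]mulrC -mulrA ler_wpM2l//.
have : 1 * 1 <= (1 + s ^+ 2) * (1 + t ^+ 2) by rewrite ler_pM.
rewrite ger0_norm; lra.
Qed.

Lemma rotation_homotopy (M : hilbertModule A) (X Y Z : bop M M) :
  let F c u := c :r*: X + u :r*: Y + Z in
  (forall c u : R, c ^+ 2 + u ^+ 2 = 1 -> F c u * F c u = 1) ->
  (forall c u, selfadj (F c u)) -> (forall c u, tb_comm (F c u)) ->
  K1_step (KCycle (F 1 0)) (KCycle (F 0 1)).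
Proof.
move=> F FF Fs Fc; pose f t := F (circle_cos t) (circle_sin t).
have f0 : F 1 0 = f 0.
  by rewrite /f /circle_cos /circle_sin expr0n /= subr0 addr0 divr1 addr0 mul0r.
have f1 : F 0 1 = f 1.
  have c1 : circle_cos 1 = 0 by rewrite /circle_cos expr1n subrr mul0r.
  have s1 : circle_sin 1 = 1 by rewrite /circle_sin expr1n divff// -[1 + 1]/(2%:R)
    pnatr_eq0.
  by rewrite /f c1 s1.
rewrite f0 f1; apply: (@K1_homotopy R A M (fun t => f t)); split=> [t _|t t01 e e0].
  by apply: involution_fredholm; [apply: FF; exact: circle_eq1|exact: Fs|exact: Fc].
have [K K0 hK] := bop_bound X; have [L L0 hL] := bop_bound Y.
(* The norm of f s - f t is at most 4 |s - t| (K + L), with 4 the Lipschitz constant of both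
   coefficients. *)
exists (e / (4 * (K + L))); first by rewrite divr_gt0// mulr_gt0// addr_gt0.
move=> s s01 st v; rewrite !nmE -rmorphM lecR -bopBE.
have -> : f s - f t = (circle_cos s - circle_cos t) :r*: X + (circle_sin s - circle_sin
  t) :r*: Y.
  by rewrite /f /F !rscaleBl opprD addrACA subrr addr0 opprD addrACA.
have := bounded_byD (bounded_byZ (circle_cos s - circle_cos t) hK) (bounded_byZ
  (circle_sin s - circle_sin t) hL).
move=> /(_ v) /le_trans; apply; rewrite ler_wpM2r//.
apply: (@le_trans _ _ (4 * `|s - t| * K + 4 * `|s - t| * L)).
  by rewrite lerD// ler_wpM2r ?(ltW K0) ?(ltW L0)//; [exact: circle_cos_lip|exact:
    circle_sin_lip].
rewrite -mulrDr mulrAC; move: st; rewrite ltr_pdivlMr ?mulr_gt0 ?addr_gt0//.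
by rewrite mulrC => /ltW.
Qed.

End KHomologySteps.

(** * Splitting off degree 0 of the total module *)

Section SplitHead.
Variables (R : realType) (A : cstarAlgType R) (n : nat).
Variables (H : nat -> hilbertModule A).
Local Notation V := (total_module H n).
Local Notation Hs := (fun k : 'I_n.+1 => hmod_space (H k)).

(** Degrees 1 to n; for n = 0 the index type is empty and the tail is the zero module. *)
Definition tail_family (i : 'I_n) : hilbertModule A := H (lift ord0 i).
Definition tail_module : hilbertModule A := hsum_module tail_family.
Definition tail_grading : bop tail_module tail_module :=
  hdiag (fun i => hmod_space (tail_family i)) (fun i => sgn R (lift ord0 i)).

Lemma tail_grading_sq : tail_grading * tail_grading = 1.
Proof. by apply: hdiag_sq => i; exact: sgn_sq. Qed.

Lemma tail_grading_selfadj : selfadj tail_grading.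
Proof. exact: hdiag_selfadj. Qed.

Lemma tail_grading_comm a : tail_grading * actb tail_module a = actb tail_module a *
  tail_grading.
Proof.
apply: bopP => x; rewrite !bopME -!actbE; apply: functional_extensionality_dep => k.
rewrite hdiagE -[RHS]/(act a (sgn R (lift ord0 k) :r*: (x : hsum (fun i => hmod_space
  (tail_family i))) k)).
by rewrite -[(act a x : hsum _) k]/(act a ((x : hsum (fun i => hmod_space (tail_family
  i))) k)) !actbE linearZ.
Qed.

Variables (f : H 0%N -> H 0%N).
Local Notation X := (KCycle f).
Local Notation Z := (KCycle tail_grading).

Definition split_head (x : hsum Hs) : kc_sum X Z := fun b =>
  match b return (if b then X else Z : kcycle A) with
  | true => x ord0
  | false => fun i : 'I_n => x (lift ord0 i)
  end.

Definition join_head (y : kc_sum X Z) : hsum Hs := fun k : 'I_n.+1 =>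
  let: Ordinal m ltm := k return H k in
  match m return (m < n.+1)%N -> H m with
  | 0 => fun=> y true
  | j.+1 => fun ltj => y false (Ordinal (ltj : (j < n)%N))
  end ltm.

Lemma split_headK : cancel split_head join_head.
Proof.
move=> x; apply: functional_extensionality_dep => -[[|j] lt] /=.
  by rewrite (bool_irrelevance lt (ltn0Sn n)).
rewrite /lift; exact: (@congr1 (j.+1 < n.+1)%N (H j.+1) (fun q => x (Ordinal q)) _ _
  (bool_irrelevance _ lt)).
Qed.

Lemma join_headK : cancel join_head split_head.
Proof.
move=> y; apply: functional_extensionality_dep => -[] //.
apply: functional_extensionality_dep => -[i lt] /=.
exact: (@congr1 (i < n)%N (H i.+1)
  (fun q => (y false : hsum (fun i => hmod_space (tail_family i))) (Ordinal q)) _ _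
  (bool_irrelevance _ lt)).
Qed.

Lemma split_head_unitary (G : V -> V) :
  (forall x : hsum Hs, (G x : hsum Hs) ord0 = f (x ord0)) ->
  (forall (x : hsum Hs) i, (G x : hsum Hs) (lift ord0 i) = sgn R (lift ord0 i) :r*: x
    (lift ord0 i)) ->
  unitarily_equivalent (KCycle G) (kc_sum X Z).
Proof.
move=> G0 GS; exists split_head; split.
- by move=> k x y; apply: functional_extensionality_dep => -[].
- by exists join_head; [exact: split_headK|exact: join_headK].
- move=> u v; rewrite -[LHS]/(hsum_inner (split_head u) (split_head v)).
  rewrite -[RHS]/(hsum_inner (u : hsum Hs) (v : hsum Hs)).
  by rewrite /hsum_inner big_bool /= big_ord_recl.
- by move=> a v; apply: functional_extensionality_dep => -[].
- move=> v; apply: functional_extensionality_dep => -[] /=; first exact: G0.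
  by apply: functional_extensionality_dep => i; exact: GS.
Qed.

End SplitHead.

Theorem theorem2p4 (R : realType) (A : cstarAlgType R) (n : nat)
    (H : nat -> hilbertModule A) (P : H 0%N -> H 0%N)
    (hP : admissible_projection P)
    (d : forall j : nat, H j -> H j.+1)
    (hd : admissible_resolution P d n) :
  let D : total_module H n -> total_module H n :=
    @resolution_operator R A H P d n in
  exists hQ : admissible_projection (positive_spectral_projection D),
    toeplitz_class hP = toeplitz_class hQ.
Proof.
pose V := total_module H n; pose W := hmod_space V.
pose dT : bop W W := total_d hd; pose Pi : bop W W := total_Pi hP hd.
pose sig : bop W W := total_sig hP hd; pose g : bop W W := @grading R A n H.
have Pip : is_proj Pi := total_Pi_proj hP hd.
have sigs : selfadj sig := total_sig_selfadj hP hd.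
have sigsig : sig * sig = Pi := total_sig_sq hP hd.
have Pisig : Pi * sig = sig := total_Pi_sig hP hd.
have dd : dT * dT = 0 by exact: total_d_sq.
have dPi : dT * Pi = 0 by exact: total_dPi.
have Pid : Pi * dT = 0 by exact: total_Pid.
have ex x : dT x = 0 -> Pi x = 0 -> range dT x by exact: total_exact.
have cl : closed (range dT) by exact: total_d_closed.
have gs : selfadj g  by exact: grading_selfadj.
have gg : g * g = 1  by exact: grading_sq.
have gd : g * dT = - (dT * g) by exact: grading_d.
have gPi : g * Pi = Pi * g by exact: grading_Pi.
have hJ := @compact_ideal R W.
have dc (a : A) : comm_mod (@tb R W W) dT (actb V a) by exact: total_d_tb_comm.
(* The adjoint of the action of [a] is the action of [astar a], so commutators with dT suffice. *)
have dac (a : A) : comm_mod (@tb R W W) (adj dT) (actb V a).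
  by apply: comm_mod_adj; rewrite adj_actb.
have [Pp PE Pc] := PbP hP; have [Qp _ Qc] := QbP hP hd.
have Cc : tb_comm (Cb hP hd).
  move=> a; have hn := @compact_ideal R (H n).
  by apply: (comm_modB hn) (Qc a); exact: (comm_mod1 hn).
have tPc (a : A) : comm_mod (@tb R W W) (total_P n hP) (actb V a).
  exact: (component_tb_comm (n := n) (k := ord0) Pc).
have tCc (a : A) : comm_mod (@tb R W W) (total_C hP hd) (actb V a).
  exact: (component_tb_comm (n := n) (k := ord_max) Cc).
have Pic (a : A) : comm_mod (@tb R W W) Pi (actb V a) by exact: (comm_modD hJ).
have sigc (a : A) : comm_mod (@tb R W W) sig (actb V a).
  by apply: (comm_modD hJ) => //; exact: (comm_modZ hJ).
have gc (a : A) : comm_mod (@tb R W W) g (actb V a).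
  by rewrite /comm_mod grading_comm subrr; exact: tb0.
pose D : bop W W := dT + adj dT + sig.
have Ds : selfadj D := hodge_selfadj sigs (erefl D).
have [F [FF Fs FD FD0 FE]] := positive_spectral_projection_sign Ds.
have DE : @resolution_operator R A H P d n = D.
  by apply/funext => x; exact: resolution_operatorE.
rewrite /= DE.
pose rot := rotation sig F g (1 - Pi).
have rot0 : rot 1 0 = F.
  exact: (rotation0 Pip sigs sigsig Pisig dPi Pid (erefl D) FF FD FD0 g (erefl (1 - Pi))).
have rots c u : selfadj (rot c u).
  exact: (rotation_selfadj Pip sigs sigsig Pisig dd dPi Pid ex cl (erefl D) FF Fs FD
    FD0 gs gPi (erefl (1 - Pi))).
have rotsq c u : c ^+ 2 + u ^+ 2 = 1 -> rot c u * rot c u = 1.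
  exact: (rotation_sq Pip sigs sigsig Pisig dd dPi Pid ex cl (erefl D) FF Fs FD FD0 gs
    gg gd gPi (erefl (1 - Pi))).
have rotc c u : @tb_comm R A V V (rot c u).
  move=> a; exact: (rotation_comm Pip sigs sigsig Pisig dd dPi Pid ex cl (erefl D) FF
    Fs FD FD0 (erefl (1 - Pi)) c u (dc a) (dac a) (Pic a) (sigc a) (gc a)).
pose E : bop W W := 2^-1 :r*: (1 + F).
have Ep : is_proj E.
  split; last by apply: selfadjZ; exact: selfadjD.
  rewrite /E -scalebAl -scalebAr mulrDl mul1r mulrDr mulr1 FF [F + 1]addrC -rscale2.
  by congr (_ *: _); rewrite rscaleA mulVf ?pnatr_eq0// rscale1.
have Ec : @tb_comm R A V V E.
  move=> a; apply: (comm_modZ hJ); apply: (comm_modD hJ); first exact: (comm_mod1 hJ).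
  by rewrite -rot0; exact: rotc.
have -> : positive_spectral_projection D = E by apply/funext => x; rewrite FE.
have hE : @admissible_projection R A V E := proj_admissible Ep Ec.
exists hE; apply: K1_class_eq.
pose Z := KCycle (tail_grading n H).
pose T : bop (H 0%N) (H 0%N) := 2 :r*: Pb hP - 1.
have TE : toeplitz_cycle P = KCycle T.
  rewrite /toeplitz_cycle PE; congr KCycle; apply/funext => x.
  by rewrite /T bopBE bopZE bop1E rmorph_nat.
have FEq : @toeplitz_cycle R A V E = KCycle (rot 1 0).
  rewrite rot0 /toeplitz_cycle; congr KCycle; apply/funext => x.
  rewrite /E bopZE bopDE bop1E -(rmorph_nat (real_complex R)) rscaleA mulfV ?pnatr_eq0//.
  by rewrite rscale1 addrAC subrr add0r.
have TT : T * T = 1 by exact: reflection_sq.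
have Ts : selfadj T by apply: selfadjB => //; apply: selfadjZ; exact: Pp.2.
have Tc : tb_comm T.
  move=> a; have h0 := @compact_ideal R (H 0%N).
  by apply: (comm_modB h0); [apply: (comm_modZ h0); exact: Pc|exact: (comm_mod1 h0)].
have tgc : tb_comm (tail_grading n H).
  move=> a; rewrite -[tb _]/(comm_mod (@tb R _ _) (tail_grading n H) (actb (tail_module
    n H) a)).
  by rewrite /comm_mod tail_grading_comm subrr; exact: tb0.
have xT : is_fredholm (KCycle T) by exact: involution_fredholm.
(* The two ends meet in this sum: the class of P reaches it by adding the degenerate tail, that of
   P_+(D) by rotating to [rot 0 1] and splitting off degree 0. *)
apply: (@rst_trans _ _ _ (kc_sum (KCycle T) Z)).
  rewrite TE; apply: rst_step; apply: K1_degenerate => //.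
  apply: involution_degenerate; [exact: tail_grading_sq|exact: tail_grading_selfadj|].
  exact: tail_grading_comm.
apply: rst_sym; rewrite FEq; apply: (@rst_trans _ _ _ (@KCycle R A V (rot 0 1))).
  by apply: rst_step; exact: (rotation_homotopy rotsq rots rotc).
apply: rst_step; apply: K1_unitary.
- by apply: involution_fredholm => //; apply: rotsq; rewrite expr0n expr1n add0r.
- apply: kc_sum_fredholm => //; [exact: tail_grading_sq|exact: tail_grading_selfadj].
(* In degree 0 this sum is 2 P - 1, that is [T]; in degree k > 0 it is the sign of the grading. *)
- have rE : rot 0 1 = g + 2 :r*: total_P n hP.
    by rewrite /rot rotation1; exact: rotation_end.
  rewrite rE; apply: split_head_unitary => [x|x i].
    rewrite -[LHS]/(g x ord0 + 2 :r*: total_P n hP x ord0) hdiagE total_P_head.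
    by rewrite /sgn expr1 rscaleNl rscale1 addrC.
  rewrite -[LHS]/(g x (lift ord0 i) + 2 :r*: total_P n hP x (lift ord0 i)) hdiagE.
  by rewrite total_P_tail scaler0 addr0.
Qed.
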